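(* Let $H$ be a cocommutative Hopf algebra over a field $\mathbf k$ of characteristic $0$. There is an isomorphism of vector spaces $$\Omega_2(H)\cong\frac{\overline{H^{\otimes2}}}{\langle\mathrm{Id}-\tau,\ \mathrm{Id}-S\otimes S,\ \mathrm{Id}+\gamma+\gamma^2,\ \eta\epsilon\otimes\mathrm{Id}\rangle}.$$ That is, $\Omega_2(H)$ is presented by $\overline{H^{\otimes2}}$ modulo the relations, for all $a,b\in H$: (1) $a\otimes b=b\otimes a=S(a)\otimes S(b)$; (2) $\eta(1)\otimes a=0$; (3) $a\otimes b+S(b)a_{(1)}\otimes a_{(2)}+b_{(1)}\otimes S(a)b_{(2)}=0$.
   Context: $H$ has coproduct $\Delta$ (Sweedler notation), unit $\eta$, counit $\epsilon$, antipode $S$. $H$ acts on $H^{\otimes n}$ by conjugation: $h\circledast(h_1\otimes\cdots\otimes h_n)=h_{(1)}h_1S(h_{(2)})\otimes\cdots\otimes h_{(2n-1)}h_nS(h_{(2n)})$, and $\overline{H^{\otimes n}}$ is the quotient of $H^{\otimes n}$ by the span of all $(h-\eta\epsilon(h))\circledast(h_1\otimes\cdots\otimes h_n)$. On $\overline{H^{\otimes2}}$ (operators acting on the right): $(a\otimes b)\tau=b\otimes a$, $(a\otimes b)\gamma=S(b_{(1)})\otimes aS(b_{(2)})$. $\langle r_1,\dots,r_j\rangle$ denotes the sum of the images of the operators $r_i$. Definition of $\Omega_n(H)$. For a cyclic operad $\mathcal O$, $\mathcal O((n))=\mathcal O[n-1]$ denotes the operations with $n$ input/output slots, a $\Sigma_n$-module.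 $\mathsf{Lie}((n))$ is spanned by vertex-oriented trivalent trees with $n$ labeled leaves modulo antisymmetry and IHX relations. $H$ is regarded as a cyclic operad with elements only of arity $1$, composition given by multiplication and the generator of $\Sigma_2$ acting by $S$. The cyclic operad $H\mathsf{Lie}$ is the quotient of the operad freely generated by $H$ and $\mathsf{Lie}$ (units identified) by the relation that $h\in H$ composed with the output of $o\in\mathsf{Lie}[n]$ equals $o$ with $h_{(1)},\dots,h_{(n)}$ composed with its $n$ inputs. The graph complex $\mathcal G_{H\mathsf{Lie}}$ is spanned by oriented finite graphs without univalent or isolated vertices (bivalent vertices allowed), each vertex $v$ decorated by an element of $H\mathsf{Lie}((|v|))$ with slots identified with the adjacent half-edges, multilinearly in the decorations; an orientation is an ordering of the vertices and a direction of each edge, an odd change giving a sign. It is graded by the number of vertices, and $\partial$ is the sum over non-loop edges of contracting the edge and composing the decorations. $\mathcal G^{(n)}_{H\mathsf{Lie}}$ is spanned by connected graphs of rank (first Betti number) $n$; $\mathcal G^{(n)}_{H\mathsf{Lie},j}$ is its part with $j$ vertices. $\overline{\mathcal G^{(n)}_{H\mathsf{Lie}}}$ is the quotient complex in which elements of $H$ may slide along an edge, from the slot at one end to the slot at the other end. Let $\mathcal S_2\subset\mathcal G^{(n)}_{H\mathsf{Lie},2}$ be spanned by the two-vertex graphs in which one of the two vertices is decorated by an element of $\mathsf{Lie}((3))\subset H\mathsf{Lie}((3))$ (a tripod). Then $\Omega_n(H)=\overline{\mathcal G^{(n)}_{H\mathsf{Lie},1}}/\partial\mathcal S_2$. *)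

(* Defs.v *)
From HB Require Import structures.
From mathcomp Require Import all_boot all_algebra ring_quotient generic_quotient.
From mathcomp Require Import boolp.
From mathcomp Require Import freeg.

Set Implicit Arguments.
Unset Strict Implicit.
Unset Printing Implicit Defensive.

Import GRing.Theory.
Local Open Scope ring_scope.
Local Open Scope quotient_scope.

(* ------------------------------------------------------------------------ *)
(* Quotient of a vector space V by the span of a set P of vectors.          *)

Section Quot.
Variables (k : fieldType) (V : lmodType k) (P : V -> Prop).

Definition in_span (v : V) : Prop :=
  exists2 s : seq (k * V),
    forall c, c \in s -> P c.2 & v = \sum_(c <- s) c.1 *: c.2.

Definition span_pred : {pred V} := fun v => `[< in_span v >].

Lemma in_span0 : in_span 0.
Proof. by exists [::] => //; rewrite big_nil. Qed.

Lemma in_spanZD a u v : in_span u -> in_span v -> in_span (a *: u + v).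
Proof.
move=> [s sP ->] [t tP ->]; exists ([seq (a * c.1, c.2) | c <- s] ++ t).
  by move=> c; rewrite mem_cat => /orP[/mapP[d /sP dP ->]|/tP].
rewrite big_cat big_map scaler_sumr; congr (_ + _).
by apply: eq_bigr => c _; rewrite scalerA.
Qed.

Lemma in_span_gen v : P v -> in_span v.
Proof.
move=> Pv; exists [:: (1, v)]; last by rewrite big_seq1 scale1r.
by move=> c; rewrite inE => /eqP->.
Qed.

Lemma span_zmod_closed : zmod_closed span_pred.
Proof.
split=> [|u v /asboolP su /asboolP sv]; apply/asboolP; first exact: in_span0.
by rewrite addrC -scaleN1r; apply: in_spanZD.
Qed.

HB.instance Definition _ := GRing.isZmodClosed.Build V span_pred span_zmod_closed.

Definition quot : Type := Quotient.quot span_pred.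

HB.instance Definition _ := GRing.Zmodule.on quot.

Definition pr (v : V) : quot := \pi_(Quotient.quot span_pred) v.

Lemma pr_eqP u v : pr u = pr v <-> in_span (u - v).
Proof.
split; first by move/eqP; rewrite -Quotient.idealrBE => /asboolP.
by move=> uv; apply/eqP; rewrite -Quotient.idealrBE; apply/asboolP.
Qed.

Definition quot_scale (a : k) (x : quot) : quot :=
  pr (a *: repr (x : Quotient.quot span_pred)).

Lemma pr_repr (x : quot) : pr (repr (x : Quotient.quot span_pred)) = x.
Proof. exact: (@reprK _ (Quotient.quot span_pred)). Qed.

Lemma pr_scale a v : pr (a *: v) = quot_scale a (pr v).
Proof.
apply/pr_eqP; rewrite -scalerBr -[_ *: _]addr0.
by apply: in_spanZD (in_span0); apply/pr_eqP; rewrite pr_repr.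
Qed.

Lemma pr_add u v : pr (u + v) = pr u + pr v.
Proof. exact: (@Quotient.pi_add _ span_pred). Qed.

Fact quot_scalerA a b x : quot_scale a (quot_scale b x) = quot_scale (a * b) x.
Proof. by rewrite -(pr_repr x) -!pr_scale scalerA. Qed.
Fact quot_scale1r : left_id 1 quot_scale.
Proof. by move=> x; rewrite -(pr_repr x) -pr_scale scale1r. Qed.
Fact quot_scalerDr : right_distributive quot_scale +%R.
Proof.
by move=> a x y; rewrite -(pr_repr x) -(pr_repr y) -!(pr_scale, pr_add) scalerDr.
Qed.
Fact quot_scalerDl x : {morph quot_scale^~ x : a b / a + b}.
Proof. by move=> a b; rewrite -(pr_repr x) -!(pr_scale, pr_add) scalerDl. Qed.

HB.instance Definition _ := GRing.Zmodule_isLmodule.Build k quot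
  quot_scalerA quot_scale1r quot_scalerDr quot_scalerDl.

Fact pr_linear : linear pr.
Proof. by move=> a u v; rewrite pr_add pr_scale. Qed.

HB.instance Definition _ := GRing.isLinear.Build k V quot _ pr pr_linear.

End Quot.

Notation freemod k T := {freeg T / k}.

Lemma fglift_linear (k : fieldType) (T : choiceType) (V : lmodType k)
  (f : T -> V) : linear (fglift f).
Proof.
have fB := @lift_is_additive k T V f.
pose g := HB.pack_for {additive freemod k T -> V} (fglift f)
  (GRing.isZmodMorphism.Build _ _ (fglift f) fB).
have gE : fglift f = g by [].
have fZ a D : fglift f (a *: D) = a *: fglift f D.
  have -> : a *: D = \sum_(x <- dom D) << a * coeff x D *g x >> by [].
  rewrite -[in RHS](freeg_sumE D) gE !raddf_sum /=.
  by apply: eq_bigr => z _; rewrite !liftU scalerA.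
by move=> a u v; have -> : fglift f (a *: u + v) = _ := raddfD g _ _; rewrite /= fZ.
Qed.

(* ------------------------------------------------------------------------ *)
(* Tensor products.                                                         *)

Section Tensor.
Variables (k : fieldType) (U V : lmodType k).

Inductive bilin_rel : freemod k (U * V)%type -> Prop :=
| BilinL a u u' v :
    bilin_rel (<< (a *: u + u', v) >> - a *: << (u, v) >> - << (u', v) >>)
| BilinR a u v v' :
    bilin_rel (<< (u, a *: v + v') >> - a *: << (u, v) >> - << (u, v') >>).

Definition tensor : lmodType k := quot bilin_rel.

Definition tens (u : U) (v : V) : tensor := pr bilin_rel << (u, v) >>.

(* The linear map on the tensor product induced by a bilinear map f. In
   Sweedler notation, tlift f (Delta h) is f h_(1) h_(2). *)
Definition tlift (W : lmodType k) (f : U -> V -> W) (z : tensor) : W :=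
  fglift (fun p => f p.1 p.2) (repr (z : Quotient.quot (span_pred bilin_rel))).

Section Lift.
Variables (W : lmodType k) (f : U -> V -> W).
Hypotheses (fl : forall v, linear (f^~ v)) (fr : forall u, linear (f u)).

Lemma tlift_pr x : tlift f (pr bilin_rel x) = fglift (fun p => f p.1 p.2) x.
Proof.
have [F FE] : exists F : {linear freemod k (U * V)%type -> W},
    forall y, fglift (fun p : U * V => f p.1 p.2) y = F y.
  pose lin := GRing.isLinear.Build _ _ _ _ _
    (fglift_linear (fun p : U * V => f p.1 p.2)).
  by exists (HB.pack_for {linear freemod k (U * V)%type -> W}
    (fglift (fun p : U * V => f p.1 p.2)) lin).
rewrite /tlift !FE; set y := repr _.
have /pr_eqP [s sP xyE] : pr bilin_rel y = pr bilin_rel x by apply: pr_repr.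
apply/eqP; rewrite -subr_eq0 -raddfB xyE.
rewrite raddf_sum big1_seq //= => c /sP cP; rewrite linearZ /=.
have FB b y1 y2 y3 : F (y1 - b *: y2 - y3) = F y1 - b *: F y2 - F y3.
  by have <- : F (b *: y2) = b *: F y2 := linearZZ F b y2; rewrite !raddfB.
have FU p : F << p >> = f p.1 p.2 by rewrite -FE liftU scale1r.
have fl' b u u' v : f (b *: u + u') v = b *: f u v + f u' v by apply: fl.
suff -> : F c.2 = 0 by rewrite scaler0.
by case: c.2 / cP => [a u u' v|a u v v']; rewrite FB !FU /= (fl', fr)
  addrAC addrK subrr.
Qed.

Lemma tlift_tens u v : tlift f (tens u v) = f u v.
Proof. by rewrite tlift_pr liftU scale1r. Qed.

Lemma tlift_linear : linear (tlift f).
Proof.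
move=> a x y; rewrite -(pr_repr x) -(pr_repr y) -linearP !tlift_pr.
exact: fglift_linear.
Qed.

End Lift.
End Tensor.

(* ------------------------------------------------------------------------ *)
(* Hopf algebras.                                                           *)

Record hopf (k : fieldType) (H : algType k) := Hopf {
  cop : {linear H -> tensor H H};
  cou : {linear H -> k^o};
  antip : {linear H -> H};
  hopf_coassoc : forall h,
    tlift (fun x y => tens x (cop y)) (cop h) =
    tlift (fun x y => tlift (fun x1 x2 => tens x1 (tens x2 y)) (cop x)) (cop h);
  hopf_coul : forall h, tlift (fun x y => cou x *: y) (cop h) = h;
  hopf_cour : forall h, tlift (fun x y => cou y *: x) (cop h) = h;
  hopf_cop1 : cop 1 = tens 1 1;
  hopf_copM : forall g h, cop (g * h) =
    tlift (fun x y => tlift (fun z w => tens (x * z) (y * w)) (cop h)) (cop g);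
  hopf_cou1 : cou 1 = 1;
  hopf_couM : forall g h, cou (g * h) = cou g * cou h :> k;
  hopf_antipl : forall h, tlift (fun x y => antip x * y) (cop h) = cou h *: 1;
  hopf_antipr : forall h, tlift (fun x y => x * antip y) (cop h) = cou h *: 1
}.

Section HopfTheory.
Variables (k : fieldType) (H : algType k) (hH : hopf H).
Local Notation "'\Delta'" := (cop hH).
Local Notation "'\eps'" := (cou hH).
Local Notation S := (antip hH).

Definition cocommutative : Prop :=
  forall h, tlift (fun x y => tens y x) (\Delta h) = \Delta h.

(* tpow n is H^{(x)(n+1)}, bracketed to the right; only the values
   p 0, ..., p n of p enter its elementary tensor ptens n p. *)
Fixpoint tpow (n : nat) : lmodType k :=
  if n is n'.+1 then tensor H (tpow n') else H.

Fixpoint ptens (n : nat) (p : nat -> H) : tpow n :=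
  if n is n'.+1 return tpow n then tens (p 0%N) (ptens n' (fun i => p i.+1))
  else p 0%N.

Fixpoint copn (n : nat) (h : H) : tpow n :=
  if n is n'.+1 return tpow n then tlift (fun x y => tens x (copn n' y)) (\Delta h)
  else h.

(* The sum over p in s of p 0 (x) ... (x) p n is an expression of
   h_(1) (x) ... (x) h_(n+1). *)
Definition sweedler (n : nat) (h : H) (s : seq (nat -> H)) : Prop :=
  copn n h = \sum_(p <- s) ptens n p.

(* Relations of the conjugation coinvariants of H^{(x)(n+1)}. *)
Inductive conj_rel (n : nat) : tpow n -> Prop :=
| ConjRel (h : H) (a : nat -> H) (s : seq (nat -> H)) :
    sweedler n.*2.+1 (h - (\eps h : k) *: 1) s ->
    conj_rel
      (\sum_(p <- s) ptens n (fun i => p i.*2 * a i * S (p i.*2.+1))).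

Definition Hbar (n : nat) : lmodType k := quot (@conj_rel n).

(* Operators on H (x) H; those of the same name on Hbar 1 are induced by them. *)
Definition tau : tensor H H -> tensor H H := tlift (fun a b => tens b a).
Definition SxS : tensor H H -> tensor H H := tlift (fun a b => tens (S a) (S b)).
Definition gam : tensor H H -> tensor H H :=
  tlift (fun a b => tlift (fun b1 b2 => tens (S b1) (a * S b2)) (\Delta b)).
Definition etaepsxId : tensor H H -> tensor H H :=
  tlift (fun a b => tens ((\eps a : k) *: 1) b).

Local Notation cls := (pr (@conj_rel 1)).

Inductive op_rel : Hbar 1 -> Prop :=
| OpTau (z : tensor H H) : op_rel (cls (z - tau z))
| OpSS (z : tensor H H) : op_rel (cls (z - SxS z))
| OpGam (z : tensor H H) : op_rel (cls (z + gam z + gam (gam z)))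
| OpEta (z : tensor H H) : op_rel (cls (etaepsxId z)).

Inductive elt_rel : Hbar 1 -> Prop :=
| EltTau a b : elt_rel (cls (tens a b) - cls (tens b a))
| EltSS a b : elt_rel (cls (tens a b) - cls (tens (S a) (S b)))
| EltEta a : elt_rel (cls (tens 1 a))
| EltGam a b : elt_rel
    (cls (tens a b
          + tlift (fun a1 a2 => tens (S b * a1) a2) (\Delta a)
          + tlift (fun b1 b2 => tens b1 (S a * b2)) (\Delta b))).

End HopfTheory.

(* ------------------------------------------------------------------------ *)
(* The cyclic operad HLie.                                                  *)

(* Planar binary trees with leaves labelled by L and with elements of H placed
   on their edges; [Op h t] is h applied to the output of t. A pair (s, t) is
   the unrooted tree obtained by gluing the roots of s and t; a leaf x carrying
   h as an input is [Op h (Lf x)]. *)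
Inductive tm (H L : Type) : Type :=
| Lf of L
| Br of tm H L & tm H L
| Op of H & tm H L.
Arguments Lf {H L}.
Arguments Br {H L}.
Arguments Op {H L}.

HB.instance Definition _ (H L : Type) := gen_eqMixin (tm H L).
HB.instance Definition _ (H L : Type) := gen_choiceMixin (tm H L).

Notation tree H L := (tm H L * tm H L)%type.

Section Trees.
Variables (H : Type).

Fixpoint bind (L L' : Type) (f : L -> tm H L') (t : tm H L) : tm H L' :=
  match t with
  | Lf x => f x
  | Br t1 t2 => Br (bind f t1) (bind f t2)
  | Op h t1 => Op h (bind f t1)
  end.

Fixpoint leaves (L : Type) (t : tm H L) : seq L :=
  match t with
  | Lf x => [:: x]
  | Br t1 t2 => leaves t1 ++ leaves t2
  | Op _ t1 => leaves t1
  end.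

Fixpoint lie (L : Type) (t : tm H L) : bool :=
  match t with
  | Lf _ => true
  | Br t1 t2 => lie t1 && lie t2
  | Op _ _ => false
  end.

Definition tbind (L L' : Type) (f : L -> tm H L') (t : tree H L) : tree H L' :=
  (bind f t.1, bind f t.2).
Definition slots (L : Type) (t : tree H L) : seq L := leaves t.1 ++ leaves t.2.
Definition tlie (L : Type) (t : tree H L) : bool := lie t.1 && lie t.2.
Definition relab (L L' : Type) (f : L -> L') : tree H L -> tree H L' :=
  tbind (fun x => Lf (f x)).

End Trees.

Section HLie.
Variables (k : fieldType) (H : algType k) (hH : hopf H) (L : choiceType).
Local Notation S := (antip hH).
Local Notation tm := (tm H L).

(* The trees with slots X; [tr X t] is the basis vector t (0 if t is not
   one of these trees). *)
Definition treeOn (X : seq L) := {t : tree H L | perm_eq (slots t) X}.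

Definition tr (X : seq L) (t : tree H L) : freemod k (treeOn X) :=
  if insub t is Some u then << u >> else 0.

(* The first two relations identify the pairs presenting the same unrooted
   tree; since any edge can thus be made the gluing edge, the other relations
   need only be imposed there. HIhx: IHX in its Jacobi form. HInv: turning an edge around acts on its
   H-label by the antipode. HSlide: h composed with the output of o, an
   element of Lie[n+1] with inputs 0, ..., n, into which the f i are plugged. *)
Inductive HLie_rel (X : seq L) : freemod k (treeOn X) -> Prop :=
| HSym (s t : tm) : HLie_rel (tr X (s, t) - tr X (t, s))
| HRot (s t u : tm) : HLie_rel (tr X (Br s t, u) - tr X (s, Br t u))
| HInv h (s t : tm) : HLie_rel (tr X (Op h s, t) - tr X (s, Op (S h) t))
| HAs (s t u : tm) : HLie_rel (tr X (Br s t, u) + tr X (Br t s, u))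
| HIhx (s t u v : tm) : HLie_rel
    (tr X (Br (Br s t) u, v) + tr X (Br (Br t u) s, v) + tr X (Br (Br u s) t, v))
| HLin a g h (s t : tm) : HLie_rel
    (tr X (Op (a *: g + h) s, t) - a *: tr X (Op g s, t) - tr X (Op h s, t))
| HUnit (s t : tm) : HLie_rel (tr X (Op 1 s, t) - tr X (s, t))
| HMul g h (s t : tm) : HLie_rel
    (tr X (Op (g * h) s, t) - tr X (Op g (Op h s), t))
| HSlide n (h : H) (sw : seq (nat -> H)) (o : Defs.tm H nat) (f : nat -> tm)
    (t : tm) :
    lie o -> perm_eq (leaves o) (iota 0 n.+1) -> sweedler hH n h sw ->
    HLie_rel (tr X (Op h (bind f o), t)
      - \sum_(p <- sw) tr X (bind (fun i => Op (p i) (f i)) o, t)).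

Definition HLie (X : seq L) : lmodType k := quot (@HLie_rel X).

Definition hl (X : seq L) (t : tree H L) : HLie X := pr (@HLie_rel X) (tr X t).

(* Composition of s and t, the slot a of s being glued to the slot b of t. *)
Fixpoint reroot (b : L) (t acc : tm) : tm :=
  match t with
  | Lf _ => acc
  | Br t1 t2 => if b \in leaves t1 then reroot b t1 (Br t2 acc)
                else reroot b t2 (Br acc t1)
  | Op h t1 => reroot b t1 (Op (S h) acc)
  end.

Definition glue (a b : L) (s t : tree H L) : tree H L :=
  let t' := if b \in leaves t.1 then reroot b t.1 t.2 else reroot b t.2 t.1 in
  tbind (fun x => if x == a then t' else Lf x) s.

End HLie.

(* ------------------------------------------------------------------------ *)
(* The graph complex.                                                       *)

(* The edges of a graph are named by natural numbers; the edge e is directed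
   from its half-edge (e, false) to its half-edge (e, true). A graph is the
   sequence of its vertices, in the order given by the orientation, each
   decorated by a tree whose slots are the adjacent half-edges. *)
Definition hedge : Type := (nat * bool)%type.
HB.instance Definition _ := Choice.on hedge.

Definition flip (a : hedge) : hedge := (a.1, ~~ a.2).

Section Graphs.
Variables (k : fieldType) (H : algType k) (hH : hopf H).
Local Notation S := (antip hH).
Local Notation tree := (tree H hedge).

Definition hedges (g : seq tree) : seq hedge := flatten [seq slots v | v <- g].

Definition edges (g : seq tree) : seq nat := [seq a.1 | a <- hedges g & ~~ a.2].

(* The position of the vertex adjacent to the half-edge a. *)
Definition vtx (g : seq tree) (a : hedge) : nat := find (fun v => a \in slots v) g.

Definition adj (g : seq tree) (u v : 'I_(size g)) : bool :=
  has (fun a => (vtx g a == u) && (vtx g (flip a) == v)) (hedges g).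

(* A tree has at least two slots, so no vertex is isolated or univalent. *)
Definition is_graph (n j : nat) (g : seq tree) : bool :=
  [&& size g == j, (0 < j)%N,
      uniq (hedges g), all (fun a => flip a \in hedges g) (hedges g),
      [forall u, forall v, connect (@adj g) u v] &
      (size (edges g)).+1 == (n + j)%N].

Definition graph (n j : nat) := {g : seq tree | is_graph n j g}.

Definition gr (n j : nat) (g : seq tree) : freemod k (graph n j) :=
  if insub g is Some u then << u >> else 0.

(* Relations of the rank n, j vertices part of the graph complex: change of
   orientation, renaming of the edges, and multilinearity of the decorations,
   the vertex with slots X being decorated by an element of HLie X. *)
Inductive graph_rel (n j : nat) : freemod k (graph n j) -> Prop :=
| GSwap g1 u v g2 :
    graph_rel (gr n j (g1 ++ u :: v :: g2) + gr n j (g1 ++ v :: u :: g2))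
| GFlip g e : e \in edges g ->
    graph_rel
      (gr n j g
       + gr n j [seq relab (fun a : hedge => if a.1 == e then flip a else a) v
                | v <- g])
| GName g (f : nat -> nat) : injective f ->
    graph_rel
      (gr n j g - gr n j [seq relab (fun a : hedge => (f a.1, a.2) : hedge) v
                         | v <- g])
| GDec g1 (X : seq hedge) (s : seq (k * tree)) g2 :
    (forall c, c \in s -> perm_eq (slots c.2) X) ->
    \sum_(c <- s) c.1 *: hl hH X c.2 = 0 ->
    graph_rel (\sum_(c <- s) c.1 *: gr n j (g1 ++ c.2 :: g2)).

Definition graphs (n j : nat) : lmodType k := quot (@graph_rel n j).

(* g with h composed with the input of the slot a *)
Definition put (h : H) (a : hedge) (g : seq tree) : seq tree :=
  [seq tbind (fun x => if x == a then Op h (Lf x) else Lf x) v | v <- g].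

(* h sliding along an edge enters one end and leaves through the other one; as
   an input of the slot at the latter it is S h. *)
Inductive slide_rel (n j : nat) : graphs n j -> Prop :=
| GSlide g h a :
    slide_rel (pr (@graph_rel n j) (gr n j (put h a g) - gr n j (put (S h) (flip a) g))).

Definition graphs_bar (n j : nat) : lmodType k := quot (@slide_rel n j).

Definition grb (n j : nat) (g : seq tree) : graphs_bar n j :=
  pr (@slide_rel n j) (pr (@graph_rel n j) (gr n j g)).

(* Contraction of the edge e from the vertex at position i to the one at
   position i' <> i: these are moved to the first two positions, whence the
   sign, and the merged vertex becomes the first one. *)
Definition contract (e : nat) (g : seq tree) : seq tree :=
  let i := vtx g (e, false) in
  let i' := vtx g (e, true) in
  let v0 : tree := (Lf (0%N, false), Lf (0%N, false)) in
  glue hH (e, false) (e, true) (nth v0 g i) (nth v0 g i')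
    :: [seq nth v0 g l | l <- iota 0 (size g) & (l != i) && (l != i')].

Definition bd (n j : nat) (g : seq tree) : graphs_bar n j :=
  \sum_(e <- edges g | vtx g (e, false) != vtx g (e, true))
    let i := vtx g (e, false) in
    let i' := vtx g (e, true) in
    (-1) ^+ (i + i' + (i < i'))%N *: grb n j (contract e g).

Definition tripod (v : tree) : bool := tlie v && (size (slots v) == 3).

(* Boundaries of the two-vertex graphs having a tripod vertex; [tripod] trees
   span Lie((3)), so these graphs span S_2. *)
Inductive bdS2 (n : nat) : graphs_bar n 1 -> Prop :=
| BdS2 (g : seq tree) : is_graph n 2 g -> has tripod g -> bdS2 (bd n 1 g).

Definition Omega (n : nat) : lmodType k := quot (@bdS2 n).

End Graphs.

Definition lin_iso (k : fieldType) (U V : lmodType k) : Prop :=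
  exists f : {linear U -> V}, bijective f.

(* Main.v *)
(* Push all the labels of a one-vertex graph of rank 2 to its four leaves and
   slide them to one end of each of the two loops: what is left is a class in
   H (x) H modulo conjugation together with an element of the 2-dimensional
   Lie((4)). The latter is seen inside the span of the three pairings of the
   leaves, by evaluating trees in the Lie algebra so(3) with its invariant form;
   the symmetries of the graph then leave one copy of H (x) H modulo tau and
   S (x) S. The boundaries of the dumbbells give the relation 1 (x) a = 0, and
   those of the theta graphs the three-term relation. Conversely the class of a
   standard graph labelled by a and b depends bilinearly on a and b, satisfies
   the same relations, and such classes span Omega_2. *)
Require Import Defs.
From HB Require Import structures.
From mathcomp Require Import all_boot all_algebra.
From mathcomp Require Import ring_quotient generic_quotient boolp freeg.
From mathcomp Require Import ring zify.
Import GRing.Theory.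
Local Open Scope ring_scope.

Set Implicit Arguments.
Unset Strict Implicit.
Unset Printing Implicit Defensive.

(** * Linear maps and quotients *)

(** Why so(3): [dot (cross a b) (cross c d)] equals (a.c)(b.d) - (a.d)(b.c), so a tree with four
    leaves turns into a combination of pairings of its leaves, with IHX built in, and basis vectors
    at the leaves read off the coefficient of one pairing. The obstacle is the labels. A label on an
    edge can be pushed either way and splits by the coproduct at each bracket, so its path to the
    leaves involves choices. [ev] therefore transforms an arbitrary multilinear function [K] of the
    leaf labels, passed as a continuation, which avoids tensor powers indexed by leaves.
    Cocommutativity makes the order of the leaves irrelevant, and invariance of [K] under the
    diagonal action ([invK]) makes the direction irrelevant; for the function [kappa] of the two
    loop labels this invariance is invariance under conjugation. The functional is built for an
    abstract linear map [M] on H (x) H with the required symmetries; only at the end is [M] the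
    class map to the quotient. In the other direction a dumbbell yields 1 (x) b only up to a factor
    2, which characteristic 0 removes. *)

Section LinearMaps.
Variables (k : fieldType) (U V W : lmodType k).

(** Linearity is carried as the plain proposition [linear f], because most maps below are anonymous
    functions built from Sweedler sums; they are packed into structures only on demand. *)
Definition mklin (f : U -> V) (fl : linear f) : {linear U -> V} :=
  HB.pack_for {linear U -> V} f (GRing.isLinear.Build _ _ _ _ f fl).

Lemma lin0 (f : U -> V) : linear f -> f 0 = 0.
Proof. by move=> fl; rewrite -[f]/(mklin fl : U -> V) linear0. Qed.

Lemma linD (f : U -> V) : linear f -> forall x y, f (x + y) = f x + f y.
Proof. by move=> fl x y; rewrite -[f]/(mklin fl : U -> V) linearD. Qed.

Lemma linB (f : U -> V) : linear f -> forall x y, f (x - y) = f x - f y.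
Proof. by move=> fl x y; rewrite -[f]/(mklin fl : U -> V) linearB. Qed.

Lemma linZ (f : U -> V) : linear f -> forall a x, f (a *: x) = a *: f x.
Proof. by move=> fl a x; rewrite -[f]/(mklin fl : U -> V) linearZ. Qed.

Lemma lin_sum (f : U -> V) : linear f ->
  forall I (r : seq I) (P : pred I) E,
  f (\sum_(i <- r | P i) E i) = \sum_(i <- r | P i) f (E i).
Proof. by move=> fl I r P E; rewrite -[f]/(mklin fl : U -> V) linear_sum. Qed.

Lemma linear_id : linear (fun x : U => x). Proof. by []. Qed.

Lemma linear_fun (f : {linear U -> V}) : linear f.
Proof. exact: linearP. Qed.

Lemma linear_comp (g : V -> W) (f : U -> V) :
  linear g -> linear f -> linear (fun x => g (f x)).
Proof. by move=> gl fl a x y; rewrite fl gl. Qed.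

Lemma linear_sum_fun I (r : seq I) (P : pred I) (f : I -> U -> V) :
  (forall i, linear (f i)) -> linear (fun x => \sum_(i <- r | P i) f i x).
Proof.
move=> fl a x y; rewrite scaler_sumr -big_split.
by apply: eq_bigr => i _; rewrite fl.
Qed.

Lemma linear_scale c (f : U -> V) : linear f -> linear (fun x => c *: f x).
Proof. by move=> fl a x y; rewrite fl scalerDr !scalerA mulrC. Qed.

Lemma linear_add (f g : U -> V) :
  linear f -> linear g -> linear (fun x => f x + g x).
Proof. by move=> fl gl a x y; rewrite fl gl scalerDr addrACA. Qed.

Lemma linear_opp (f : U -> V) : linear f -> linear (fun x => - f x).
Proof. by move=> fl a x y; rewrite fl opprD scalerN. Qed.

Lemma linear_scalel (f : U -> k^o) (v : V) :
  linear f -> linear (fun x => (f x : k) *: v).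
Proof. by move=> fl a x y; rewrite fl scalerDl -scalerA. Qed.

End LinearMaps.

Section Quotients.
Variables (k : fieldType) (V : lmodType k) (P : V -> Prop).

Lemma in_span_lin (W : lmodType k) (f : V -> W) (Q : W -> Prop) :
    linear f -> (forall v, P v -> in_span Q (f v)) ->
  forall v, in_span P v -> in_span Q (f v).
Proof.
move=> fl fP v [s sP ->]; rewrite (lin_sum fl).
elim: s sP => [|c s IHs] sP; first by rewrite big_nil; apply: in_span0.
rewrite big_cons (linZ fl); apply: in_spanZD; first by apply/fP/sP/mem_head.
by apply: IHs => d ds; apply: sP; rewrite inE ds orbT.
Qed.

Lemma span_ker (W : lmodType k) (f : V -> W) :
  linear f -> (forall v, P v -> f v = 0) -> forall v, in_span P v -> f v = 0.
Proof.
move=> fl fP v [s sP ->]; rewrite (lin_sum fl) big1_seq // => c /andP[_ /sP Pc].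
by rewrite (linZ fl) fP // scaler0.
Qed.

Lemma pr0P (v : V) : pr P v = 0 <-> in_span P v.
Proof.
have -> : (pr P v = 0) = (pr P v = pr P 0) by rewrite linear0.
by rewrite pr_eqP subr0.
Qed.

Lemma pr_gen0 (v : V) : P v -> pr P v = 0.
Proof. by move=> Pv; apply/pr0P/in_span_gen. Qed.

Lemma pr_surj (x : quot P) : exists v, x = pr P v.
Proof.
by exists (repr (x : Quotient.quot (span_pred P))); rewrite pr_repr.
Qed.

(** Evaluating at the chosen representative defines the map for every [f]; that it does not depend
    on the representative is then the separate statement [quot_lift_pr]. *)
Definition quot_lift (W : lmodType k) (f : V -> W) (x : quot P) : W :=
  f (repr (x : Quotient.quot (span_pred P))).

Section Lift.
Variables (W : lmodType k) (f : V -> W).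
Hypotheses (fl : linear f) (fP : forall v, P v -> f v = 0).

Lemma quot_lift_pr v : quot_lift f (pr P v) = f v.
Proof.
apply/eqP; rewrite -subr_eq0 -(linB fl); apply/eqP.
by apply: (span_ker fl fP); apply/pr_eqP; rewrite pr_repr.
Qed.

Lemma quot_lift_linear : linear (quot_lift f).
Proof.
move=> a x y; have [u ->] := pr_surj x; have [v ->] := pr_surj y.
by rewrite -linearP !quot_lift_pr fl.
Qed.

End Lift.
End Quotients.

Lemma span_sub (k : fieldType) (V : lmodType k) (P Q : V -> Prop) :
  (forall v, P v -> in_span Q v) -> forall v, in_span P v -> in_span Q v.
Proof. by move=> PQ; apply: (in_span_lin (@linear_id k V)). Qed.

Lemma quot_span_iso (k : fieldType) (V : lmodType k) (P Q : V -> Prop) :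
  (forall v, in_span P v <-> in_span Q v) -> lin_iso (quot P) (quot Q).
Proof.
have lift (P' Q' : V -> Prop) : (forall v, in_span P' v <-> in_span Q' v) ->
    linear (quot_lift (P := P') (pr Q')) /\
    forall v, quot_lift (P := P') (pr Q') (pr P' v) = pr Q' v.
  move=> PQ; have prl := @linear_fun _ _ _ (pr Q').
  have prP v : P' v -> pr Q' v = 0 by move/in_span_gen/PQ/pr0P.
  split; first exact: quot_lift_linear.
  exact: quot_lift_pr.
move=> PQ; have [fl fE] := lift _ _ PQ.
have [_ gE] := lift Q P (fun v => iff_sym (PQ v)).
exists (mklin fl); exists (quot_lift (P := Q) (pr P)).
  by move=> x; have [v ->] := pr_surj x; rewrite /= fE gE.
by move=> x; have [v ->] := pr_surj x; rewrite /= gE fE.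
Qed.

Section Tensors.
Variables (k : fieldType) (U V : lmodType k).

Lemma tens_linl (v : V) : linear (fun u : U => tens u v).
Proof.
move=> a u u'; rewrite /tens -linearP; apply/pr_eqP; apply: in_span_gen.
by rewrite opprD addrA; exact: BilinL.
Qed.

Lemma tens_linr (u : U) : linear (fun v : V => tens u v).
Proof.
move=> a v v'; rewrite /tens -linearP; apply/pr_eqP; apply: in_span_gen.
by rewrite opprD addrA; exact: BilinR.
Qed.

Lemma freeg_ind_lin (T : choiceType) (x : freemod k T) :
  exists s : seq (k * T), x = \sum_(c <- s) c.1 *: << c.2 >>.
Proof.
exists [seq (coeff z x, z) | z <- dom x].
have E z : << coeff z x *g z >> = coeff z x *: (<< z >> : freemod k T).
  by apply/eqP/freeg_eqP => y; rewrite coeffZ !coeffU mul1r.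
rewrite big_map -[LHS]freeg_sumE.

rewrite (eq_bigr _ (fun z _ => E z)).
by [].
Qed.

Lemma tensor_sum (z : tensor U V) :
  exists s : seq (U * V), z = \sum_(p <- s) tens p.1 p.2.
Proof.
have [x ->] := pr_surj z; have [s ->] := freeg_ind_lin x.
(* The scalars are absorbed into the left factors. *)
exists [seq (c.1 *: c.2.1, c.2.2) | c <- s].
rewrite linear_sum big_map; apply: eq_bigr => c _ /=.
by rewrite (linZ (tens_linl _)) linearZ /=; case: c => a [].
Qed.

Lemma tensor_ext (W : lmodType k) (f g : tensor U V -> W) :
    linear f -> linear g -> (forall u v, f (tens u v) = g (tens u v)) ->
  forall z, f z = g z.
Proof.
move=> fl gl fg z; have [s ->] := tensor_sum z.
by rewrite (lin_sum fl) (lin_sum gl); apply: eq_bigr => p _.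
Qed.

End Tensors.

(** * Hopf algebras *)

Section Sweedler.
Variables (k : fieldType) (H : algType k) (hH : hopf H).
Local Notation S := (antip hH).
Local Notation eps := (cou hH).

Lemma mull_linear (x : H) : linear (fun y => x * y).
Proof. by move=> a u v; rewrite mulrDr scalerAr. Qed.

Lemma mulr_linear (x : H) : linear (fun y => y * x).
Proof. by move=> a u v; rewrite mulrDl scalerAl. Qed.

Lemma S_linear : linear S. Proof. exact: linear_fun. Qed.

Lemma eps_linear : linear eps. Proof. exact: linear_fun. Qed.

(** An arbitrary choice of a decomposition of the coproduct. Sums over it are independent of the
    choice only for bilinear summands, hence the hypothesis [bilinear F] in the identities that use
    the coalgebra axioms. *)
Definition sw (h : H) : seq (H * H) := sval (cid (tensor_sum (cop hH h))).

Lemma swE h : cop hH h = \sum_(p <- sw h) tens p.1 p.2.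
Proof. exact: (svalP (cid (tensor_sum (cop hH h)))). Qed.

(* F h_(1) h_(2). *)
Definition copsum (V : lmodType k) (h : H) (F : H -> H -> V) : V :=
  \sum_(p <- sw h) F p.1 p.2.

Local Notation D := (@copsum _).

Section SweedlerSums.
Variables (V : lmodType k).
Implicit Types (F : H -> H -> V).

Definition bilinear F := (forall y, linear (F^~ y)) /\ (forall x, linear (F x)).

Lemma D_tlift h F : bilinear F -> tlift F (cop hH h) = D h F.
Proof.
case=> Fl Fr; rewrite swE (lin_sum (tlift_linear Fl Fr)).
by apply: eq_bigr => p _; rewrite tlift_tens.
Qed.

Lemma D_lin F : bilinear F -> linear (fun h => D h F).
Proof.
move=> Fb a g h; rewrite -!D_tlift //.
by rewrite linearP (tlift_linear Fb.1 Fb.2).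
Qed.

Lemma D_linF (U : lmodType k) h (F : U -> H -> H -> V) :
  (forall x y, linear (fun u => F u x y)) -> linear (fun u => D h (F u)).
Proof. by move=> Fl; apply: linear_sum_fun. Qed.

Lemma eq_D h F G : (forall x y, F x y = G x y) -> D h F = D h G.
Proof. by move=> FG; apply: eq_bigr => p _. Qed.

Lemma D_exch g h (F : H -> H -> H -> H -> V) :
  D g (fun x y => D h (F x y)) = D h (fun z w => D g (fun x y => F x y z w)).
Proof. exact: exchange_big. Qed.

Lemma D_1 F : bilinear F -> D 1 F = F 1 1.
Proof.
by move=> Fb; rewrite -D_tlift // hopf_cop1 (tlift_tens Fb.1 Fb.2).
Qed.

End SweedlerSums.

Lemma D_hom (V W : lmodType k) (f : V -> W) h F :
  linear f -> f (D h F) = D h (fun x y => f (F x y)).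
Proof. by move=> fl; rewrite (lin_sum fl). Qed.

Lemma tens_bil : bilinear (fun x y : H => tens x y).
Proof. by split=> z; [apply: tens_linl | apply: tens_linr]. Qed.

Section SweedlerIdentities.
Variables (V : lmodType k).
Implicit Types (F : H -> H -> V) (f : H -> V).

Lemma D_counl h f : linear f -> D h (fun x y => (eps x : k) *: f y) = f h.
Proof.
move=> fl; rewrite -[in RHS](hopf_coul hH h) D_tlift.
  by rewrite (D_hom _ _ fl); apply: eq_D => x y; rewrite (linZ fl).
split=> z; first exact: linear_scalel eps_linear.
exact: linear_scale (@linear_id _ _).
Qed.

Lemma D_counr h f : linear f -> D h (fun x y => (eps y : k) *: f x) = f h.
Proof.
move=> fl; rewrite -[in RHS](hopf_cour hH h) D_tlift.
  by rewrite (D_hom _ _ fl); apply: eq_D => x y; rewrite (linZ fl).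
split=> z; first exact: linear_scale (@linear_id _ _).
exact: linear_scalel eps_linear.
Qed.

Lemma D_antipl h f : linear f -> D h (fun x y => f (S x * y)) = (eps h : k) *: f 1.
Proof.
move=> fl; rewrite -(linZ fl) -hopf_antipl D_tlift ?(D_hom _ _ fl) //.
split=> z; last exact: mull_linear.
exact: linear_comp (mulr_linear _) S_linear.
Qed.

Lemma D_antipr h f : linear f -> D h (fun x y => f (x * S y)) = (eps h : k) *: f 1.
Proof.
move=> fl; rewrite -(linZ fl) -hopf_antipr D_tlift ?(D_hom _ _ fl) //.
split=> z; first exact: mulr_linear.
exact: linear_comp (mull_linear _) S_linear.
Qed.

Lemma D_mul g h F : bilinear F ->
  D (g * h) F = D g (fun x y => D h (fun z w => F (x * z) (y * w))).
Proof.
move=> Fb; have mb x y : bilinear (fun z w : H => tens (x * z) (y * w)).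
  split=> z; first exact: linear_comp (tens_linl _) (mull_linear _).
  exact: linear_comp (tens_linr _) (mull_linear _).
rewrite -(D_tlift _ Fb) hopf_copM.
have mE : tlift (fun x y => tlift (fun z w => tens (x * z) (y * w)) (cop hH h))
    (cop hH g) = D g (fun x y => D h (fun z w => tens (x * z) (y * w))).
  rewrite D_tlift; first by apply: eq_D => x y; rewrite D_tlift.
  split=> z a x y; rewrite !D_tlift //.
    apply: (@D_linF _ _ h (fun x z0 w => tens (x * z0) (z * w))) => z' w.
    exact: linear_comp (tens_linl _) (mulr_linear _).
  apply: (@D_linF _ _ h (fun x z0 w => tens (z * z0) (x * w))) => z' w.
  exact: linear_comp (tens_linr _) (mulr_linear _).
have tl := tlift_linear Fb.1 Fb.2.
rewrite mE (D_hom _ _ tl); apply: eq_D => x y; rewrite (D_hom _ _ tl).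
by apply: eq_D => z w; rewrite (tlift_tens Fb.1 Fb.2).
Qed.

Definition trilinear (F : H -> H -> H -> V) :=
  [/\ forall y z, linear (fun x => F x y z),
      forall x z, linear (fun y => F x y z) & forall x y, linear (F x y)].

(** The axiom is an equation in H (x) (H (x) H); both sides are contracted with the linear map that
    [F] induces there, obtained by lifting first in the last two variables and then in the first
    one. *)
Lemma D_coassoc h (F : H -> H -> H -> V) : trilinear F ->
  D h (fun x y => D y (F x)) = D h (fun x z => D x (fun x y => F x y z)).
Proof.
case=> F1 F2 F3; have Fb x : bilinear (F x) by split=> z; [apply: F2 | apply: F3].
have tl x := tlift_linear (Fb x).1 (Fb x).2.
pose G x := tlift (F x).
have Gb : (forall z, linear (G^~ z)) /\ (forall x, linear (G x)).
  split=> [z a x y|x]; last exact: tl.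
  have [s ->] := tensor_sum z; rewrite /G !(lin_sum (tl _)) scaler_sumr.
  rewrite -big_split; apply: eq_bigr => p _.
  by rewrite !(tlift_tens (Fb _).1 (Fb _).2) F1.
have Gl := tlift_linear Gb.1 Gb.2.
have /(congr1 (tlift G)) := hopf_coassoc hH h.
rewrite D_tlift; last first.
  split=> z; first exact: tens_linl.
  exact: linear_comp (tens_linr _) (@linear_fun _ _ _ _).
rewrite (D_hom _ _ Gl) => E.
transitivity (D h (fun x y => tlift G (tens x (cop hH y)))).
  by apply: eq_D => x y; rewrite (tlift_tens Gb.1 Gb.2) /G D_tlift.
rewrite {}E D_tlift; last first.
  split=> z.
    apply: (linear_comp (f := cop hH)); last exact: linear_fun.
    apply: tlift_linear => w.
      exact: tens_linl.
    exact: linear_comp (tens_linr _) (tens_linl _).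
  move=> a x y; rewrite swE !(lin_sum (tlift_linear _ _)).
  1: rewrite scaler_sumr -big_split; apply: eq_bigr => p _ /=.
  1: rewrite !tlift_tens ?(tens_linr z) ?linearP.
  all: try by move=> w; apply: tens_linl.
  all: try by move=> w; apply: linear_comp (tens_linr _) (tens_linl _).
  by rewrite (tens_linr p.2) (tens_linr p.1).
rewrite (D_hom _ _ Gl); apply: eq_D => x z.
rewrite D_tlift; last first.
  split=> w; first exact: tens_linl.
  exact: linear_comp (tens_linr _) (tens_linl _).
rewrite (D_hom _ _ Gl); apply: eq_D => x' y'.
by rewrite (tlift_tens Gb.1 Gb.2) /G (tlift_tens (Fb _).1 (Fb _).2).
Qed.

Hypothesis coc : cocommutative hH.

Lemma D_comm h F : bilinear F -> D h F = D h (fun x y => F y x).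
Proof.
move=> Fb; rewrite -[LHS]D_tlift // -coc D_tlift; last first.
  by split=> z; [apply: tens_linr | apply: tens_linl].
have tl := tlift_linear Fb.1 Fb.2.
by rewrite (D_hom _ _ tl); apply: eq_D => x y; rewrite (tlift_tens Fb.1 Fb.2).
Qed.

End SweedlerIdentities.
End Sweedler.
Arguments D_hom {k H hH V W f} h F _.
Arguments D_coassoc {k H hH V} h {F} _.
Arguments D_exch {k H hH V} g h F.

(** Linearity of an explicit expression follows its syntax: each clause strips the outermost linear
    operation and leaves the linearity of its argument. *)
Ltac lin_step :=
  match goal with
  | |- forall _, _ => intro
  | |- bilinear _ => split
  | |- trilinear _ => split
  | |- _ /\ _ => split
  | h : ?P |- ?P => exact h
  | |- GRing.linear_for _ (fun x => x) => exact: linear_id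
  | |- GRing.linear_for _ (fun x => @?g x * ?c) =>
      apply: (linear_comp (mulr_linear c) (f := g))
  | |- GRing.linear_for _ (fun x => ?c * @?g x) =>
      apply: (linear_comp (mull_linear c) (f := g))
  | |- GRing.linear_for _ (fun x => tens (@?g x) ?c) =>
      apply: (linear_comp (tens_linl c) (f := g))
  | |- GRing.linear_for _ (fun x => tens ?c (@?g x)) =>
      apply: (linear_comp (tens_linr c) (f := g))
  | |- GRing.linear_for _ (fun x => copsum ?hH ?h (@?F x)) =>
      apply: (@D_linF _ _ hH _ _ h F)
  | |- GRing.linear_for _ (fun x => copsum ?hH (@?g x) ?F) =>
      apply: (linear_comp (f := g) (g := fun h => copsum hH h F)); first apply: D_lin
  | |- GRing.linear_for _ (fun x => ?c *: (@?g x)) => apply: linear_scale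
  | |- GRing.linear_for _ (fun x => (@?g x) *: ?c) => apply: linear_scalel
  | |- GRing.linear_for _ (fun x => @?f x + @?g x) =>
      apply: (@linear_add _ _ _ f g)
  | |- GRing.linear_for _ (fun x => - @?f x) =>
      apply: (@linear_opp _ _ _ f)
  | Fb : bilinear ?F |- GRing.linear_for _ (fun x => ?F (@?g x) ?c) =>
      apply: (linear_comp (Fb.1 c) (f := g))
  | Fb : bilinear ?F |- GRing.linear_for _ (fun x => ?F ?c (@?g x)) =>
      apply: (linear_comp (Fb.2 c) (f := g))
  | Fb : bilinear ?F |- GRing.linear_for _ (?F ?c) => exact: (Fb.2 c)
  | fl : GRing.linear_for _ ?f |- GRing.linear_for _ (fun x => ?f (@?g x)) =>
      apply: (linear_comp fl (f := g))
  | fl : forall _, GRing.linear_for _ _ |- GRing.linear_for _ _ => apply: fl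
  | fl : forall _ _, GRing.linear_for _ _ |- GRing.linear_for _ _ => apply: fl
  | |- GRing.linear_for _ (fun x => GRing.Linear.sort ?f (@?g x)) =>
      apply: (linear_comp (linear_fun f) (f := g))
  | |- GRing.linear_for _ (GRing.Linear.sort ?f) => exact: linear_fun
  | |- GRing.linear_for _ (tens ?u) => exact: tens_linr
  | |- GRing.linear_for _ (GRing.mul ?u) => exact: mull_linear
  end.
Ltac lin := repeat (cbv beta; lin_step).

(** * The antipode: anti-multiplicative, and for cocommutative H an involution compatible with the
    coproduct *)

Section Antipode.
Variables (k : fieldType) (H : algType k) (hH : hopf H).
Local Notation S := (antip hH).
Local Notation eps := (cou hH).
Local Notation D := (@copsum k H hH _).

Lemma S_1 : S 1 = 1.
Proof.
have := D_antipl hH 1 (@linear_id _ H); rewrite D_1; last by lin.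
by rewrite mulr1 hopf_cou1 scale1r.
Qed.

(** Both sides are convolution inverses of the multiplication. Concretely, g_(2) h_(2) S(h_(3))
    S(g_(3)), which is a scalar, is inserted to the right of S(g_(1) h_(1)); after regrouping,
    S(g_(1) h_(1)) g_(2) h_(2) collapses and S(h) S(g) remains. *)
Lemma S_mul g h : S (g * h) = S h * S g.
Proof.
have E1 : S (g * h) = D g (fun g1 g2 => D h (fun h1 h2 =>
    D g2 (fun x y => D h2 (fun z w => S (g1 * h1) * (x * (z * S w) * S y))))).
  rewrite -(D_counr hH g (f := fun g => S (g * h))); last by lin.
  apply: eq_D => g1 g2.
  rewrite -(D_counr hH h (f := fun h => S (g1 * h))); last by lin.
  rewrite (D_hom _ _ (f := fun u => (eps g2 : k) *: u)); last by lin.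
  apply: eq_D => h1 h2.
  transitivity (D g2 (fun x y => (eps h2 : k) *: (S (g1 * h1) * (x * S y)))).
    rewrite (D_antipr hH g2 (f := fun u => (eps h2 : k) *: (S (g1 * h1) * u)));
      last by lin.
    by rewrite mulr1.
  apply: eq_D => x y.
  rewrite (D_antipr hH h2 (f := fun u => S (g1 * h1) * (x * u * S y)));
    last by lin.
  by rewrite mulr1.
rewrite {}E1.
under eq_D => g1 g2 do rewrite D_exch.
rewrite (D_coassoc _ (F := fun g1 x y => D h (fun h1 h2 => D h2 (fun z w =>
   S (g1 * h1) * (x * (z * S w) * S y))))); last by lin.
rewrite -[RHS](D_counl hH g (f := fun y => S h * S y)); last by lin.
apply: eq_D => p y.
under eq_D => g1 x do (rewrite (D_coassoc _ (F := fun h1 z w =>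
      S (g1 * h1) * (x * (z * S w) * S y))); last by lin).
rewrite D_exch -(D_counl hH h (f := fun w => S w * S y)); last by lin.
rewrite (D_hom _ _ (f := fun u => (eps p : k) *: u)); last by lin.
apply: eq_D => q w.
rewrite scalerA -hopf_couM -{2}[S w]mul1r.
rewrite -(D_antipl hH (p * q) (f := fun u => u * S w * S y)); last by lin.
rewrite D_mul; last by lin.
by apply: eq_D => g1 x; apply: eq_D => h1 z; rewrite !mulrA.
Qed.

Hypothesis coc : cocommutative hH.

(** Expand S(S(h)) as S(S(h_(1))) S(h_(2)) h_(3). The first two factors are S(h_(2) S(h_(1))), which
    cocommutativity turns into S(h_(1) S(h_(2))), a scalar. *)
Lemma S_invol h : S (S h) = h.
Proof.
have <- : D h (fun x y => D y (fun z w => S (S x) * (S z * w))) = S (S h).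
  rewrite -[RHS](D_counr hH h (f := fun x => S (S x))); last by lin.
  apply: eq_D => x y.
  rewrite (D_antipl hH y (f := fun u => S (S x) * u)); last by lin.
  by rewrite mulr1.
rewrite (D_coassoc _ (F := fun x z w => S (S x) * (S z * w))); last by lin.
rewrite -[RHS](D_counl hH h (@linear_id _ H)); apply: eq_D => p w.
transitivity (D p (fun x z => S (x * S z) * w)).
  rewrite (D_comm coc); last by lin.
  by apply: eq_D => x z; rewrite S_mul mulrA.
rewrite (D_antipr hH p (f := fun u => S u * w)); last by lin.
by rewrite S_1 mul1r.
Qed.

(** Cocommutativity for the two middle factors of a fourfold coproduct: coassociativity first brings
    these two factors out of a single coproduct. *)
Lemma D_swap (V : lmodType k) h (F : H -> H -> H -> H -> V) :
    (forall y z w, linear (fun x => F x y z w)) ->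
    (forall x z w, linear (fun y => F x y z w)) ->
    (forall x y w, linear (fun z => F x y z w)) ->
    (forall x y z, linear (fun w => F x y z w)) ->
  D h (fun p q => D p (fun x y => D q (fun z w => F x y z w))) =
  D h (fun p q => D p (fun x z => D q (fun y w => F x y z w))).
Proof.
move=> F1 F2 F3 F4.
have a1 (G : H -> H -> H -> H -> V) : 
    (forall y z w, linear (fun x => G x y z w)) ->
    (forall x z w, linear (fun y => G x y z w)) ->
    (forall x y w, linear (fun z => G x y z w)) ->
    (forall x y z, linear (fun w => G x y z w)) ->
    D h (fun p q => D p (fun x y => D q (fun z w => G x y z w))) =
    D h (fun x r => D r (fun s w => D s (fun y z => G x y z w))).
  move=> G1 G2 G3 G4.
  rewrite -(D_coassoc _ (F := fun x y q => D q (fun z w => G x y z w))).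
    apply: eq_D => x r.
    by rewrite -(D_coassoc _ (F := fun y z w => G x y z w)) //; lin.
  by split=> *; lin.
rewrite a1 // (a1 (fun x z y w => F x y z w)) //.
apply: eq_D => x r; apply: eq_D => s w.
by rewrite (D_comm coc); lin.
Qed.

(** Both sides are convolution inverses of the coproduct. The unit 1 (x) 1 is inserted as b S(c) (x)
    d S(e); after [D_swap], b and d form one coproduct, which cancels against that of S(h_(1)). *)
Lemma D_S (V : lmodType k) h (F : H -> H -> V) : bilinear F ->
  D (S h) F = D h (fun x y => F (S x) (S y)).
Proof.
move=> Fb.
pose G (a b c d : H) := D (S a) (fun u v => F (u * b * S c) (v * d)).
have E1 : D (S h) F = D h (fun h1 r => D r (fun p q =>
    D p (fun b c => D q (fun d e =>
      D (S h1) (fun u v => F (u * (b * S c)) (v * (d * S e))))))).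
  rewrite -[LHS](D_counr hH h (f := fun h => D (S h) F)); last by lin.
  apply: eq_D => h1 r.
  rewrite -[LHS](D_counr hH r (f := fun r => (eps r : k) *: D (S h1) F));
    last by lin.
  apply: eq_D => p q.
  rewrite scalerA mulrC -scalerA.
  transitivity (D p (fun b c => (eps q : k) *: D (S h1)
     (fun u v => F (u * (b * S c)) (v * 1)))).
    rewrite (D_antipr hH p (f := fun t => (eps q : k) *: D (S h1)
     (fun u v => F (u * t) (v * 1)))); last by lin.
    do 2 congr (_ *: _).
    by apply: eq_D => u v; rewrite !mulr1.
  apply: eq_D => b c.
  by rewrite (D_antipr hH q (f := fun t => D (S h1)
     (fun u v => F (u * (b * S c)) (v * t)))); lin.
rewrite {}E1.
under eq_D => h1 r do (rewrite D_swap; try by lin).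
rewrite (D_coassoc _ (F := fun h1 p q => D p (fun b d => D q (fun c e =>
  D (S h1) (fun u v => F (u * (b * S c)) (v * (d * S e))))))); last by lin.
rewrite -[RHS](D_counl hH h (f := fun h => D h (fun x y => F (S x) (S y))));
  last by lin.
apply: eq_D => r q.
under eq_D => h1 p do rewrite D_exch.
rewrite D_exch (D_hom _ _ (f := fun u => (eps r : k) *: u)); last by lin.
apply: eq_D => c e.
transitivity (D r (fun h1 p => D (S h1 * p) (fun u v => F (u * S c) (v * S e)))).
  apply: eq_D => h1 p; rewrite D_mul; last by lin.
  by rewrite D_exch; apply: eq_D => u v; apply: eq_D => b d; rewrite !mulrA.
rewrite (D_antipl hH r (f := fun t => D t (fun u v => F (u * S c) (v * S e))));
  last by lin.
by rewrite D_1 ?mul1r //; lin.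
Qed.

End Antipode.

Definition upd (T : eqType) (H : Type) (r : T -> H) (x : T) (h : H) : T -> H :=
  fun y => if y == x then h else r y.

Definition scons (H : Type) (x : H) (p : nat -> H) : nat -> H :=
  fun i => if i is j.+1 then p j else x.

(** * Iterated coproducts and invariance under conjugation *)

Section IteratedCoproduct.
Variables (k : fieldType) (H : algType k) (hH : hopf H).
Local Notation S := (antip hH).
Local Notation eps := (cou hH).
Local Notation D := (@copsum k H hH _).

Lemma tpow_sum n (z : tpow H n) : exists s, z = \sum_(p <- s) ptens n p.
Proof.
elim: n z => [|n IHn] z.
  by exists [:: fun _ => z]; rewrite big_seq1.
have [s ->] := tensor_sum z.
elim: s => [|[x y] s [t tE]]; first by exists [::]; rewrite !big_nil.
have [u uE] := IHn y.
exists ([seq scons x p | p <- u] ++ t); rewrite big_cons big_cat /= tE big_map.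
by congr (_ + _); rewrite uE (lin_sum (tens_linr x)).
Qed.

Lemma copn_linear n : linear (copn hH n).
Proof.
elim: n => [|n IHn] //= a g h; rewrite linearP tlift_linear // => x.
  exact: tens_linl.
exact: linear_comp (tens_linr x) IHn.
Qed.

(** The arguments are infinite sequences, as in [ptens]; the second clause makes [G] a function of
    the entries 0, ..., n alone. *)
Definition multilinear (V : lmodType k) n (G : (nat -> H) -> V) :=
  (forall i p, (i <= n)%N -> linear (fun h => G (upd p i h))) /\
  (forall p q, (forall i, (i <= n)%N -> p i = q i) -> G p = G q).

Fixpoint itD (V : lmodType k) n h (G : (nat -> H) -> V) : V :=
  if n is m.+1 then D h (fun x y => itD m y (fun p => G (scons x p)))
  else G (fun _ => h).

Lemma mult_scons (V : lmodType k) n (G : (nat -> H) -> V) x :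
  multilinear n.+1 G -> multilinear n (fun p => G (scons x p)).
Proof.
case=> Gl Ge; split=> [i p lein|p q pq].
  rewrite (_ : (fun h => _) = fun h => G (upd (scons x p) i.+1 h)).
    exact: Gl.
  by apply/funext => h; congr G; apply/funext; case.
by apply: Ge => -[|i] // lein; apply: pq.
Qed.

(** The universal property of the iterated tensor power, by induction: fixing the first entry gives
    a map on the remaining factors, which depends linearly on that entry and is lifted once more. *)
Lemma mult_lift (V : lmodType k) n (G : (nat -> H) -> V) : multilinear n G ->
  exists2 X : tpow H n -> V, linear X & forall p, X (ptens n p) = G p.
Proof.
elim: n G => [|n IHn] G Gm; have [Gl Ge] := Gm.
  exists (fun h => G (fun _ => h)) => [|p]; last by apply: Ge => -[].
  move=> a g h; have := Gl 0%N (fun _ => 0) isT a g h.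
  by congr (_ = _); first [congr (_ + _) | idtac]; do ?congr (_ *: _);
    apply: Ge => -[].
have /choice [X XP] : forall x, exists X : tpow H n -> V,
    linear X /\ forall p, X (ptens n p) = G (scons x p).
  by move=> x; have [X Xl XE] := IHn _ (mult_scons x Gm); exists X.
have X1 z : linear (X^~ z).
  have [s ->] := tpow_sum z; move=> a x y.
  rewrite !(lin_sum (XP _).1) scaler_sumr -big_split; apply: eq_bigr => p _ /=.
  rewrite !(XP _).2; have := Gl 0%N (scons 0 p) isT a x y.
  by congr (_ = _); first [congr (_ + _) | idtac]; do ?congr (_ *: _);
    congr G; apply/funext; case.
have X2 x : linear (X x) := (XP x).1.
exists (tlift X) => [|p]; first exact: tlift_linear.
rewrite /= tlift_tens // (XP _).2; congr G.
by apply/funext; case.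
Qed.

Lemma lin_copn (V : lmodType k) n (X : tpow H n -> V) h : linear X ->
  X (copn hH n h) = itD n h (fun p => X (ptens n p)).
Proof.
elim: n X h => [|n IHn] X h Xl //=.
rewrite D_tlift; last first.
  by split=> x; [apply: tens_linl | apply: linear_comp (tens_linr x) (copn_linear n)].
rewrite (D_hom _ _ Xl); apply: eq_D => x y.
by rewrite (IHn (fun z => X (tens x z))) //; apply: linear_comp Xl (tens_linr x).
Qed.

(** The relations of the statement quantify over all expressions [s] of an iterated coproduct.
    Multilinear functions do not see the choice of [s], so these relations become identities between
    nested sums. *)
Lemma sweedler_sum (V : lmodType k) n h s (G : (nat -> H) -> V) :
  multilinear n G -> sweedler hH n h s -> \sum_(p <- s) G p = itD n h G.
Proof.
move=> /mult_lift[X Xl XE] sP.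
have -> : G = fun p => X (ptens n p) by apply/funext => p.
by rewrite -lin_copn // sP (lin_sum Xl).
Qed.

Lemma sweedler_ex n h : exists s, sweedler hH n h s.
Proof. exact: tpow_sum. Qed.

Definition adj_action (h a : H) : H := D h (fun x y => x * a * S y).

(** For linear [M] this is the usable form of vanishing on the relations of the conjugation
    coinvariants; [conj_cls] and [conj_inv_ker] link the two. *)
Definition conj_inv (V : lmodType k) (M : tensor H H -> V) := forall h a b,
  M (D h (fun x y => tens (adj_action x a) (adj_action y b))) = (eps h : k) *: M (tens a b).

Let conj_summand a b : (nat -> H) -> tensor H H :=
  fun p => tens (p 0%N * a * S (p 1%N)) (p 2%N * b * S (p 3%N)).

Lemma conjG_mult a b : multilinear 3 (conj_summand a b).
Proof.
split=> [i p|p q pq]; last by rewrite /conj_summand !pq.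
by case: i => [|[|[|[|]]]] // _; rewrite /conj_summand /upd /=; lin.
Qed.

(** Coassociativity regroups the fourfold coproduct into two pairs, one for each tensor factor. *)
Lemma itD_conjG h a b :
  itD 3 h (conj_summand a b) = D h (fun x y => tens (adj_action x a) (adj_action y b)).
Proof.
rewrite /conj_summand /=.
transitivity (D h (fun x y => D x (fun x y' => D y (fun z w =>
  tens (x * a * S y') (z * b * S w))))).
  by rewrite -(D_coassoc _ (F := fun x y' y => D y (fun z w =>
  tens (x * a * S y') (z * b * S w)))); lin.
apply: eq_D => x y; rewrite /adj_action (D_hom _ _ (tens_linl _)).
by apply: eq_D => z w; rewrite (D_hom _ _ (tens_linr _)).
Qed.

Lemma conj_cls : conj_inv (pr (@conj_rel k H hH 1)).
Proof.
move=> h a b; set c := pr _.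
have cl : linear c by apply: linear_fun.
pose ab (i : nat) := if i == 0%N then a else b.
have [s sP] := sweedler_ex 3 (h - (eps h : k) *: 1).
have /pr_gen0 := ConjRel (n := 1) ab sP.
rewrite -/c /= => E.
have {E} : c (\sum_(p <- s) conj_summand a b p) = 0 by [].
rewrite (sweedler_sum (conjG_mult a b) sP) itD_conjG.
set F := fun x y => _; have Fb : bilinear F by rewrite /F /adj_action; lin.
have Dl := D_lin hH Fb.
rewrite (linB Dl) (linZ Dl) D_1 // /F /adj_action (linB cl) (linZ cl).
move/eqP; rewrite subr_eq0 => /eqP ->.
by rewrite !D_1 ?S_1 ?mulr1 ?mul1r //; lin.
Qed.

Lemma conj_inv_ker (V : lmodType k) (M : tensor H H -> V) :
  linear M -> conj_inv M -> forall z, conj_rel hH (n := 1) z -> M z = 0.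
Proof.
move=> Ml Mi _ [h a s sP].
have -> : \sum_(p <- s) ptens 1 (fun i => p i.*2 * a i * S (p i.*2.+1)) =
  \sum_(p <- s) conj_summand (a 0%N) (a 1%N) p by [].
rewrite (sweedler_sum (conjG_mult _ _) sP) itD_conjG.
set F := fun x y => _; have Fb : bilinear F by rewrite /F /adj_action; lin.
have Dl := D_lin hH Fb.
rewrite (linB Dl) (linZ Dl) D_1 // /F /adj_action (linB Ml) (linZ Ml) -/(adj_action) Mi.
by rewrite !D_1 ?S_1 ?mulr1 ?mul1r ?subrr //; lin.
Qed.

End IteratedCoproduct.

(** * The operator relations and the elementwise relations span the same subspace *)

Section Relations.
Variables (k : fieldType) (H : algType k) (hH : hopf H).
Hypothesis coc : cocommutative hH.
Local Notation S := (antip hH).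
Local Notation eps := (cou hH).
Local Notation D := (@copsum k H hH _).

Lemma gam_linear : linear (gam hH).
Proof.
have gb (a : H) : bilinear (fun b1 b2 => tens (S b1) (a * S b2)) by lin.
apply: tlift_linear => [b|a] c x y; rewrite !(D_tlift _ _ (gb _)); last first.
  exact: D_lin.
apply: (D_linF _ _ (F := fun x b1 b2 => tens (S b1) (x * S b2))); lin.
Qed.

Lemma gam_tens a b : gam hH (tens a b) = D b (fun b1 b2 => tens (S b1) (a * S b2)).
Proof.
have gb (x : H) : bilinear (fun b1 b2 => tens (S b1) (x * S b2)) by lin.
rewrite /gam tlift_tens ?(D_tlift _ _ (gb _)) //.
  move=> y c u v; rewrite !(D_tlift _ _ (gb _)).
  by apply: (D_linF _ _ (F := fun x b1 b2 => tens (S b1) (x * S b2))); lin.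
move=> x c u v; rewrite !(D_tlift _ _ (gb _)).
exact: D_lin.
Qed.

(** In the second factor S(b_(1)) meets a component of b_(2) next to it, and these cancel by the
    antipode axiom. *)
Lemma gam2_tens a b :
  gam hH (gam hH (tens a b)) = D a (fun a1 a2 => tens (b * S a1) (S a2)).
Proof.
rewrite gam_tens (D_hom _ _ gam_linear).
transitivity (D b (fun b1 b2 => D a (fun a1 a2 => D b2 (fun d c =>
  tens (c * S a1) (S b1 * d * S a2))))).
  apply: eq_D => b1 b2; rewrite gam_tens D_mul; last by lin.
  apply: eq_D => a1 a2; rewrite (D_S coc); last by lin.
  rewrite (D_comm coc); last by lin.
  by apply: eq_D => d c; rewrite !S_mul !(S_invol coc) mulrA.
under eq_D => b1 b2 do rewrite D_exch.
rewrite (D_coassoc _ (F := fun b1 d c => D a (fun a1 a2 =>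
  tens (c * S a1) (S b1 * d * S a2)))); last by lin.
rewrite -(D_counl hH b (f := fun b => D a (fun a1 a2 => tens (b * S a1) (S a2))));
  last by lin.
apply: eq_D => p c; rewrite (D_antipl hH p (f := fun u => D a (fun a1 a2 =>
  tens (c * S a1) (u * S a2)))); last by lin.
by congr (_ *: _); apply: eq_D => a1 a2; rewrite mul1r.
Qed.

Lemma tau_linear : linear (@tau k H).
Proof.
by apply: tlift_linear => x; [apply: tens_linr | apply: tens_linl].
Qed.

Lemma tau_tens (a b : H) : tau (tens a b) = tens b a.
Proof.
by rewrite /tau tlift_tens // => x; [apply: tens_linr | apply: tens_linl].
Qed.

Lemma SxS_linear : linear (SxS hH).
Proof. by apply: tlift_linear => x; lin. Qed.

Lemma SxS_tens (a b : H) : SxS hH (tens a b) = tens (S a) (S b).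
Proof. by rewrite /SxS tlift_tens // => x; lin. Qed.

Lemma etaeps_linear : linear (etaepsxId hH).
Proof. by apply: tlift_linear => x; lin. Qed.

Lemma etaeps_tens (a b : H) :
  etaepsxId hH (tens a b) = (eps a : k) *: tens 1 b.
Proof.
rewrite /etaepsxId tlift_tens; [|by move=> x; lin..].
by rewrite (linZ (tens_linl b)).
Qed.

Section Invariants.
Variables (V : lmodType k) (M : tensor H H -> V).
Hypotheses (Ml : linear M) (Mi : conj_inv hH M).

(** Conjugation by b_(1) sends b_(2) (x) c b_(3) to an expression in which, by cocommutativity, the
    factors b_(2), b_(3) cancel against the trailing antipodes, leaving b_(1) (x) b_(2) c. By
    invariance [M] does not notice this conjugation. *)
Lemma conj_inv_swap b c :
  D b (fun x y => M (tens x (c * y))) = D b (fun x y => M (tens x (y * c))).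
Proof.
transitivity (D b (fun h r => D r (fun r1 r2 =>
    M (D h (fun x y => tens (adj_action hH x r1) (adj_action hH y (c * r2))))))).
  rewrite -[LHS](D_counl hH b (f := fun b => D b (fun x y => M (tens x (c * y)))));
    last by lin.
  apply: eq_D => h r; rewrite (D_hom _ _ (f := fun u => (eps h : k) *: u));
    last by lin.
  by apply: eq_D => r1 r2; rewrite Mi.
transitivity (D b (fun h r => D h (fun p q => D p (fun x1 y1 =>
  D r (fun r1 r2 => D q (fun x2 y2 =>
    M (tens (x1 * (r1 * S x2)) (y1 * c * (r2 * S y2))))))))).
  apply: eq_D => h r.
  transitivity (D r (fun r1 r2 => D h (fun p q => D p (fun x1 y1 =>
    D q (fun x2 y2 => M (tens (x1 * (r1 * S x2)) (y1 * c * (r2 * S y2)))))))).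
    apply: eq_D => r1 r2; rewrite (D_hom _ _ Ml).
    rewrite D_swap //; [|by move=> *; lin..].
    apply: eq_D => x y; rewrite /adj_action (D_hom _ _ (tens_linl _)) (D_hom _ _ Ml).
    apply: eq_D => z w; rewrite (D_hom _ _ (tens_linr _)) (D_hom _ _ Ml).
    by apply: eq_D => u v; rewrite !mulrA.
  rewrite D_exch; apply: eq_D => p q.
  by rewrite D_exch.
rewrite -(D_coassoc _ (F := fun p q r => D p (fun x1 y1 =>
  D r (fun r1 r2 => D q (fun x2 y2 =>
    M (tens (x1 * (r1 * S x2)) (y1 * c * (r2 * S y2)))))))); last by lin.
rewrite -[RHS](D_counr hH b (f := fun b => D b (fun x y => M (tens x (y * c)))));
  last by lin.
apply: eq_D => p t; rewrite D_exch.
rewrite (D_hom _ _ (f := fun u => (eps t : k) *: u)); last by lin.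
apply: eq_D => x1 y1.
rewrite (D_comm coc); last by lin.
transitivity (D t (fun r q => D (r * S q) (fun u v =>
   M (tens (x1 * u) (y1 * c * v))))).
  apply: eq_D => r q; rewrite D_mul; last by lin.
  by apply: eq_D => r1 r2; rewrite (D_S coc) //; lin.
rewrite (D_antipr hH t (f := fun t => D t (fun u v =>
   M (tens (x1 * u) (y1 * c * v))))); last by lin.
by rewrite D_1 ?mulr1 //; lin.
Qed.

Hypothesis Mtau : forall a b, M (tens a b) = M (tens b a).
Hypothesis MSS : forall a b, M (tens a b) = M (tens (S a) (S b)).

(** The square of gamma matches the sum over the coproduct of [a] and gamma itself the sum over that
    of [b]. In each case the factor coming from the other argument is moved across by
    [conj_inv_swap], and the antipodes are removed by [MSS]. *)
Lemma gam_elt a b :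
  M (tens a b + gam hH (tens a b) + gam hH (gam hH (tens a b))) =
  M (tens a b) + D a (fun a1 a2 => M (tens (S b * a1) a2))
               + D b (fun b1 b2 => M (tens b1 (S a * b2))).
Proof.
rewrite !(linD Ml) addrAC; congr (_ + _ + _).
  rewrite gam2_tens (D_hom _ _ Ml).
  transitivity (D a (fun x y => M (tens x (S b * y)))); last first.
    by rewrite (D_comm coc); [apply: eq_D => x y | lin].
  rewrite conj_inv_swap (D_comm coc); last by lin.
  by apply: eq_D => x y; rewrite MSS Mtau !S_mul !(S_invol coc).
rewrite gam_tens (D_hom _ _ Ml) conj_inv_swap.
by apply: eq_D => x y; rewrite MSS !S_mul !(S_invol coc).
Qed.

End Invariants.

Local Notation cls := (pr (@conj_rel k H hH 1)).

Lemma elt_gamE a b :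
  cls (tens a b + tlift (fun a1 a2 => tens (S b * a1) a2) (cop hH a)
                + tlift (fun b1 b2 => tens b1 (S a * b2)) (cop hH b)) =
  cls (tens a b) + D a (fun a1 a2 => cls (tens (S b * a1) a2))
               + D b (fun b1 b2 => cls (tens b1 (S a * b2))).
Proof.
rewrite !D_tlift; [|by lin..].
by rewrite !linearD /= !(D_hom _ _ (linear_fun cls)).
Qed.

Section Sub.
Variable P : Hbar hH 1 -> Prop.
Let M z := pr P (cls z).

Let Ml : linear M.
Proof. exact: linear_comp (linear_fun (pr P)) (linear_fun cls). Qed.

Let Mi : conj_inv hH M.
Proof.
by move=> h a b; rewrite /M conj_cls (linZ (linear_fun (pr P))).
Qed.

Let M0 z : M z = 0 <-> in_span P (cls z).
Proof. exact: pr0P. Qed.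

(** Stated for an arbitrary [P], so that taking for [P] either family of relations gives one of the
    two inclusions of spans. Both sides amount to the same conditions on the class map [M]; the
    symmetries under tau and S (x) S come first because [gam_elt] relies on them. *)
Lemma op_elt_span :
  (forall z, op_rel z -> in_span P z) <-> (forall z, elt_rel z -> in_span P z).
Proof.
have sub z w : M (z - w) = 0 <-> M z = M w.
  by rewrite (linB Ml); split=> [/eqP|->]; rewrite ?subrr // subr_eq0 => /eqP.
have gE a b : (forall a b, M (tens a b) = M (tens b a)) ->
    (forall a b, M (tens a b) = M (tens (S a) (S b))) ->
  M (tens a b + gam hH (tens a b) + gam hH (gam hH (tens a b))) = 0 <->
  in_span P (cls (tens a b + tlift (fun a1 a2 => tens (S b * a1) a2) (cop hH a)
                + tlift (fun b1 b2 => tens b1 (S a * b2)) (cop hH b))).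
  move=> Mt MS; rewrite -pr0P elt_gamE gam_elt // !linearD /=.
  by rewrite !(D_hom _ _ (linear_fun (pr P))).
split=> hP z.
  have Mt a b : M (tens a b) = M (tens b a).
    by apply/sub/M0; rewrite -(tau_tens a b); apply: hP (OpTau hH _).
  have MS a b : M (tens a b) = M (tens (S a) (S b)).
    by apply/sub/M0; rewrite -(SxS_tens a b); apply: hP (OpSS hH _).
  case=> [a b|a b|a|a b].
  - by rewrite -linearB; apply/M0/sub.
  - by rewrite -linearB; apply/M0/sub.
  - apply/M0; have /M0 := hP _ (OpEta hH (tens 1 a)).
    by rewrite etaeps_tens hopf_cou1 scale1r.
  - by apply/gE => //; apply/M0/hP/OpGam.
have Mt a b : M (tens a b) = M (tens b a).
  by apply/sub/M0; rewrite linearB; apply: hP (EltTau hH _ _).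
have MS a b : M (tens a b) = M (tens (S a) (S b)).
  by apply/sub/M0; rewrite linearB; apply: hP (EltSS hH _ _).
case=> {}z; apply/M0.
- apply/sub; apply: (tensor_ext Ml (linear_comp Ml tau_linear)) => a b.
  by rewrite tau_tens.
- apply/sub; apply: (tensor_ext Ml (linear_comp Ml SxS_linear)) => a b.
  by rewrite SxS_tens.
- have gl := gam_linear.
  apply: (tensor_ext (f := fun z => M (z + gam hH z + gam hH (gam hH z)))
    (g := fun _ => 0)); first by lin.
    by move=> c u v; rewrite scaler0 addr0.
  by move=> a b; apply/gE => //; apply: hP (EltGam hH _ _).
- have el := etaeps_linear.
  apply: (tensor_ext (f := fun z => M (etaepsxId hH z)) (g := fun _ => 0)).
  + by lin.
  + by move=> c u v; rewrite scaler0 addr0.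
  move=> a b; rewrite etaeps_tens (linZ Ml).
  rewrite (_ : M _ = 0) ?scaler0 //; apply/M0/hP.
  exact: EltEta.
Qed.

End Sub.

Lemma op_elt_eq (z : Hbar hH 1) :
  in_span (@op_rel k H hH) z <-> in_span (@elt_rel k H hH) z.
Proof.
split; apply: span_sub; first by apply/op_elt_span => w; apply: in_span_gen.
by apply/op_elt_span => w; apply: in_span_gen.
Qed.

End Relations.

(** * Evaluation of labelled trees *)

Lemma updC (T : eqType) (H : Type) (r : T -> H) x y a b : x != y ->
  upd (upd r x a) y b = upd (upd r y b) x a.
Proof.
move=> xy; apply/funext => z; rewrite /upd.
by case: (eqVneq z y) => [->|//]; rewrite eq_sym (negPf xy).
Qed.

Lemma updK (T : eqType) (H : Type) (r : T -> H) x a b :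
  upd (upd r x a) x b = upd r x b.
Proof. by apply/funext => z; rewrite /upd; case: eqP. Qed.

Lemma upd_same (T : eqType) (H : Type) (r : T -> H) x a : upd r x a x = a.
Proof. by rewrite /upd eqxx. Qed.

Lemma upd_other (T : eqType) (H : Type) (r : T -> H) x y a :
  y != x -> upd r x a y = r y.
Proof. by rewrite /upd => /negPf->. Qed.

Section Evaluation.
Variables (k : fieldType) (H : algType k) (hH : hopf H).
Hypothesis coc : cocommutative hH.
Local Notation S := (antip hH).
Local Notation eps := (cou hH).
Local Notation D := (@copsum k H hH _).
Variables (L : eqType) (V : lmodType k).
Local Notation tm := (tm H L).
Implicit Types (K : (L -> H) -> V) (r : L -> H) (t : tm).

(* The value at r of the function K of the labels of the leaves, once h, applied
   to the output of t, has been pushed together with the labels of t down to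
   the leaves, where it multiplies r on the left. *)
Fixpoint ev t (h : H) K r : V :=
  match t with
  | Lf x => K (upd r x (h * r x))
  | Br t1 t2 => D h (fun x y => ev t1 x (ev t2 y K) r)
  | Op g t1 => ev t1 (h * g) K r
  end.

Definition mlin (A : seq L) K :=
  forall x r, x \in A -> linear (fun h => K (upd r x h)).

Lemma ev_sum t h I (s : seq I) (K : I -> (L -> H) -> V) r :
  ev t h (fun r => \sum_(i <- s) K i r) r = \sum_(i <- s) ev t h (K i) r.
Proof.
elim: t h K r => [x|t1 IH1 t2 IH2|g t IHt] h K r //=.
rewrite /copsum exchange_big; apply: eq_bigr => p _ /=.
by rewrite -IH1; congr ev; apply/funext => r'; rewrite IH2.
Qed.

Lemma ev_D t h g (K : H -> H -> (L -> H) -> V) r :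
  ev t h (fun r => D g (fun x y => K x y r)) r = D g (fun x y => ev t h (K x y) r).
Proof. exact: ev_sum. Qed.

Lemma ev_scale t h a K r : ev t h (fun r => a *: K r) r = a *: ev t h K r.
Proof.
elim: t h K r => [x|t1 IH1 t2 IH2|g t IHt] h K r //=.
rewrite /copsum scaler_sumr; apply: eq_bigr => p _ /=.
by rewrite -IH1; congr ev; apply/funext => r'; rewrite IH2.
Qed.

Lemma ev_add t h K K' r :
  ev t h (fun r => K r + K' r) r = ev t h K r + ev t h K' r.
Proof.
elim: t h K K' r => [x|t1 IH1 t2 IH2|g t IHt] h K K' r //=.
rewrite /copsum -big_split; apply: eq_bigr => p _ /=.
by rewrite -IH1; congr ev; apply/funext => r'; rewrite IH2.
Qed.

Lemma ev_linear t h r : forall a K K',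
  ev t h (fun r => a *: K r + K' r) r = a *: ev t h K r + ev t h K' r.
Proof. by move=> a K K'; rewrite ev_add ev_scale. Qed.

Lemma ev_linK t h r (F : H -> (L -> H) -> V) :
  (forall r, linear (fun g => F g r)) -> linear (fun g => ev t h (F g) r).
Proof.
move=> Fl a u v; rewrite -ev_linear; congr ev.
by apply/funext => r'; rewrite Fl.
Qed.

Section Multilinear.
Variable A : seq L.

Lemma ev_mlin t h K : {subset leaves t <= A} -> mlin A K -> mlin A (ev t h K).
Proof.
elim: t h K => [x|t1 IH1 t2 IH2|g t IHt] h K /= tA Km y r yA.
- case: (eqVneq x y) => [->|xy].
    rewrite (_ : (fun _ => _) = (fun a => K (upd r y (h * a)))).
      by apply: (linear_comp (Km y r yA)); lin.
    by apply/funext => a; rewrite updK upd_same.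
  rewrite (_ : (fun _ => _) = (fun a => K (upd (upd r x (h * r x)) y a))).
    exact: Km.
  by apply/funext => a; rewrite upd_other // updC // eq_sym.
- apply: (D_linF _ _ (F := fun a x z => ev t1 x (ev t2 z K) (upd r y a))) => x z.
  apply: IH1 => // [w wt|]; first by apply: tA; rewrite mem_cat wt.
  by apply: IH2 => // w wt; apply: tA; rewrite mem_cat wt orbT.
- exact: IHt.
Qed.

Lemma ev_lin t K r : {subset leaves t <= A} -> mlin A K ->
  linear (fun h => ev t h K r).
Proof.
elim: t K r => [x|t1 IH1 t2 IH2|g t IHt] K r /= tA Km.
- apply: (linear_comp (f := fun h => h * r x) (Km x r _)); last by lin.
  by apply: tA; rewrite mem_head.
- have t1A : {subset leaves t1 <= A} by move=> w wt; apply: tA; rewrite mem_cat wt.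
  have t2A : {subset leaves t2 <= A}.
    by move=> w wt; apply: tA; rewrite mem_cat wt orbT.
  apply: D_lin; split=> x; first by apply: IH1 => //; apply: ev_mlin.
  by apply: ev_linK => r'; apply: IH2.
- by apply: (linear_comp (f := fun h => h * g) (IHt K r tA Km)); lin.
Qed.

Lemma ev_bil t1 t2 K r : {subset leaves t1 <= A} -> {subset leaves t2 <= A} ->
  mlin A K -> bilinear (fun x y => ev t1 x (ev t2 y K) r).
Proof.
move=> t1A t2A Km; split=> x; first by apply: ev_lin => //; apply: ev_mlin.
by apply: ev_linK => r'; apply: ev_lin.
Qed.

Lemma ev_Br1 t1 t2 K r : {subset leaves t1 <= A} -> {subset leaves t2 <= A} ->
  mlin A K -> ev (Br t1 t2) 1 K r = ev t1 1 (ev t2 1 K) r.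
Proof. by move=> t1A t2A Km; rewrite /= D_1 //; apply: ev_bil. Qed.

End Multilinear.

Lemma ev_commLf x t g h K r : x \notin leaves t ->
  ev (Lf x) g (ev t h K) r = ev t h (ev (Lf x) g K) r.
Proof.
elim: t h K r => [y|t1 IH1 t2 IH2|a t IHt] h K r /=.
- rewrite inE => xy; have yx : y != x by rewrite eq_sym.
  by rewrite !upd_other // updC.
- rewrite mem_cat negb_or => /andP[x1 x2]; apply: eq_D => u v.
  rewrite -[LHS]/(ev (Lf x) g (ev t1 u (ev t2 v K)) r) IH1 //.
  by congr ev; apply/funext => r'; rewrite IH2.
- by move=> xt; rewrite -IHt.
Qed.

Definition disj (s t : seq L) := forall x, x \in s -> x \notin t.

(** The two trees modify labels at different leaves. *)
Lemma ev_comm s t g h K r : disj (leaves s) (leaves t) ->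
  ev s g (ev t h K) r = ev t h (ev s g K) r.
Proof.
elim: s g K r => [x|s1 IH1 s2 IH2|a s IHs] g K r st.
- by apply: ev_commLf; apply: st; rewrite mem_head.
- rewrite [in RHS](_ : ev (Br s1 s2) g K =
    fun r => D g (fun x y => ev s1 x (ev s2 y K) r)) // ev_D.
  apply: eq_D => x y; rewrite -IH1; last first.
    by move=> z zs; apply: st; rewrite mem_cat zs.
  congr ev; apply/funext => r'; apply: IH2.
  by move=> z zs; apply: st; rewrite mem_cat zs orbT.
- exact: IHs.
Qed.

Section Plugging.
Variables (I : eqType) (f : I -> tm).

(* h_(1), h_(2), ... applied to the outputs of the trees f i, i in l. *)
Fixpoint ev_cop (l : seq I) h K r : V :=
  if l is i :: l' then D h (fun x y => ev (f i) x (ev_cop l' y K) r)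
  else (eps h : k) *: K r.

(** Here the elements [p i] are independent of each other, unlike in [ev_cop]: this is one summand
    of the right-hand side of [HSlide]. *)
Definition ev_fam (l : seq I) (p : I -> H) K : (L -> H) -> V :=
  foldr (fun i K => ev (f i) (p i) K) K l.

Definition fam_leaves (l : seq I) := flatten [seq leaves (f i) | i <- l].

Lemma fam_leaves_cat l1 l2 : fam_leaves (l1 ++ l2) = fam_leaves l1 ++ fam_leaves l2.
Proof. by rewrite /fam_leaves map_cat flatten_cat. Qed.

Lemma ev_cop_sum l h J (s : seq J) (K : J -> (L -> H) -> V) r :
  ev_cop l h (fun r => \sum_(i <- s) K i r) r = \sum_(i <- s) ev_cop l h (K i) r.
Proof.
elim: l h K r => [|i l IHl] h K r /=; first by rewrite scaler_sumr.
rewrite /copsum exchange_big; apply: eq_bigr => p _ /=.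
by rewrite -ev_sum; congr ev; apply/funext => r'; rewrite IHl.
Qed.

Lemma ev_cop_scale l h a K r : ev_cop l h (fun r => a *: K r) r = a *: ev_cop l h K r.
Proof.
elim: l h r => [|i l IHl] h r /=; first by rewrite !scalerA mulrC.
rewrite (D_hom _ _ (f := fun u => a *: u)); last by lin.
apply: eq_D => x y; rewrite -ev_scale; congr ev.
by apply/funext => r'; rewrite IHl.
Qed.

Lemma ev_cop_linK l h r (F : H -> (L -> H) -> V) :
  (forall r, linear (fun g => F g r)) -> linear (fun g => ev_cop l h (F g) r).
Proof.
move=> Fl; elim: l h r => [|i l IHl] h r /=; first by apply: linear_scale.
apply: (D_linF _ _ (F := fun g x y => ev (f i) x (ev_cop l y (F g)) r)) => x y.
by apply: ev_linK => r'; apply: IHl.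
Qed.

Lemma ev_cop_comm l t g h K r : disj (fam_leaves l) (leaves t) ->
  ev_cop l g (ev t h K) r = ev t h (ev_cop l g K) r.
Proof.
elim: l g K r => [|i l IHl] g K r lt; first by rewrite /= ev_scale.
rewrite [in RHS](_ : ev_cop (i :: l) g K =
    fun r => D g (fun x y => ev (f i) x (ev_cop l y K) r)) // ev_D.
apply: eq_D => x y; rewrite -ev_comm; last first.
  by move=> z zs; apply: lt; rewrite mem_cat zs.
congr ev; apply/funext => r'; apply: IHl.
by move=> z zs; apply: lt; rewrite mem_cat zs orbT.
Qed.

Lemma ev_cop_commd l1 l2 g h K r : disj (fam_leaves l1) (fam_leaves l2) ->
  ev_cop l1 g (ev_cop l2 h K) r = ev_cop l2 h (ev_cop l1 g K) r.
Proof.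
elim: l2 h K r => [|i l IHl] h K r lt /=.
  exact: ev_cop_scale.
rewrite ev_cop_sum; apply: eq_bigr => p _; rewrite ev_cop_comm; last first.
  by move=> z /lt; rewrite mem_cat negb_or => /andP[].
congr ev; apply/funext => r'; apply: IHl.
by move=> z /lt; rewrite mem_cat negb_or => /andP[].
Qed.

Lemma ev_fam_comm l1 t h p K r : disj (fam_leaves l1) (leaves t) ->
  ev_fam l1 p (ev t h K) r = ev t h (ev_fam l1 p K) r.
Proof.
elim: l1 K r => [|i l IHl] K r lt //=.
rewrite -ev_comm; last by move=> z zs; apply: lt; rewrite mem_cat zs.
congr ev; apply/funext => r'; apply: IHl.
by move=> z zs; apply: lt; rewrite mem_cat zs orbT.
Qed.

Lemma ev_fam_commd l1 l2 p K r : disj (fam_leaves l1) (fam_leaves l2) ->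
  ev_fam l1 p (ev_fam l2 p K) r = ev_fam l2 p (ev_fam l1 p K) r.
Proof.
elim: l2 K r => [|i l IHl] K r lt //=.
rewrite ev_fam_comm; last by move=> z /lt; rewrite mem_cat negb_or => /andP[].
congr ev; apply/funext => r'; apply: IHl.
by move=> z /lt; rewrite mem_cat negb_or => /andP[].
Qed.

Lemma ev_fam_cat l1 l2 p K : ev_fam (l1 ++ l2) p K = ev_fam l1 p (ev_fam l2 p K).
Proof. by rewrite /ev_fam foldr_cat. Qed.

Section PluggingMultilinear.
Variable A : seq L.

Lemma ev_cop_mlin l h K : {subset fam_leaves l <= A} -> mlin A K -> mlin A (ev_cop l h K).
Proof.
elim: l h => [|i l IHl] h lA Km x r xA /=.
  by apply: linear_scale; apply: Km.
apply: (D_linF _ _ (F := fun a u v => ev (f i) u (ev_cop l v K) (upd r x a))) => u v.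
apply: (@ev_mlin A) => // [w wt|]; first by apply: lA; rewrite mem_cat wt.
by apply: IHl => // w wt; apply: lA; rewrite mem_cat wt orbT.
Qed.

Lemma ev_cop_bil i l r K : {subset fam_leaves (i :: l) <= A} -> mlin A K ->
  (forall r, linear (fun h => ev_cop l h K r)) ->
  bilinear (fun x y => ev (f i) x (ev_cop l y K) r).
Proof.
move=> lA Km dl; have iA : {subset leaves (f i) <= A}.
  by move=> w wt; apply: lA; rewrite mem_cat wt.
split=> x; last by apply: ev_linK => r'; apply: dl.
apply: (@ev_lin A) => //; apply: ev_cop_mlin => // w wt.
by apply: lA; rewrite mem_cat wt orbT.
Qed.

Lemma ev_cop_lin l K r : {subset fam_leaves l <= A} -> mlin A K ->
  linear (fun h => ev_cop l h K r).
Proof.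
elim: l r => [|i l IHl] r lA Km /=; first by lin.
apply: D_lin; apply: ev_cop_bil => // r'; apply: IHl => // w wt.
by apply: lA; rewrite mem_cat wt orbT.
Qed.

Lemma ev_cop_cat l1 l2 h K r : {subset fam_leaves (l1 ++ l2) <= A} -> mlin A K ->
  ev_cop (l1 ++ l2) h K r = D h (fun x y => ev_cop l1 x (ev_cop l2 y K) r).
Proof.
elim: l1 h K r => [|i l1 IHl] h K r lA Km.
  rewrite -[LHS](D_counl hH h (f := fun h => ev_cop l2 h K r)) //.
  exact: ev_cop_lin.
have lA' : {subset fam_leaves (l1 ++ l2) <= A}.
  by move=> w wt; apply: lA; rewrite mem_cat wt orbT.
have iA : {subset leaves (f i) <= A}.
  by move=> w wt; apply: lA; rewrite mem_cat wt.
have l1A : {subset fam_leaves l1 <= A}.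
  by move=> w wt; apply: lA'; rewrite fam_leaves_cat mem_cat wt.
have l2A : {subset fam_leaves l2 <= A}.
  by move=> w wt; apply: lA'; rewrite fam_leaves_cat mem_cat wt orbT.
rewrite /= -(D_coassoc _ (F := fun u v y => ev (f i) u (ev_cop l1 v (ev_cop l2 y K)) r)).
  apply: eq_D => x y; rewrite -ev_D; congr ev.
  by apply/funext => r'; apply: IHl.
split=> x y.
- by apply: (@ev_lin A) => //; do 2 apply: ev_cop_mlin => //.
- by apply: ev_linK => r'; apply: ev_cop_lin => //; apply: ev_cop_mlin.
by apply: ev_linK => r'; apply: ev_cop_linK => r1; apply: ev_cop_lin.
Qed.

Lemma ev_cop_1 i h K r : {subset leaves (f i) <= A} -> mlin A K ->
  ev_cop [:: i] h K r = ev (f i) h K r.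
Proof.
move=> iA Km; rewrite -[RHS](D_counr hH h (f := fun h => ev (f i) h K r)).
  by apply: eq_D => x y; rewrite -ev_scale.
exact: (@ev_lin A).
Qed.

(** Exchanging two adjacent blocks of [l1] exchanges the corresponding factors of the coproduct,
    which cocommutativity allows, and the order of evaluation, which disjointness of the leaves
    allows. *)
Lemma ev_cop_perm l1 l2 h K r : perm_eq l1 l2 -> uniq (fam_leaves l1) ->
  {subset fam_leaves l1 <= A} -> mlin A K -> ev_cop l1 h K r = ev_cop l2 h K r.
Proof.
move=> l12 Ul lA Km.
(* Uniqueness and inclusion in [A] belong to the induction predicate because every exchange of
   blocks uses them. *)
pose P s := uniq (fam_leaves s) /\ {subset fam_leaves s <= A} /\
    forall h r, ev_cop l1 h K r = ev_cop s h K r.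
suff : P l2 by case=> _ [].
apply: (@catCA_perm_ind _ P) l12 _; last by [].
move=> s1 s2 s3 IH; clear Ul lA.
have [Ul [lA E]] := IH.
have pl : perm_eq (fam_leaves (s1 ++ s2 ++ s3)) (fam_leaves (s2 ++ s1 ++ s3)).
  by rewrite !fam_leaves_cat; apply/permP => a; rewrite !count_cat; lia.
split; first by rewrite -(perm_uniq pl).
split; first by move=> x; rewrite -(perm_mem pl); apply: lA.
move=> {}h {}r; rewrite E !catA.
have lA' s : {subset s <= s1 ++ s2 ++ s3} -> {subset fam_leaves s <= A}.
  move=> ss x /flattenP[/= c /mapP[i /ss i123 ->] xi]; apply: lA.
  by apply/flattenP; exists (leaves (f i)) => //; apply: map_f.
have sA1 : {subset fam_leaves s1 <= A} by apply: lA' => x; rewrite !mem_cat => ->.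
have sA2 : {subset fam_leaves s2 <= A}.
  by apply: lA' => x; rewrite !mem_cat => ->; rewrite orbT.
have sA12 : {subset fam_leaves (s1 ++ s2) <= A}.
  by apply: lA' => x; rewrite catA !mem_cat => ->.
have sA21 : {subset fam_leaves (s2 ++ s1) <= A}.
  by apply: lA' => x; rewrite catA !mem_cat [(_ \in s2) || _]orbC => ->.
have sA3 : {subset fam_leaves s3 <= A}.
  by apply: lA' => x; rewrite !mem_cat => ->; rewrite !orbT.
rewrite ev_cop_cat // 1?ev_cop_cat //; try by rewrite -catA; apply: lA'.
  apply: eq_D => x y; have K3 := ev_cop_mlin y sA3 Km.
  rewrite !ev_cop_cat // (D_comm coc).
    apply: eq_D => u v; apply: ev_cop_commd => w w2.
    move: Ul; rewrite !fam_leaves_cat cat_uniq => /and3P[_ /hasPn /(_ w) Uw _].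
    by apply/negP => w1; move: Uw; rewrite mem_cat w1 w2 => /(_ isT).
  split=> u; first by apply: ev_cop_lin => //; apply: ev_cop_mlin.
  by apply: ev_cop_linK => r1; apply: ev_cop_lin => //.
by move=> x; rewrite -catA -(perm_mem pl); apply: lA.
Qed.

End PluggingMultilinear.
End Plugging.
End Evaluation.

(** * Evaluation respects sliding through Lie elements and turning an edge around *)

Section Sliding.
Variables (k : fieldType) (H : algType k) (hH : hopf H).
Hypothesis coc : cocommutative hH.
Local Notation S := (antip hH).
Local Notation eps := (cou hH).
Local Notation D := (@copsum k H hH _).
Variables (L : eqType) (V : lmodType k) (A : seq L).
Local Notation tm := (tm H L).
Implicit Types (K : (L -> H) -> V) (r : L -> H) (t : tm).
Local Notation ev := (@ev k H hH L V).
Local Notation mlin := (@mlin k H L V A).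

Lemma leaves_bind (I : eqType) (f : I -> tm) o :
  leaves (bind f o) = fam_leaves f (leaves o).
Proof.
elim: o => [i|o1 IH1 o2 IH2|g o IHo] //=; first by rewrite /fam_leaves /= cats0.
by rewrite fam_leaves_cat IH1 IH2.
Qed.

(** Coassociativity forgets the bracketing of [o]: only the sequence of its leaves matters. *)
Lemma ev_bind (I : eqType) (f : I -> tm) o h K r :
  lie o -> {subset leaves (bind f o) <= A} -> mlin K ->
  ev (bind f o) h K r = ev_cop hH f (leaves o) h K r.
Proof.
elim: o h K r => [i|o1 IH1 o2 IH2|//] h K r /=.
  by move=> _ iA Km; rewrite -[RHS]/(ev_cop hH f [:: i] h K r) (@ev_cop_1 _ _ _ _ _ _ _ A).
case/andP=> l1 l2 oA Km; rewrite (@ev_cop_cat _ _ _ _ _ _ _ A) //; last first.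
  by rewrite fam_leaves_cat -!leaves_bind.
have o1A : {subset leaves (bind f o1) <= A}.
  by move=> x xo; apply: oA; rewrite mem_cat xo.
have o2A : {subset leaves (bind f o2) <= A}.
  by move=> x xo; apply: oA; rewrite mem_cat xo orbT.
apply: eq_D => x y; rewrite IH1 //; last exact: ev_mlin.
by congr ev_cop; apply/funext => r'; rewrite IH2.
Qed.

Lemma ev_bind_Op (I : eqType) (f : I -> tm) o (p : I -> H) K r :
  lie o -> {subset leaves (bind f o) <= A} -> mlin K ->
  ev (bind (fun i => Op (p i) (f i)) o) 1 K r = ev_fam hH f (leaves o) p K r.
Proof.
elim: o K r => [i|o1 IH1 o2 IH2|//] K r; first by rewrite /= mul1r.
case/andP=> l1 l2 oA Km; rewrite [leaves _]/= ev_fam_cat.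
have lE o : leaves (bind (fun i => Op (p i) (f i)) o) = leaves (bind f o).
  by rewrite !leaves_bind.
have o1A : {subset leaves (bind f o1) <= A}.
  by move=> x xo; apply: oA; rewrite mem_cat xo.
have o2A : {subset leaves (bind f o2) <= A}.
  by move=> x xo; apply: oA; rewrite mem_cat xo orbT.
rewrite [bind _ _]/= (@ev_Br1 _ _ _ _ _ A) ?lE // IH1 //; last first.
  by apply: ev_mlin; rewrite ?lE.
by congr ev_fam; apply/funext => r'; rewrite IH2.
Qed.

Lemma ev_fam_perm (I : eqType) (f : I -> tm) l1 l2 p K r : perm_eq l1 l2 ->
  uniq (fam_leaves f l1) -> ev_fam hH f l1 p K r = ev_fam hH f l2 p K r.
Proof.
move=> l12 Ul.
pose P s := uniq (fam_leaves f s) /\ forall r, ev_fam hH f l1 p K r = ev_fam hH f s p K r.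
suff : P l2 by case=> _.
apply: (@catCA_perm_ind _ P) l12 _; last by [].
move=> s1 s2 s3 [{}Ul E].
have pl : perm_eq (fam_leaves f (s1 ++ s2 ++ s3)) (fam_leaves f (s2 ++ s1 ++ s3)).
  by rewrite !fam_leaves_cat; apply/permP => a; rewrite !count_cat; lia.
split; first by rewrite -(perm_uniq pl).
move=> r'; rewrite E !ev_fam_cat; apply: ev_fam_commd => w w1; apply/negP => w2.
move: Ul; rewrite !fam_leaves_cat cat_uniq => /and3P[_ /hasPn /(_ w) Uw _].
by move: Uw; rewrite mem_cat w1 w2 => /(_ isT).
Qed.

Lemma ev_fam_mlin (I : eqType) (f : I -> tm) l p K :
  {subset fam_leaves f l <= A} -> mlin K -> mlin (ev_fam hH f l p K).
Proof.
elim: l => [|i l IHl] lA Km //=; apply: ev_mlin => [x xi|].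
  by apply: lA; rewrite mem_cat xi.
by apply: IHl => // x xi; apply: lA; rewrite mem_cat xi orbT.
Qed.

Lemma eq_ev_fam (I : eqType) (f : I -> tm) l p q K :
  {in l, p =1 q} -> ev_fam hH f l p K = ev_fam hH f l q K.
Proof.
elim: l => [|i l IHl] pq //=; rewrite pq ?mem_head // IHl // => j jl.
by apply: pq; rewrite inE jl orbT.
Qed.

Lemma ev_fam_lin (I : eqType) (f : I -> tm) l p i K r :
  {subset fam_leaves f l <= A} -> mlin K -> uniq l -> i \in l ->
  linear (fun h => ev_fam hH f l (upd p i h) K r).
Proof.
elim: l r => [|j l IHl] r lA Km //= /andP[jl Ul].
have jA : {subset leaves (f j) <= A} by move=> x xi; apply: lA; rewrite mem_cat xi.
have lA' : {subset fam_leaves f l <= A}.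
  by move=> x xi; apply: lA; rewrite mem_cat xi orbT.
rewrite inE; case: (eqVneq i j) => [-> _|ij /= il].
  rewrite (_ : (fun _ => _) = fun h => ev (f j) h (ev_fam hH f l p K) r).
    by apply: (@ev_lin _ _ _ _ _ A) => //; apply: ev_fam_mlin.
  apply/funext => h; rewrite upd_same; congr ev.
  apply: eq_ev_fam => x xl; apply: upd_other.
  by apply: contraNneq jl => <-.
rewrite (_ : (fun _ => _) = fun h => ev (f j) (p j) (ev_fam hH f l (upd p i h) K) r).
  by apply: ev_linK => r'; apply: IHl.
by apply/funext => h; rewrite upd_other // eq_sym.
Qed.

Lemma ev_itD t g n h (F : (nat -> H) -> (L -> H) -> V) r :
  ev t g (fun r => itD hH n h (fun p => F p r)) r =
  itD hH n h (fun p => ev t g (F p) r).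
Proof.
elim: n h F => [|n IHn] h F //=; rewrite ev_D; apply: eq_D => x y.
exact: IHn.
Qed.

Lemma ev_fam_map (f : nat -> tm) l p K :
  ev_fam hH f [seq i.+1 | i <- l] p K =
  ev_fam hH (fun i => f i.+1) l (fun i => p i.+1) K.
Proof. by rewrite /ev_fam foldr_map. Qed.

Lemma ev_cop_map (f : nat -> tm) l h K r :
  ev_cop hH f [seq i.+1 | i <- l] h K r = ev_cop hH (fun i => f i.+1) l h K r.
Proof.
elim: l h r => [|i l IHl] h r //=; apply: eq_D => x y.
by congr ev; apply/funext => r'.
Qed.

Lemma iotaS n : iota 0 n.+1 = 0%N :: [seq i.+1 | i <- iota 0 n].
Proof. by rewrite /= (iotaDl 1 0 n). Qed.

Lemma itD_ev_fam n (f : nat -> tm) h K r :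
  {subset fam_leaves f (iota 0 n.+1) <= A} -> mlin K ->
  itD hH n h (fun p => ev_fam hH f (iota 0 n.+1) p K r) =
  ev_cop hH f (iota 0 n.+1) h K r.
Proof.
elim: n f h r => [|n IHn] f h r fA Km.
  rewrite [RHS](@ev_cop_1 _ _ _ _ _ _ _ A) // => x xA.
  by apply: fA; rewrite /fam_leaves /= cats0.
rewrite (iotaS n.+1) [LHS]/= [RHS]/=; apply: eq_D => x y.
under [X in itD _ _ _ X]funext => p do rewrite ev_fam_map.
rewrite -(ev_itD (f 0%N) x n y
  (fun p => ev_fam hH (fun i => f i.+1) (iota 0 n.+1) p K)).
congr ev; apply/funext => r'; rewrite IHn //; first by rewrite -ev_cop_map.
move=> z; rewrite /fam_leaves => zf; apply: fA; rewrite (iotaS n.+1) /fam_leaves /= mem_cat.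
by rewrite -map_comp zf orbT.
Qed.

(** This is what [HSlide] demands. The leaves of [o] come in any order while the Sweedler expression
    numbers its factors 0, ..., n; cocommutativity sorts the leaves, after which both sides are the
    same iterated sum. *)
Lemma sweedler_ev_fam n (f : nat -> tm) (o : Defs.tm H nat) h s K r :
    lie o -> perm_eq (leaves o) (iota 0 n.+1) -> sweedler hH n h s ->
    uniq (leaves (bind f o)) -> {subset leaves (bind f o) <= A} -> mlin K ->
  ev (bind f o) h K r =
  \sum_(p <- s) ev (bind (fun i => Op (p i) (f i)) o) 1 K r.
Proof.
move=> lo po sP Uo oA Km; rewrite ev_bind //.
rewrite leaves_bind in Uo oA.
have fA : {subset fam_leaves f (iota 0 n.+1) <= A}.
  move=> x xi; apply: oA; move: xi; rewrite /fam_leaves.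
  by move/flattenP=> [c /mapP[i ii ->] xi]; apply/flattenP;
    exists (leaves (f i)) => //; apply: map_f; rewrite (perm_mem po).
rewrite (@ev_cop_perm _ _ _ coc _ _ _ _ A _ _ _ _ _ po) // -itD_ev_fam //.
under eq_bigr => p _ do rewrite ev_bind_Op ?leaves_bind // (ev_fam_perm _ _ _ po) //.
rewrite (sweedler_sum (G := fun p => ev_fam hH f (iota 0 n.+1) p K r) _ sP) //.
split=> [i p lein|p q pq].
  by apply: ev_fam_lin => //; rewrite ?iota_uniq // mem_iota.
by rewrite (@eq_ev_fam _ _ _ p q) // => i; rewrite mem_iota => /pq.
Qed.

Local Notation dg := (ev_cop hH (@Lf H L)).

Lemma fam_leaves_Lf l : fam_leaves (@Lf H L) l = l.
Proof. by rewrite /fam_leaves /=; elim: l => //= x l ->. Qed.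

(** Elements pushed down multiply on the left, so [g] reaches the leaves first and [h] then acts
    diagonally on all of them. *)
Lemma ev_mulh t h g K r : uniq (leaves t) -> {subset leaves t <= A} -> mlin K ->
  ev t (h * g) K r = ev t g (dg (leaves t) h K) r.
Proof.
elim: t h g K r => [x|t1 IH1 t2 IH2|a t IHt] h g K r Ut tA Km.
- rewrite -[RHS]/(dg [:: x] h K (upd r x (g * r x))) (@ev_cop_1 _ _ _ _ _ _ _ A) //=.
  by rewrite updK upd_same mulrA.
- have t1A : {subset leaves t1 <= A}.
    by move=> x xo; apply: tA; rewrite mem_cat xo.
  have t2A : {subset leaves t2 <= A}.
    by move=> x xo; apply: tA; rewrite mem_cat xo orbT.
  move: Ut; rewrite /= cat_uniq => /and3P[U1 /hasPn U12 U2].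
  rewrite D_mul; last exact: (@ev_bil _ _ _ _ _ A).
  rewrite D_exch; apply: eq_D => g1 g2.
  transitivity (D h (fun x y => ev t1 g1 (ev t2 g2
      (dg (leaves t1) x (dg (leaves t2) y K))) r)).
    apply: eq_D => x y; rewrite IH1 //; last exact: ev_mlin.
    congr ev; apply/funext => r'; rewrite -ev_cop_comm; last first.
      by rewrite fam_leaves_Lf => z z1; apply/negP => /U12; rewrite /= z1.
    by congr ev_cop; apply/funext => r1; rewrite IH2.
  rewrite -ev_D; congr ev; apply/funext => r'.
  rewrite -ev_D; congr ev; apply/funext => r1.
  by rewrite (@ev_cop_cat _ _ _ _ _ _ _ A) // fam_leaves_Lf.
- by rewrite /= -mulrA IHt.
Qed.

(** Invariance of [K] under the diagonal left action of H on the labels of all slots in [A]. *)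
Definition invK K := forall h r, dg A h K r = (eps h : k) *: K r.

(** Write h on [s] as h_(1) on [s] together with h_(2) S(h_(3)) on [t]. The parts h_(1) on [s] and
    h_(2) on [t] form the diagonal action on all slots, a scalar by [invK], and S(h_(3)) on [t] is
    left. *)
Lemma ev_inv s t h K r : uniq A -> perm_eq (leaves s ++ leaves t) A ->
  mlin K -> invK K -> ev s h (ev t 1 K) r = ev s 1 (ev t (S h) K) r.
Proof.
move=> UA stA Km Ki.
have sA : {subset leaves s <= A}.
  by move=> x xs; rewrite -(perm_mem stA) mem_cat xs.
have tA : {subset leaves t <= A}.
  by move=> x xs; rewrite -(perm_mem stA) mem_cat xs orbT.
have Ust : uniq (leaves s ++ leaves t) by rewrite (perm_uniq stA).
move: (Ust); rewrite cat_uniq => /and3P[Us /hasPn Ust' Ut].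
have l1 x : linear (fun g => ev s x (ev t g K) r).
  by apply: ev_linK => r'; apply: (@ev_lin _ _ _ _ _ A).
have l2 y : linear (fun g => ev s g (ev t y K) r).
  by apply: (@ev_lin _ _ _ _ _ A) => //; apply: ev_mlin.
transitivity (D h (fun x y => D y (fun y1 y2 => ev s x (ev t (y1 * S y2) K) r))).
  rewrite -[LHS](D_counr hH h (f := fun x => ev s x (ev t 1 K) r)) //.
  apply: eq_D => x y.
  by rewrite (D_antipr hH y (f := fun u => ev s x (ev t u K) r)).
rewrite (D_coassoc _ (F := fun x y1 y2 => ev s x (ev t (y1 * S y2) K) r)).
  rewrite -[RHS](D_counl hH h (f := fun z => ev s 1 (ev t (S z) K) r)); last first.
    exact: linear_comp (l1 1) (S_linear hH).
  apply: eq_D => p z.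
  transitivity (D p (fun x y => ev s 1 (ev t (S z)
      (dg (leaves s) x (dg (leaves t) y K))) r)).
    apply: eq_D => x y; rewrite -{1}[x]mulr1 ev_mulh //; last exact: ev_mlin.
    congr ev; apply/funext => r'; rewrite -ev_cop_comm; last first.
      by rewrite fam_leaves_Lf => w w1; apply/negP => /Ust'; rewrite /= w1.
    by congr ev_cop; apply/funext => r1; rewrite ev_mulh.
  rewrite -ev_D -ev_scale; congr ev; apply/funext => r'.
  rewrite -ev_D -ev_scale; congr ev; apply/funext => r1.
  rewrite -Ki -(@ev_cop_cat _ _ _ _ _ _ _ A) ?fam_leaves_Lf //.
    apply: (@ev_cop_perm _ _ _ coc _ _ _ _ A) => //; rewrite fam_leaves_Lf //.
    by move=> x; rewrite (perm_mem stA).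
  by move=> x; rewrite (perm_mem stA).
split=> x y; first exact: l2.
  by apply: (linear_comp (l1 x)); lin.
by apply: (linear_comp (l1 x)); lin.
Qed.

End Sliding.

Ltac perm_count :=
  clear; apply/permP => ?; rewrite /slots /= ?(leaves_bind, count_cat) /=; lia.

Section FreeModules.
Variables (k : fieldType) (T : choiceType) (V : lmodType k).

Definition fext (f : T -> V) : freemod k T -> V := fglift f.

Lemma fext_linear f : linear (fext f). Proof. exact: fglift_linear. Qed.

Lemma fextU f x : fext f << x >> = f x.
Proof. by rewrite /fext liftU scale1r. Qed.

End FreeModules.

(** * Functions on HLie *)

Section TreeFunctions.
Variables (k : fieldType) (H : algType k) (hH : hopf H) (L : choiceType).
Local Notation S := (antip hH).
Local Notation D := (@copsum k H hH _).
Local Notation tm := (tm H L).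
Local Notation tree := (tree H L).
Variables (V : lmodType k).
Implicit Types (X : seq L) (f : tree -> V) (s t u v : tm).

Definition ext X f : freemod k (treeOn H X) -> V :=
  fext (fun u : treeOn H X => f (val u)).

Lemma ext_linear X f : linear (@ext X f). Proof. exact: fext_linear. Qed.

Lemma ext_tr X f (t : tree) : ext f (tr X t) = if perm_eq (slots t) X then f t else 0.
Proof.
rewrite /tr; case: insubP => [u tX <-|/negPf tX].
  by rewrite (valP u) /ext fextU.
by rewrite tX (lin0 (@ext_linear X f)).
Qed.

(* The functions of trees inducing a linear map on HLie X. *)
Definition hlie_fun X f := forall r, HLie_rel hH r -> ext (X := X) f r = 0.

Lemma hlie_fun_sum X f (s : seq (k * tree)) : hlie_fun X f ->
    (forall c, c \in s -> perm_eq (slots c.2) X) ->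
    \sum_(c <- s) c.1 *: hl hH X c.2 = 0 ->
  \sum_(c <- s) c.1 *: f c.2 = 0.
Proof.
move=> Xf sX; have prl := linear_fun (pr (@HLie_rel k H hH L X)).
have -> : \sum_(c <- s) c.1 *: hl hH X c.2 =
  pr (@HLie_rel k H hH L X) (\sum_(c <- s) c.1 *: tr X c.2).
  by rewrite (lin_sum prl); apply: eq_bigr => c _; rewrite (linZ prl).
move/pr0P/(span_ker (@ext_linear X f) Xf) => E.
rewrite -[RHS]E (lin_sum (@ext_linear X f)); apply: eq_big_seq => c cs.
by rewrite (linZ (@ext_linear X f)) ext_tr sX.
Qed.

(** The relations of HLie as rewriting rules on values. Sliding is kept for a single bracket
    ([rule_br]), applied repeatedly to reach the leaves. *)
Record tree_rules X f := TreeRules {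
  rule_sym : forall s t, perm_eq (slots (s, t)) X -> f (s, t) = f (t, s);
  rule_rot : forall s t u, perm_eq (slots (Br s t, u)) X ->
    f (Br s t, u) = f (s, Br t u);
  rule_inv : forall h s t, perm_eq (slots (s, t)) X ->
    f (Op h s, t) = f (s, Op (S h) t);
  rule_as : forall s t u, perm_eq (slots (Br s t, u)) X ->
    f (Br s t, u) = - f (Br t s, u);
  rule_ihx : forall s t u v, perm_eq (slots (Br (Br s t) u, v)) X ->
    f (Br (Br s t) u, v) + f (Br (Br t u) s, v) + f (Br (Br u s) t, v) = 0;
  rule_lin : forall s t, perm_eq (slots (s, t)) X ->
    linear (fun h => f (Op h s, t));
  rule_unit : forall s t, perm_eq (slots (s, t)) X -> f (Op 1 s, t) = f (s, t);
  rule_mul : forall g h s t, perm_eq (slots (s, t)) X ->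
    f (Op (g * h) s, t) = f (Op g (Op h s), t);
  rule_br : forall h s t u, perm_eq (slots (Br s t, u)) X ->
    f (Op h (Br s t), u) = D h (fun x y => f (Br (Op x s) (Op y t), u))
}.

Lemma hlie_fun_rules X f : hlie_fun X f -> tree_rules X f.
Proof.
move=> Xf; have fl := @ext_linear X f.
have sub0 (x y : V) : x - y = 0 -> x = y by move/eqP; rewrite subr_eq0 => /eqP.
split.
- move=> s t stX; apply: sub0; have := Xf _ (HSym hH X s t).
  by rewrite (linB fl) !ext_tr stX /slots perm_catC [perm_eq _ X]stX.
- move=> s t u stX; apply: sub0; have := Xf _ (HRot hH X s t u).
  by rewrite (linB fl) !ext_tr stX /slots /= catA [perm_eq _ X]stX.
- move=> h s t stX; apply: sub0; have := Xf _ (HInv hH X h s t).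
  by rewrite (linB fl) !ext_tr /slots /= [perm_eq _ X]stX.
- move=> s t u stX; have := Xf _ (HAs hH X s t u).
  rewrite (linD fl) !ext_tr stX.
  have -> : perm_eq (slots (Br t s, u)) X.
    by apply: perm_trans stX; perm_count.
  by move/eqP; rewrite addr_eq0 => /eqP.
- move=> s t u v stX; have := Xf _ (HIhx hH X s t u v).
  rewrite !(linD fl) !ext_tr stX.
  have -> : perm_eq (slots (Br (Br t u) s, v)) X.
    by apply: perm_trans stX; perm_count.
  have -> : perm_eq (slots (Br (Br u s) t, v)) X.
    by apply: perm_trans stX; perm_count.
  by [].
- move=> s t stX a g h; apply: sub0; have := Xf _ (HLin hH X a g h s t).
  rewrite !(linB fl) (linZ fl) !ext_tr /slots /= [perm_eq _ X]stX.
  by rewrite opprD addrA.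
- move=> s t stX; apply: sub0; have := Xf _ (HUnit hH X s t).
  by rewrite (linB fl) !ext_tr /slots /= [perm_eq _ X]stX.
- move=> g h s t stX; apply: sub0; have := Xf _ (HMul hH X g h s t).
  by rewrite (linB fl) !ext_tr /slots /= [perm_eq _ X]stX.
move=> h s t u stX; apply: sub0.
(* A single bracket with two inputs, that is [HSlide] for n = 1. *)
pose o : Defs.tm H nat := Br (Lf 0%N) (Lf 1%N).
pose pl (i : nat) := if i == 0%N then s else t.
pose q := [seq scons p.1 (fun _ => p.2) | p <- sw hH h].
have qP : sweedler hH 1 h q.
  rewrite /sweedler /= D_tlift; last exact: tens_bil.
  by rewrite /q big_map.
have := Xf _ (HSlide (n := 1%N) (o := o) X pl u isT isT qP).
rewrite (linB fl) (lin_sum fl) ext_tr /slots /= [perm_eq _ X]stX => <-.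
congr (_ - _); rewrite /q big_map; apply: eq_bigr => p _.
by rewrite ext_tr /slots /= [perm_eq _ X]stX.
Qed.

End TreeFunctions.

(** * The so(3) weight of a tree *)

Section CrossProduct.
Variables (k : fieldType) (H : Type) (L : Type).
Local Notation vec := (k * k * k)%type.

Definition dot (a b : vec) : k := a.1.1 * b.1.1 + a.1.2 * b.1.2 + a.2 * b.2.

Definition cross (a b : vec) : vec :=
  (a.1.2 * b.2 - a.2 * b.1.2, a.2 * b.1.1 - a.1.1 * b.2,
   a.1.1 * b.1.2 - a.1.2 * b.1.1).

(* The invariant pairing and the bracket of the Lie algebra so(3) evaluate
   trees whose leaves are labelled by vectors, ignoring the labels in H. *)
Fixpoint so3_val (w : L -> vec) (t : tm H L) : vec :=
  match t with
  | Lf x => w x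
  | Br t1 t2 => cross (so3_val w t1) (so3_val w t2)
  | Op _ t1 => so3_val w t1
  end.

Definition weight w (t : tree H L) : k := dot (so3_val w t.1) (so3_val w t.2).

Lemma dotC a b : dot a b = dot b a.
Proof. by rewrite /dot; ring. Qed.

Lemma dot_cross a b c : dot (cross a b) c = dot a (cross b c).
Proof. by rewrite /dot /cross /=; ring. Qed.

Lemma dot_crossC a b c : dot (cross a b) c = - dot (cross b a) c.
Proof. by rewrite /dot /cross /=; ring. Qed.

Lemma dot_jacobi a b c d : dot (cross (cross a b) c) d +
  dot (cross (cross b c) a) d + dot (cross (cross c a) b) d = 0.
Proof. by rewrite /dot /cross /=; ring. Qed.

Lemma cv_bind_Op (w : L -> vec) (I : Type) (f : I -> tm H L) (p : I -> H) o :
  so3_val w (bind (fun i => Op (p i) (f i)) o) = so3_val w (bind f o).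
Proof. by elim: o => [i|o1 IH1 o2 IH2|h o IHo] //=; rewrite IH1 IH2. Qed.

End CrossProduct.

Section Functional.
Variables (k : fieldType) (H : algType k) (hH : hopf H) (L : choiceType).
Hypothesis coc : cocommutative hH.
Local Notation S := (antip hH).
Local Notation D := (@copsum k H hH _).
Local Notation tm := (tm H L).
Local Notation tree := (tree H L).
Variables (V : lmodType k) (X : seq L) (K : (L -> H) -> V) (w : L -> k * k * k).
Hypotheses (UX : uniq X) (Km : mlin X K) (Ki : invK hH X K).
Local Notation ev := (@ev k H hH L V).

(** Shape and labels are separated: the weight ignores H and the evaluation ignores the bracket
    structure as far as the Lie relations see it. The evaluation starts with the trivial label 1 at
    every leaf. *)
Definition wev (t : tree) : V :=
  weight w t *: ev t.1 1 (ev t.2 1 K) (fun _ => 1).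

Let subX (s t : tm) : perm_eq (slots (s, t)) X ->
  [/\ {subset leaves s <= X}, {subset leaves t <= X} & disj (leaves s) (leaves t)].
Proof.
move=> stX; split.
- by move=> x xs; rewrite -(perm_mem stX) /slots mem_cat xs.
- by move=> x xs; rewrite -(perm_mem stX) /slots mem_cat xs orbT.
move=> x xs; have : uniq (slots (s, t)) by rewrite (perm_uniq stX).
rewrite cat_uniq => /and3P[_ /hasPn U _]; apply/negP => /U; by rewrite /= xs.
Qed.

Let brE (s t u : tm) r : perm_eq (slots (Br s t, u)) X ->
  ev (Br s t) 1 (ev u 1 K) r = ev s 1 (ev t 1 (ev u 1 K)) r.
Proof.
case/subX=> stX uX _; rewrite (@ev_Br1 _ _ _ _ _ X) //.
- by move=> x xs; apply: stX; rewrite mem_cat xs.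
- by move=> x xs; apply: stX; rewrite mem_cat xs orbT.
exact: ev_mlin.
Qed.

Let brE2 (s t u : tm) r : perm_eq (slots (Br s t, u)) X ->
  ev s 1 (ev (Br t u) 1 K) r = ev s 1 (ev t 1 (ev u 1 K)) r.
Proof.
case/subX=> stX uX _; congr ev; apply/funext => r'.
rewrite (@ev_Br1 _ _ _ _ _ X) // => x xs; apply: stX.
by rewrite mem_cat xs orbT.
Qed.

Let commE (s t u : tm) r : perm_eq (slots (Br s t, u)) X ->
  ev s 1 (ev t 1 (ev u 1 K)) r = ev t 1 (ev s 1 (ev u 1 K)) r.
Proof.
move=> stX; rewrite ev_comm // => x xs.
have : uniq (slots (Br s t, u)) by rewrite (perm_uniq stX).
rewrite /slots /= -catA cat_uniq => /and3P[_ /hasPn U _]; apply/negP => xt.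
by have := U x; rewrite /= mem_cat xt xs => /(_ isT).
Qed.

(** In every relation one of the two factors is common to all terms. For antisymmetry and IHX the
    evaluations agree and the weights cancel by antisymmetry and Jacobi; for the relations involving
    labels the weights agree and the evaluations satisfy [ev_inv], linearity or
    [sweedler_ev_fam]. *)
Lemma wev_hlie : hlie_fun hH X wev.
Proof.
have fl := @ext_linear k H L V X wev.
have pE (s t s' t' : tm) : perm_eq (slots (s, t)) (slots (s', t')) ->
    perm_eq (slots (s, t)) X = perm_eq (slots (s', t')) X.
  by move=> /permPl.
move=> _ [].
- move=> s t; rewrite (linB fl) !ext_tr (pE t s s t); last by perm_count.
  case: ifP => stX; last by rewrite subr0.
  have [_ _ st] := subX stX.
  by rewrite /wev /weight /= (ev_comm _ _ _ _ _ st) dotC subrr.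
- move=> s t u; rewrite (linB fl) !ext_tr (pE s (Br t u) (Br s t) u);
    last by perm_count.
  case: ifP => stX; last by rewrite subr0.
  rewrite /wev /weight [(_, _).1]/= [(_, _).2]/= brE // [(_, _).1]/=.
  by rewrite [(_, _).2]/= brE2 // /= dot_cross subrr.
- move=> h s t; rewrite (linB fl) !ext_tr (pE (Op h s) t s t) //.
  case: ifP => stX; last by rewrite subr0.
  by rewrite /wev /weight /= !mul1r (@ev_inv _ _ _ coc _ _ X) // subrr.
- move=> s t u; rewrite (linD fl) !ext_tr (pE (Br t s) u (Br s t) u);
    last by perm_count.
  case: ifP => stX; last by rewrite addr0.
  have tsX : perm_eq (slots (Br t s, u)) X.
    by rewrite (pE _ _ (Br s t) u) //; perm_count.
  rewrite /wev /weight [(_, _).1]/= [(_, _).2]/= brE // commE // -brE //.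
  by rewrite -scalerDl /= [X in X + _]dot_crossC addNr scale0r.
- move=> s t u v; rewrite !(linD fl) !ext_tr.
  rewrite (pE (Br (Br t u) s) v (Br (Br s t) u) v); last by perm_count.
  rewrite (pE (Br (Br u s) t) v (Br (Br s t) u) v); last by perm_count.
  case: ifP => stX; last by rewrite !addr0.
  have cX (s' t' u' : tm) : perm_eq (slots (Br (Br s' t') u', v))
      (slots (Br (Br s t) u, v)) -> perm_eq (slots (Br (Br s' t') u', v)) X.
    by move=> p; apply: perm_trans p stX.
  have E (s' t' u' : tm) r : perm_eq (slots (Br (Br s' t') u', v)) X ->
      ev (Br (Br s' t') u') 1 (ev v 1 K) r =
      ev s' 1 (ev t' 1 (ev u' 1 (ev v 1 K))) r.
    move=> X'; rewrite brE //.
    have -> : ev u' 1 (ev v 1 K) = ev (Br u' v) 1 K.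
      apply/funext => r'; rewrite (@ev_Br1 _ _ _ _ _ X) //.
        by move=> x xs; rewrite -(perm_mem X') /slots /= !mem_cat xs !orbT.
      by move=> x xs; rewrite -(perm_mem X') /slots /= !mem_cat xs !orbT.
    by apply: brE; apply: perm_trans X'; perm_count.
  rewrite /wev [(_, _).1]/= [(_, _).2]/= !E //;
    [|by apply: cX; perm_count..].
  have dj (s' t' : tm) : (exists l, perm_eq (leaves s' ++ leaves t' ++ l) X) ->
      disj (leaves s') (leaves t').
    case=> l p x xs; have : uniq (leaves s' ++ leaves t' ++ l).
      by rewrite (perm_uniq p).
    rewrite cat_uniq => /and3P[_ /hasPn U _]; apply/negP => xt.
    by have := U x; rewrite /= mem_cat xt xs => /(_ isT).
  have st : disj (leaves s) (leaves t).
    apply: dj; exists (leaves u ++ leaves v).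
    by apply: perm_trans stX; perm_count.
  have su : disj (leaves s) (leaves u).
    apply: dj; exists (leaves t ++ leaves v).
    by apply: perm_trans stX; perm_count.
  have ut : disj (leaves u) (leaves t).
    apply: dj; exists (leaves s ++ leaves v).
    by apply: perm_trans stX; perm_count.
  set K' := ev v 1 K.
  have -> : ev t 1 (ev u 1 (ev s 1 K')) = ev s 1 (ev t 1 (ev u 1 K')).
    apply/funext => r; rewrite (ev_comm _ _ _ _ _ st); congr ev.
    by apply/funext => r'; rewrite (ev_comm _ _ _ _ _ su).
  have -> : ev u 1 (ev s 1 (ev t 1 K')) = ev s 1 (ev t 1 (ev u 1 K')).
    apply/funext => r; rewrite -(ev_comm _ _ _ _ _ su); congr ev.
    by apply/funext => r'; rewrite (ev_comm _ _ _ _ _ ut).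
  by rewrite -!scalerDl /weight /= dot_jacobi scale0r.
- move=> a g h s t; rewrite !(linB fl) (linZ fl) !ext_tr.
  rewrite (pE (Op (a *: g + h) s) t s t) //.
  case: ifP => stX; last by rewrite scaler0 !subr0.
  have [sX tX _] := subX stX.
  have l : linear (fun h => ev s h (ev t 1 K) (fun _ => 1)).
    by apply: (@ev_lin _ _ _ _ _ X) => //; apply: ev_mlin.
  rewrite /wev /weight /= !mul1r l scalerDr !scalerA [a * _]mulrC.
  by rewrite addrAC addrK subrr.
- move=> s t; rewrite (linB fl) !ext_tr (pE (Op 1 s) t s t) //.
  case: ifP => stX; last by rewrite subr0.
  by rewrite /wev /weight /= mul1r subrr.
- move=> g h s t; rewrite (linB fl) !ext_tr.
  rewrite (pE (Op (g * h) s) t s t) //.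
  case: ifP => stX; last by rewrite subr0.
  by rewrite /wev /weight /= !mul1r subrr.
move=> n h sq o f t lo po sP; rewrite (linB fl) (lin_sum fl) ext_tr.
have E p : ext wev (tr X (bind (fun i => Op (p i) (f i)) o, t)) =
    if perm_eq (slots (bind f o, t)) X
    then wev (bind (fun i => Op (p i) (f i)) o, t) else 0.
  by rewrite ext_tr /slots /= !leaves_bind.
rewrite (eq_bigr _ (fun p _ => E p)) (pE (Op h (bind f o)) t (bind f o) t) //.
case: ifP => stX; last by rewrite big1 // subr0.
have [sX tX _] := subX stX.
have Uo : uniq (leaves (bind f o)).
  have : uniq (slots (bind f o, t)) by rewrite (perm_uniq stX).
  by rewrite cat_uniq => /and3P[].
rewrite /wev /weight /= mul1r.
rewrite (@sweedler_ev_fam _ _ _ coc _ _ X _ _ _ _ _ _ _ lo po sP) //; last exact: ev_mlin.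
rewrite scaler_sumr; apply/eqP; rewrite subr_eq0; apply/eqP.
by apply: eq_bigr => p _; rewrite cv_bind_Op.
Qed.

End Functional.

(** * The two-loop functional *)

Lemma flipK : involutive flip.
Proof. by case=> e b; rewrite /flip /= negbK. Qed.

Lemma flip_inj : injective flip. Proof. exact: inv_inj flipK. Qed.

Lemma flip_neq a : (flip a == a) = false.
Proof. by case: a => e []; rewrite /flip /eq_op /= andbF. Qed.

Lemma neq_flip a : (a == flip a) = false.
Proof. by rewrite eq_sym flip_neq. Qed.

Definition ends (x y : hedge) : seq hedge := [:: x; flip x; y; flip y].

Lemma ends_neq x y : x.1 != y.1 ->
  [/\ (x == y) = false, (x == flip y) = false, (flip x == y) = false &
      (flip x == flip y) = false].
Proof.
have N (a b : hedge) : a.1 != b.1 -> (a == b) = false.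
  by apply: contraNF => /eqP->.
by move=> xy; split; apply: N.
Qed.

Lemma ends_uniq x y : x.1 != y.1 -> uniq (ends x y).
Proof.
by case/ends_neq=> xy xfy fxy fxfy; rewrite /= !inE !neq_flip xy xfy fxy fxfy.
Qed.

Section EvTransport.
Variables (k : fieldType) (H : algType k) (hH : hopf H).
Local Notation D := (@copsum k H hH _).
Variables (V : lmodType k).

Lemma ev_relab (L L' : eqType) (s : L -> L') (K : (L -> H) -> V)
    (K' : (L' -> H) -> V) (t : tm H L) h r :
    injective s -> (forall r, K' r = K (r \o s)) ->
  ev hH (bind (fun x => Lf (s x)) t) h K' r = ev hH t h K (r \o s).
Proof.
move=> si; elim: t h K K' r => [x|t1 IH1 t2 IH2|g t IHt] h K K' r KE /=.
- rewrite KE; congr K; apply/funext => y; rewrite /upd /=.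
  by rewrite (inj_eq si).
- by apply: eq_D => x y; apply: IH1 => r'; apply: IH2.
- exact: IHt.
Qed.

Lemma cv_relab (L L' : Type) (s : L -> L') (w : L' -> k * k * k) (t : tm H L) :
  so3_val w (bind (fun x => Lf (s x)) t) = so3_val (w \o s) t.
Proof. by elim: t => [x|t1 IH1 t2 IH2|g t IHt] //=; rewrite IH1 IH2. Qed.

Section Put.
Variables (L : eqType) (a : L) (h : H).
Implicit Types (t : tm H L) (K : (L -> H) -> V).

Definition tput t : tm H L := bind (fun x => if x == a then Op h (Lf x) else Lf x) t.

Lemma leaves_tput t : leaves (tput t) = leaves t.
Proof.
elim: t => [x|t1 IH1 t2 IH2|g t IHt] //=; last by rewrite -IH1 -IH2.
by rewrite /tput /=; case: ifP.
Qed.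

Lemma tput_notin t : a \notin leaves t -> tput t = t.
Proof.
elim: t => [x|t1 IH1 t2 IH2|g t IHt] /=; rewrite ?inE ?mem_cat /tput /=.
- by rewrite eq_sym => /negPf->.
- by rewrite negb_or => /andP[a1 a2]; congr Br; [apply: IH1 | apply: IH2].
- by move=> at'; congr Op; apply: IHt.
Qed.

Lemma cv_tput (w : L -> k * k * k) t : so3_val w (tput t) = so3_val w t.
Proof.
elim: t => [x|t1 IH1 t2 IH2|g t IHt] //=; last by rewrite -IH1 -IH2.
by rewrite /tput /=; case: ifP.
Qed.

Lemma ev_tput t g K r : uniq (leaves t) -> a \in leaves t ->
  ev hH (tput t) g K r = ev hH (Lf a) h (ev hH t g K) r.
Proof.
elim: t g K r => [x|t1 IH1 t2 IH2|g' t IHt] g K r /=.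
- by rewrite inE /tput /= => _ /eqP->; rewrite eqxx /= updK upd_same mulrA.
- rewrite cat_uniq mem_cat => /and3P[U1 /hasPn U12 U2].
  case: (boolP (a \in leaves t1)) => [a1 _|a1 /= a2]; apply: eq_D => x y.
    rewrite -/(tput t1) -/(tput t2) (@tput_notin t2) ?IH1 //.
    by apply/negP => /U12; rewrite /= a1.
  rewrite -/(tput t1) -/(tput t2) (@tput_notin t1) //.
  rewrite -[RHS]/(ev hH (Lf a) h (ev hH t1 x (ev hH t2 y K)) r) ev_commLf //.
  by congr ev; apply/funext => r'; apply: IH2.
- by move=> Ut at'; apply: IHt.
Qed.

Lemma ev_right t g K r :
  ev hH t g (fun r => K (upd r a (r a * h))) r = ev hH t g K (upd r a (r a * h)).
Proof.
elim: t g K r => [x|t1 IH1 t2 IH2|g' t IHt] g K r //=.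
  case: (eqVneq x a) => [->|xa]; first by rewrite !updK !upd_same mulrA.
  by rewrite !upd_other 1?updC // eq_sym.
apply: eq_D => x y; rewrite -IH1; congr ev; apply/funext => r'; exact: IH2.
Qed.

End Put.
End EvTransport.

Section Phi.
Variables (k : fieldType) (H : algType k) (hH : hopf H).
Hypothesis coc : cocommutative hH.
Local Notation S := (antip hH).
Local Notation D := (@copsum k H hH _).
Local Notation tree := (tree H hedge).
Local Notation tm := (tm H hedge).
Variables (V : lmodType k) (M : tensor H H -> V).
Hypotheses (Ml : linear M) (Mi : conj_inv hH M).
Hypothesis Mtau : forall a b, M (tens a b) = M (tens b a).
Hypothesis MSS : forall a b, M (tens a b) = M (tens (S a) (S b)).

(** The labels of two loops with ends x, x' and y, y': sliding the label at x' along its edge brings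
    it to x as an antipode on the right. *)
Definition kappa (x x' y y' : hedge) (r : hedge -> H) : V :=
  M (tens (r x * S (r x')) (r y * S (r y'))).

(* With these vectors the only pairing of the four leaves with a nonzero value
   is x with y', x' with y. *)
Definition leaf_vec (x x' y y' z : hedge) : k * k * k :=
  if (z == x) || (z == y') then (1, 0, 0)
  else if (z == x') || (z == y) then (0, 1, 0) else 0.

Definition Phi x x' y y' : tree -> V := wev hH (kappa x x' y y') (leaf_vec x x' y y').

(** Exchanging the ends of the second loop exchanges the two terms, so [phi] changes sign when an
    edge is reversed, as the orientation requires. The overall sign gives the standard tree the
    coefficient 1 in [phi_std]. *)
Definition phi x y (t : tree) : V :=
  - Phi x (flip x) y (flip y) t + Phi x (flip x) (flip y) y t.

Lemma uniq4 (x x' y y' : hedge) : uniq [:: x; x'; y; y'] ->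
  ((x == x') = false) * ((x == y) = false) * ((x == y') = false) *
  ((x' == x) = false) * ((x' == y) = false) * ((x' == y') = false) *
  ((y == x) = false) * ((y == x') = false) * ((y == y') = false) *
  ((y' == x) = false) * ((y' == x') = false) * ((y' == y) = false).
Proof.
rewrite /= !inE !negb_or -!andbA.
case/and3P=> /negPf a /negPf b /and3P[/negPf c /negPf d /and3P[/negPf e /negPf f _]].
have sym (u v : hedge) : (u == v) = false -> (v == u) = false.
  by rewrite eq_sym.
by rewrite a b c d e f (sym _ _ a) (sym _ _ b) (sym _ _ c) (sym _ _ d)
  (sym _ _ e) (sym _ _ f).
Qed.

Section Kap.
Variables (x x' y y' : hedge).
Hypothesis U : uniq [:: x; x'; y; y'].

Lemma kap_mlin : mlin [:: x; x'; y; y'] (kappa x x' y y').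
Proof.
move=> z r; rewrite !inE => /or4P[] /eqP->; rewrite /kappa /upd ?eqxx ?(uniq4 U);
  by apply: (linear_comp Ml); lin.
Qed.

(** The diagonal action turns the loop labels a, b into h_(1) a S(h_(2)) and h_(3) b S(h_(4)), which
    is the conjugation action. *)
Lemma kap_inv : invK hH [:: x; x'; y; y'] (kappa x x' y y').
Proof.
move=> h r; set K := kappa x x' y y'.
have Km := kap_mlin.
transitivity (D h (fun u1 v1 => D v1 (fun u2 v2 => D v2 (fun u3 v3 =>
    M (tens (u1 * (r x * S (r x')) * S u2) (u3 * (r y * S (r y')) * S v3)))))).
  apply: eq_D => u1 v1; apply: eq_D => u2 v2; apply: eq_D => u3 v3.
  rewrite -[LHS]/(ev_cop hH (@Lf H _) [:: y'] v3 K _).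
  rewrite (@ev_cop_1 _ _ _ _ _ _ _ [:: x; x'; y; y']) //; last first.
    by move=> z; rewrite !inE => ->; rewrite !orbT.
  rewrite /= /K /kappa /upd ?eqxx ?(uniq4 U) ?eqxx.
  by rewrite !S_mul !mulrA.
have := itD_conjG hH h (r x * S (r x')) (r y * S (r y')).
move/(congr1 M); rewrite Mi => <- /=; rewrite (D_hom _ _ Ml).
apply: eq_D => u1 v1; rewrite (D_hom _ _ Ml); apply: eq_D => u2 v2.
by rewrite (D_hom _ _ Ml).
Qed.

End Kap.

Lemma mlin_perm (A B : seq hedge) (K : (hedge -> H) -> V) :
  perm_eq A B -> mlin A K -> mlin B K.
Proof. by move=> AB Km x r; rewrite -(perm_mem AB); apply: Km. Qed.

Lemma invK_perm (A B : seq hedge) (K : (hedge -> H) -> V) :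
  perm_eq A B -> uniq A -> mlin A K -> invK hH A K -> invK hH B K.
Proof.
move=> AB UA Km Ki h r; rewrite -Ki; symmetry.
by apply: (@ev_cop_perm _ _ _ coc _ _ _ _ A) => //; rewrite fam_leaves_Lf.
Qed.

Lemma Phi_hlie X x x' y y' : perm_eq [:: x; x'; y; y'] X -> uniq X ->
  hlie_fun hH X (Phi x x' y y').
Proof.
move=> pX UX; have U : uniq [:: x; x'; y; y'] by rewrite (perm_uniq pX).
apply: wev_hlie => //; first exact: mlin_perm pX (kap_mlin U).
exact: (invK_perm pX U (kap_mlin U) (kap_inv U)).
Qed.

Lemma hlie_fun_lin (X : seq hedge) (f g : tree -> V) a :
  hlie_fun hH X f -> hlie_fun hH X g -> hlie_fun hH X (fun t => a *: f t + g t).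
Proof.
move=> Xf Xg r rX; have [s rE] := freeg_ind_lin r.
have E (f' : tree -> V) :
    ext f' r = \sum_(c <- s) c.1 *: f' (val c.2).
  have fl := @ext_linear k H _ V X f'.
  rewrite rE (lin_sum fl); apply: eq_bigr => c _.
  by rewrite (linZ fl) /ext fextU.
move: (Xf r rX) (Xg r rX); rewrite !E => f0 g0.
transitivity (a *: (\sum_(c <- s) c.1 *: f (val c.2)) +
    \sum_(c <- s) c.1 *: g (val c.2)); last by rewrite f0 g0 scaler0 addr0.
rewrite scaler_sumr -big_split; apply: eq_bigr => c _ /=.
by rewrite scalerDr !scalerA [a * _]mulrC.
Qed.

Lemma phi_hlie X x y : x.1 != y.1 -> perm_eq (ends x y) X ->
  hlie_fun hH X (phi x y).
Proof.
move=> xy pX; have UX : uniq X by rewrite -(perm_uniq pX) ends_uniq.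
have -> : phi x y = fun t => (-1) *: Phi x (flip x) y (flip y) t +
  Phi x (flip x) (flip y) y t.
  by apply/funext => t; rewrite scaleN1r.
apply: hlie_fun_lin; apply: Phi_hlie => //.
by apply: perm_trans pX; apply/permP => p /=; lia.
Qed.

Lemma phi_flipr x y t : phi x (flip y) t = - phi x y t.
Proof. by rewrite /phi flipK opprD opprK addrC. Qed.

Definition refl (v : k * k * k) : k * k * k := (v.1.2, v.1.1, v.2).

(** Exchanging two coordinates has determinant -1, so each bracket contributes a sign; a tree with m
    leaves has m - 1 brackets, and m + 1 has the same parity. *)
Lemma cv_refl (L : Type) (w : L -> k * k * k) (t : Defs.tm H L) :
  let e : k := (-1) ^+ (size (leaves t)).+1 in
  let v := so3_val w t in
  so3_val (fun z => refl (w z)) t = (e * v.1.2, e * v.1.1, e * v.2).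
Proof.
elim: t => [x|t1 IH1 t2 IH2|g t IHt] //=.
  by rewrite expr2 mulrNN mulr1 !mul1r.
rewrite IH1 IH2 size_cat /cross /= !exprS exprD.
by congr (_, _, _); ring.
Qed.

(* The reflection changes the sign of brackets, and a tree with four leaves has
   two brackets. *)
Lemma weight_refl (L : Type) (w : L -> k * k * k) (t : Defs.tree H L) :
  size (slots t) = 4%N -> weight (fun z => refl (w z)) t = weight w t.
Proof.
rewrite /slots size_cat /weight !cv_refl /dot /= => E.
have : (-1 : k) ^+ (size (leaves t.1)).+1 * (-1) ^+ (size (leaves t.2)).+1 = 1.
  by rewrite -exprD addSnnS !addnS E -signr_odd.
set a := (-1) ^+ _; set b := (-1) ^+ _ => ab.
rewrite -[RHS]mul1r -ab; ring.
Qed.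

(** In the first term of [phi] the exchange of the loops reflects the leaf vectors, harmless for
    four leaves, and uses tau on the labels. In the second it keeps the vectors but also reverses
    both loops, so the labels need S (x) S as well. *)
Lemma phi_swap x y t : x.1 != y.1 -> size (slots t) = 4%N ->
  phi x y t = phi y x t.
Proof.
move=> xy t4; have U := ends_uniq xy.
rewrite /phi; congr (- _ + _); rewrite /Phi /wev.
  have -> : leaf_vec y (flip y) x (flip x) = fun z => refl (leaf_vec x (flip x) y (flip y) z).
    apply/funext => z; rewrite /leaf_vec.
    case: (eqVneq z x) => [->|zx]; first by rewrite ?(uniq4 U) /refl.
    case: (eqVneq z (flip x)) => [->|zx']; first by rewrite ?(uniq4 U) /refl.
    case: (eqVneq z y) => [->|zy]; first by rewrite ?(uniq4 U) /refl.
    by case: (eqVneq z (flip y)).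
  rewrite weight_refl //; congr (_ *: ev _ _ _ (ev _ _ _ _) _).
  by apply/funext => r; rewrite /kappa Mtau.
have -> : leaf_vec y (flip y) (flip x) x = leaf_vec x (flip x) (flip y) y.
  by apply/funext => z; rewrite /leaf_vec orbC [(z == flip y) || _]orbC.
congr (_ *: ev _ _ _ (ev _ _ _ _) _); apply/funext => r.
by rewrite /kappa MSS Mtau !S_mul !(S_invol coc).
Qed.

Lemma phi_flipl x y t : x.1 != y.1 -> size (slots t) = 4%N ->
  phi (flip x) y t = - phi x y t.
Proof.
by move=> xy t4; rewrite phi_swap // phi_flipr phi_swap // eq_sym.
Qed.

Lemma phi_relab s x y t : injective s -> (forall a, s (flip a) = flip (s a)) ->
  phi (s x) (s y) (relab s t) = phi x y t.
Proof.
move=> si sf.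
have E x' y' z' : Phi (s x) (s x') (s y') (s z') (relab s t) = Phi x x' y' z' t.
  rewrite /Phi /wev /weight /= !cv_relab.
  have -> : leaf_vec (s x) (s x') (s y') (s z') \o s = leaf_vec x x' y' z'.
    by apply/funext => z; rewrite /leaf_vec /= !(inj_eq si).
  congr (_ *: _); apply: (etrans (@ev_relab _ _ hH _ _ _ s
    (ev hH t.2 1 (kappa x x' y' z')) _ t.1 1 (fun _ => 1) si _)) => // r.
  exact: (@ev_relab _ _ hH _ _ _ s (kappa x x' y' z')).
by rewrite /phi -!sf !E.
Qed.

Definition treeput (h : H) a (t : tree) : tree :=
  tbind (fun x => if x == a then Op h (Lf x) else Lf x) t.

(** Elements coming from above multiply on the left, so an input label at a leaf ends up as the
    rightmost factor of the label of that leaf. *)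
Lemma wev_put (K : (hedge -> H) -> V) w h a t : uniq (slots t) -> a \in slots t ->
  wev hH K w (treeput h a t) =
  weight w t *: ev hH t.1 1 (ev hH t.2 1 (fun r => K (upd r a (r a * h)))) (fun _ => 1).
Proof.
case: t => t1 t2; rewrite /slots cat_uniq mem_cat /= => /and3P[U1 /hasPn U12 U2] at'.
rewrite /wev /weight /= !cv_tput; congr (_ *: _).
have -> : ev hH t2 1 (fun r => K (upd r a (r a * h))) =
    fun r => ev hH t2 1 K (upd r a (r a * h)).
  by apply/funext => r; rewrite ev_right.
rewrite ev_right mul1r -[h in RHS]mulr1.
case: (boolP (a \in leaves t1)) => [a1|a1].
  have N2 : tput a h t2 = t2 by apply: tput_notin; apply/negP => /U12; rewrite /= a1.
  by rewrite -/(tput a h t1) -/(tput a h t2) N2 ev_tput.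
move: at'; rewrite (negPf a1) /= => a2.
have N1 : tput a h t1 = t1 by apply: tput_notin.
rewrite -/(tput a h t1) -/(tput a h t2) N1.
rewrite -[RHS]/(ev hH (Lf a) h (ev hH t1 1 (ev hH t2 1 K)) (fun _ => 1)) ev_commLf //.
by congr ev; apply/funext => r; rewrite ev_tput.
Qed.

Lemma kap_right x x' y y' h r : uniq [:: x; x'; y; y'] ->
  [/\ kappa x x' y y' (upd r x (r x * h)) = kappa x x' y y' (upd r x' (r x' * S h)),
      kappa x x' y y' (upd r x' (r x' * h)) = kappa x x' y y' (upd r x (r x * S h)),
      kappa x x' y y' (upd r y (r y * h)) = kappa x x' y y' (upd r y' (r y' * S h)) &
      kappa x x' y y' (upd r y' (r y' * h)) = kappa x x' y y' (upd r y (r y * S h))].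
Proof.
move=> U; rewrite /kappa /upd !eqxx !(uniq4 U) !S_mul !(S_invol coc).
by rewrite !mulrA.
Qed.

(** The slide relation. Multiplying one end of a loop on the right by h and multiplying the other
    end by S(h) have the same effect on r x S(r x'), because S is an anti-homomorphism and an
    involution. *)
Lemma phi_put x y h a t : x.1 != y.1 -> perm_eq (slots t) (ends x y) ->
  phi x y (treeput h a t) = phi x y (treeput (S h) (flip a) t).
Proof.
move=> xy tX; have U := ends_uniq xy.
have Ut : uniq (slots t) by rewrite (perm_uniq tX).
have U' : uniq [:: x; flip x; flip y; y].
  by rewrite -(perm_uniq (s1 := ends x y)) //; apply/permP => p /=; lia.
have aE : (flip a \in slots t) = (a \in slots t).
  rewrite !(perm_mem tX) !inE -!(can_eq flipK a) !flipK !(can2_eq flipK flipK).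
  by case: eqP; case: eqP; case: eqP; case: eqP.
case: (boolP (a \in slots t)) => [at'|at']; last first.
  have N b c : b \notin slots t -> treeput c b t = t.
    case: (t) => t1 t2; rewrite /slots mem_cat negb_or /= => /andP[b1 b2].
    by rewrite /treeput /tbind /= -/(tput b c t1) -/(tput b c t2) !tput_notin.
  by rewrite !N ?aE.
have at2 : flip a \in slots t by rewrite aE.
rewrite /phi /Phi; congr (- _ + _); rewrite !wev_put //;
  congr (_ *: _); congr (ev _ _ _ (ev _ _ _ _) _);
  apply/funext => r; move: at'; rewrite (perm_mem tX) !inE.
  have [k1 k2 k3 k4] := kap_right h r U.
  by case/or4P=> /eqP ->; rewrite ?flipK.
have [k1 k2 k3 k4] := kap_right h r U'.
by case/or4P=> /eqP ->; rewrite ?flipK.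
Qed.

(** [P] records what the evaluation of [t] leaves untouched, typically the labels at slots outside
    [t]. *)
Lemma ev_vanish (P : (hedge -> H) -> Prop) (K : (hedge -> H) -> V) t h r :
    (forall r, P r -> K r = 0) ->
    (forall r x g, x \in leaves t -> P r -> P (upd r x g)) ->
  P r -> ev hH t h K r = 0.
Proof.
elim: t h K r => [x|t1 IH1 t2 IH2|g t IHt] h K r /= KP PP Pr.
- by apply/KP/PP; rewrite ?mem_head.
- apply: big1 => p _; apply: IH1 => // [r' Pr'|r' x g xt].
    by apply: IH2 => // r1 x g xt; apply: PP; rewrite mem_cat xt orbT.
  by apply: PP; rewrite mem_cat xt.
- exact: IHt.
Qed.

(** The weight need not vanish here, but the loop at [x] carries the trivial label throughout, so
    only values of [M] at 1 (x) b occur. *)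
Lemma phi_loop x y (W : tm) : (forall b, M (tens 1 b) = 0) ->
    x.1 != y.1 -> perm_eq (leaves W) [:: y; flip y] ->
  phi x y (Br (Lf x) (Lf (flip x)), W) = 0.
Proof.
move=> M1 xy WX; have U := ends_uniq xy.
have tX : perm_eq (slots (Br (Lf x) (Lf (flip x)), W)) (ends x y).
  by rewrite /slots /ends /= !perm_cons.
have P0 z z' : perm_eq [:: y; flip y] [:: z; z'] ->
    Phi x (flip x) z z' (Br (Lf x) (Lf (flip x)), W) = 0.
  move=> zz; have Uz : uniq [:: x; flip x; z; z'].
    rewrite -(perm_uniq (s1 := ends x y)) // /ends !perm_cons //.
  rewrite /Phi /wev; rewrite [(_, _).1]/= [(_, _).2]/=.
  rewrite (@ev_Br1 _ _ _ _ _ [:: x; flip x; z; z']); first last.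
  - apply: ev_mlin; last exact: kap_mlin.
    by move=> u; rewrite (perm_mem WX) (perm_mem zz) !inE => ->; rewrite !orbT.
  - by move=> u; rewrite !inE => ->; rewrite orbT.
  - by move=> u; rewrite !inE => ->.
  rewrite /= (@ev_vanish (fun r => r x = 1 /\ r (flip x) = 1)) ?scaler0 //.
  - by move=> r [r1 r2]; rewrite /kappa r1 r2 S_1 mulr1.
  - move=> r u g; rewrite (perm_mem WX) !inE => /orP[] /eqP->;
      by rewrite /upd !(uniq4 U).
  by rewrite /upd !eqxx neq_flip flip_neq !mulr1.
rewrite /phi !P0 ?oppr0 ?addr0 //.
by apply/permP => p /=; lia.
Qed.

Lemma phi_std x y a b c d : x.1 != y.1 ->
  phi x y (Br (Op a (Lf x)) (Op b (Lf y)),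
           Br (Op c (Lf (flip x))) (Op d (Lf (flip y)))) =
  M (tens (a * S c) (b * S d)).
Proof.
move=> xy; have U := ends_uniq xy; have Km := kap_mlin U.
rewrite /phi /Phi /wev.
(* In the second term of [phi] the leaves x and y carry the same vector, so their bracket
   vanishes. *)
have -> : weight (leaf_vec x (flip x) (flip y) y) (Br (Op a (Lf x)) (Op b (Lf y)),
           Br (Op c (Lf (flip x))) (Op d (Lf (flip y)))) = 0.
  by rewrite /weight /= /leaf_vec !eqxx ?orbT ?(uniq4 U) /= /dot /cross /=; ring.
(* In the first term the two brackets are opposite unit vectors. *)
have -> : weight (leaf_vec x (flip x) y (flip y)) (Br (Op a (Lf x)) (Op b (Lf y)),
           Br (Op c (Lf (flip x))) (Op d (Lf (flip y)))) = -1.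
  by rewrite /weight /= /leaf_vec !eqxx ?orbT ?(uniq4 U) /= /dot /cross /=; ring.
rewrite scale0r addr0 scaleN1r opprK [(_, _).1]/= [(_, _).2]/=.
have -> : ev hH (Br (Op c (Lf (flip x))) (Op d (Lf (flip y)))) 1
    (kappa x (flip x) y (flip y)) =
  ev hH (Op c (Lf (flip x))) 1 (ev hH (Op d (Lf (flip y))) 1
    (kappa x (flip x) y (flip y))).
  apply/funext => r; apply: (@ev_Br1 _ _ _ _ _ (ends x y)) => // u;
    by rewrite !inE => ->; rewrite ?orbT.
rewrite (@ev_Br1 _ _ _ _ _ (ends x y)); first last.
- by do 2 (apply: ev_mlin; first by move=> u; rewrite !inE => ->; rewrite ?orbT).
- by move=> u; rewrite !inE => ->; rewrite ?orbT.
- by move=> u; rewrite !inE => ->; rewrite ?orbT.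
by rewrite /= /kappa /upd !eqxx ?(uniq4 U) !mul1r !mulr1.
Qed.

End Phi.

(** * Normal forms of trees *)

Ltac permX pX := apply: perm_trans pX; perm_count.

Section TreeRules.
Variables (k : fieldType) (H : algType k) (hH : hopf H) (L : choiceType).
Local Notation S := (antip hH).
Local Notation D := (@copsum k H hH _).
Local Notation tm := (tm H L).
Local Notation tree := (tree H L).
Variables (V : lmodType k) (X : seq L) (f : tree -> V).
Hypothesis fX : tree_rules hH X f.
Implicit Types (s t u : tm).

Lemma rule_left s t u : perm_eq (slots (Br s t, u)) X ->
  f (Br s t, u) = f (s, Br t u).
Proof. exact: rule_rot fX _ _ _. Qed.

Lemma rule_right s t u : perm_eq (slots (Br t s, u)) X ->
  f (Br t s, u) = - f (s, Br t u).
Proof.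
by move=> tsX; rewrite (rule_as fX) // (rule_rot fX) //; permX tsX.
Qed.

Lemma rule_asr s t u : perm_eq (slots (u, Br s t)) X ->
  f (u, Br s t) = - f (u, Br t s).
Proof.
move=> uX; rewrite (rule_sym fX) // (rule_as fX); last by permX uX.
by rewrite (rule_sym fX) //; permX uX.
Qed.

Lemma rule_cyc s t u : perm_eq (slots (s, Br t u)) X ->
  f (s, Br t u) = f (u, Br s t).
Proof.
move=> sX; rewrite -(rule_rot fX); last by permX sX.
by rewrite (rule_sym fX) //; permX sX.
Qed.

Lemma rule_rotr s t u : perm_eq (slots (s, Br t u)) X ->
  f (s, Br t u) = f (Br s t, u).
Proof. by move=> sX; rewrite (rule_rot fX) //; permX sX. Qed.

Section Transport.
Variables (s s' t u : tm).
Hypotheses (ss : perm_eq (leaves s) (leaves s'))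
  (E : forall u', perm_eq (slots (s, u')) X -> f (s, u') = f (s', u')).

(** An identity known at the root edge holds below a bracket, because the tree can be rotated until
    the edge above [s] is the root edge. *)
Lemma rule_congl : perm_eq (slots (Br s t, u)) X ->
  f (Br s t, u) = f (Br s' t, u).
Proof.
move=> sX; have s'X : perm_eq (slots (Br s' t, u)) X.
  by apply: perm_trans sX; rewrite /slots /= !perm_cat2r perm_sym.
by rewrite !rule_left // E //; permX sX.
Qed.

Lemma rule_congr : perm_eq (slots (Br t s, u)) X ->
  f (Br t s, u) = f (Br t s', u).
Proof.
move=> sX; have s'X : perm_eq (slots (Br t s', u)) X.
  by apply: perm_trans sX; rewrite /slots /= perm_cat2r perm_cat2l perm_sym.
by rewrite !rule_right // E //; permX sX.
Qed.

End Transport.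

Lemma rule_unitl s t u : perm_eq (slots (Br s t, u)) X ->
  f (Br (Op 1 s) t, u) = f (Br s t, u).
Proof. by move=> sX; apply: rule_congl => // u' uX; apply: rule_unit fX _ _ _. Qed.

Lemma rule_unitr s t u : perm_eq (slots (Br t s, u)) X ->
  f (Br t (Op 1 s), u) = f (Br t s, u).
Proof. by move=> sX; apply: rule_congr => // u' uX; apply: rule_unit fX _ _ _. Qed.

Lemma rule_unitrl s t u : perm_eq (slots (u, Br s t)) X ->
  f (u, Br (Op 1 s) t) = f (u, Br s t).
Proof.
move=> uX; have sX : perm_eq (slots (Br s t, u)) X by permX uX.
by rewrite [LHS](rule_sym fX) // [RHS](rule_sym fX) // rule_unitl.
Qed.

Lemma rule_unitrr s t u : perm_eq (slots (u, Br t s)) X ->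
  f (u, Br t (Op 1 s)) = f (u, Br t s).
Proof.
move=> uX; have sX : perm_eq (slots (Br t s, u)) X by permX uX.
by rewrite [LHS](rule_sym fX) // [RHS](rule_sym fX) // rule_unitr.
Qed.

Lemma rule_mull g h s t u : perm_eq (slots (Br s t, u)) X ->
  f (Br (Op (g * h) s) t, u) = f (Br (Op g (Op h s)) t, u).
Proof. by move=> sX; apply: rule_congl => // u' uX; apply: rule_mul fX _ _ _ _ _. Qed.

Lemma rule_mulr g h s t u : perm_eq (slots (Br t s, u)) X ->
  f (Br t (Op (g * h) s), u) = f (Br t (Op g (Op h s)), u).
Proof. by move=> sX; apply: rule_congr => // u' uX; apply: rule_mul fX _ _ _ _ _. Qed.

Lemma rule_linl s t u : perm_eq (slots (Br s t, u)) X ->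
  linear (fun h => f (Br (Op h s) t, u)).
Proof.
move=> sX; rewrite (_ : (fun h => _) = fun h => f (Op h s, Br t u)).
  by apply: rule_lin fX _ _ _; permX sX.
by apply/funext => h; apply: rule_left.
Qed.

Lemma rule_linr s t u : perm_eq (slots (Br t s, u)) X ->
  linear (fun h => f (Br t (Op h s), u)).
Proof.
move=> sX; rewrite (_ : (fun h => _) = fun h => - f (Op h s, Br t u)).
  by apply: linear_opp; apply: rule_lin fX _ _ _; permX sX.
by apply/funext => h; apply: rule_right.
Qed.

Section NormalForms.
Variable U : V -> Prop.
Hypotheses (U0 : U 0) (UZD : forall a (u v : V), U u -> U v -> U (a *: u + v)).

Lemma U_opp v : U v -> U (- v).
Proof. by move=> Uv; rewrite -scaleN1r -[_ *: _]addr0; apply: UZD. Qed.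

Lemma U_add (u v : V) : U u -> U v -> U (u + v).
Proof. by move=> Uu Uv; rewrite -[u]scale1r; apply: UZD. Qed.

Lemma U_D h F : (forall x y, U (F x y)) -> U (D h F).
Proof.
move=> UF; rewrite /copsum; elim: (sw hH h) => [|p l IHl].
  by rewrite big_nil.
by rewrite big_cons; apply: U_add.
Qed.

(** Exactly one label at each leaf and none elsewhere. *)
Fixpoint normal t : bool :=
  match t with
  | Op _ (Lf _) => true
  | Br t1 t2 => normal t1 && normal t2
  | _ => false
  end.

(** The induction is over all [u], since rotating the tree moves the sibling of the treated subtree,
    and everything above it, into [u]. *)
Lemma nf_push h s u : perm_eq (slots (s, u)) X ->
    (forall s', normal s' -> perm_eq (leaves s') (leaves s) -> U (f (s', u))) ->
  U (f (Op h s, u)).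
Proof.
elim: s h u => [x|s IHs t IHt|g s IHs] h u sX Un.
- by apply: Un.
- rewrite (rule_br fX) //; apply: U_D => x y; rewrite rule_left //.
  apply: IHs => [|s' ns' ss']; first by permX sX.
  have s'X : perm_eq (slots (Br s' (Op y t), u)) X.
    by apply: perm_trans sX; rewrite /slots /= !perm_cat2r.
  rewrite -rule_left // rule_right //; apply/U_opp/IHt => [|t' nt' tt'].
    by permX s'X.
  have t'X : perm_eq (slots (Br s' t', u)) X.
    by apply: perm_trans s'X; rewrite /slots /= perm_cat2r perm_cat2l.
  rewrite -[f _]opprK -rule_right //; apply/U_opp/Un; first by rewrite /= ns'.
  exact: perm_cat.
- by rewrite -(rule_mul fX) //; apply: IHs.
Qed.

Lemma nf_span :
    (forall s t, normal s -> normal t -> perm_eq (slots (s, t)) X -> U (f (s, t))) ->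
  forall t : tree, perm_eq (slots t) X -> U (f t).
Proof.
move=> Un [s t] stX; rewrite -(rule_unit fX) //; apply: nf_push => // s' ns' ss'.
have s'X : perm_eq (slots (s', t)) X.
  by apply: perm_trans stX; rewrite /slots perm_cat2r.
rewrite (rule_sym fX) // -(rule_unit fX); last by permX s'X.
apply: nf_push => [|t' nt' tt']; first by permX s'X.
have t'X : perm_eq (slots (s', t')) X.
  by apply: perm_trans s'X; rewrite /slots perm_cat2l.
by rewrite (rule_sym fX); [apply: Un | permX t'X].
Qed.

Lemma leaves_gt0 t : (0 < size (leaves t))%N.
Proof.
by elim: t => [x|s IHs t IHt|g t] //=; rewrite size_cat ltn_addr.
Qed.

Lemma nf_size1 t : normal t -> size (leaves t) = 1%N ->
  exists p x, t = Op p (Lf x).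
Proof.
case: t => [x|s t|g []] //=; last by move=> x _ _; exists g, x.
move=> _; rewrite size_cat; have := leaves_gt0 s; have := leaves_gt0 t; lia.
Qed.

Lemma nf_size2 t : normal t -> size (leaves t) = 2%N ->
  exists p x q y, t = Br (Op p (Lf x)) (Op q (Lf y)).
Proof.
case: t => [x|s t|g []] //= /andP[ns nt]; rewrite size_cat => E.
have s0 := leaves_gt0 s; have t0 := leaves_gt0 t.
have [p [x ->]] : exists p x, s = Op p (Lf x) by apply: nf_size1 => //; lia.
have [q [y ->]] : exists p x, t = Op p (Lf x) by apply: nf_size1 => //; lia.
by exists p, x, q, y.
Qed.

(** Normal trees with three slots are tripods with a label on each leg. Cyclic symmetry and
    antisymmetry put the legs in the prescribed order, and the label of the first leg is moved to
    the other two. *)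
Lemma nf_span3 x1 x2 x3 : uniq X -> perm_eq [:: x1; x2; x3] X ->
    (forall q r, U (f (Lf x1, Br (Op q (Lf x2)) (Op r (Lf x3))))) ->
  forall t : tree, perm_eq (slots t) X -> U (f t).
Proof.
move=> UX pX U1.
have X3 : size X = 3%N by rewrite -(perm_size pX).
(* The label [p] is turned around its edge by the antipode and distributed over the bracket. *)
have U2 p q r : U (f (Op p (Lf x1), Br (Op q (Lf x2)) (Op r (Lf x3)))).
  rewrite (rule_inv fX) // (rule_sym fX) // (rule_br fX); last by permX pX.
  apply: U_D => a b; rewrite -rule_mull; last by permX pX.
  rewrite -rule_mulr; last by permX pX.
  by rewrite (rule_sym fX); [apply: U1 | permX pX].
have U3 p q r y z : perm_eq [:: y; z] [:: x2; x3] ->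
    U (f (Op p (Lf x1), Br (Op q (Lf y)) (Op r (Lf z)))).
  move=> yz; have : y \in [:: x2; x3] by rewrite -(perm_mem yz) mem_head.
  rewrite !inE => /orP[] /eqP yE; move: yz; rewrite yE.
    by rewrite perm_cons => /(@perm_small_eq _ [:: _] [:: _] isT)[->].
  move=> yz; have {}yz : perm_eq [:: x3; z] [:: x3; x2].
    by apply: perm_trans yz _; apply/permP => P /=; lia.
  move: yz; rewrite perm_cons => /(@perm_small_eq _ [:: _] [:: _] isT)[->].
  by rewrite rule_asr; [apply: U_opp | permX pX].
apply: nf_span.
have U4 p q r x y z : perm_eq [:: x; y; z] X ->
    U (f (Op p (Lf x), Br (Op q (Lf y)) (Op r (Lf z)))).
  move=> xyzX; have : x1 \in [:: x; y; z].
    by rewrite (perm_mem xyzX) -(perm_mem pX) mem_head.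
  have xp : perm_eq [:: x; y; z] [:: x1; x2; x3].
    by apply: perm_trans xyzX _; rewrite perm_sym.
  rewrite !inE => /or3P[] /eqP E; move: xp xyzX; rewrite -E.
  - by rewrite perm_cons => /U3.
  - move=> xp xyzX; rewrite rule_cyc; last by permX xyzX.
    rewrite rule_cyc; last by permX xyzX.
    apply: U3; rewrite -(perm_cons x1).
    by apply: perm_trans xp; apply/permP => P /=; lia.
  - move=> xp xyzX; rewrite rule_cyc; last by permX xyzX.
    apply: U3; rewrite -(perm_cons x1).
    by apply: perm_trans xp; apply/permP => P /=; lia.
move=> s t ns nt stX; have : size (slots (s, t)) = 3%N by rewrite (perm_size stX).
rewrite /slots size_cat /= => E.
have s0 := leaves_gt0 s; have t0 := leaves_gt0 t.
have [s1|s1] : size (leaves s) = 1%N \/ size (leaves s) = 2%N by lia.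
  have [p [x sE]] := nf_size1 ns s1.
  have t2 : size (leaves t) = 2%N by lia.
  have [q [y [r [z tE]]]] := nf_size2 nt t2.
  by rewrite sE tE; apply: U4; move: stX; rewrite sE tE.
have t1 : size (leaves t) = 1%N by lia.
have [p [x tE]] := nf_size1 nt t1.
have [q [y [r [z sE]]]] := nf_size2 ns s1.
rewrite (rule_sym fX) // sE tE; apply: U4; move: stX; rewrite sE tE => stX.
by permX stX.
Qed.

End NormalForms.
End TreeRules.

(** * Composition of trees as the pairing of two rerooted trees *)

Section Gluing.
Variables (k : fieldType) (H : algType k) (hH : hopf H) (L : choiceType).
Local Notation S := (antip hH).
Local Notation D := (@copsum k H hH _).
Local Notation tm := (tm H L).
Local Notation tree := (tree H L).
Implicit Types (s t u : tm).

Definition plug (a : L) (T : tm) (t : tm) : tm :=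
  bind (fun x => if x == a then T else Lf x) t.

Lemma plug_notin a T t : a \notin leaves t -> plug a T t = t.
Proof.
elim: t => [x|t1 IH1 t2 IH2|g t IHt] /=; rewrite ?inE ?mem_cat /plug /=.
- by rewrite eq_sym => /negPf->.
- by rewrite negb_or => /andP[a1 a2]; congr Br; [apply: IH1 | apply: IH2].
- by move=> at'; congr Op; apply: IHt.
Qed.

Lemma leaves_plug a T t : uniq (leaves t) -> a \in leaves t ->
  perm_eq (a :: leaves (plug a T t)) (leaves t ++ leaves T).
Proof.
elim: t => [x|t1 IH1 t2 IH2|g t IHt] /=.
- by rewrite inE /plug /= => _ /eqP->; rewrite eqxx perm_refl.
- rewrite cat_uniq mem_cat => /and3P[U1 /hasPn U12 U2].
  rewrite -/(plug a T t1) -/(plug a T t2).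
  case: (boolP (a \in leaves t1)) => [a1 _|a1 /= a2].
    rewrite (@plug_notin _ _ t2); last by apply/negP => /U12; rewrite /= a1.
    rewrite -cat_cons; apply: (perm_trans (y := (leaves t1 ++ leaves T) ++ leaves t2)).
      by rewrite perm_cat2r IH1.
    by perm_count.
  rewrite (@plug_notin _ _ t1) //.
  apply: (perm_trans (y := leaves t1 ++ (a :: leaves (plug a T t2)))).
    by apply/permP => p; rewrite /= !count_cat /=; lia.
  apply: (perm_trans (y := leaves t1 ++ (leaves t2 ++ leaves T))).
    by rewrite perm_cat2l IH2.
  by perm_count.
- exact: IHt.
Qed.

(** The unrooted tree seen from its slot [a]; [glue] plugs this rooted tree into a slot of the other
    tree. *)
Definition root_at (a : L) (t : tree) : tm :=
  if a \in leaves t.1 then reroot hH a t.1 t.2 else reroot hH a t.2 t.1.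

Lemma glueE a b (s : tree) (t : tree) : glue hH a b s t = tbind
  (fun x => if x == a then root_at b t else Lf x) s.
Proof. by []. Qed.

Lemma leaves_reroot a t u : a \in leaves t ->
  perm_eq (a :: leaves (reroot hH a t u)) (leaves t ++ leaves u).
Proof.
elim: t u => [x|t1 IH1 t2 IH2|g t IHt] u /=.
- by rewrite inE => /eqP->.
- rewrite mem_cat; case: (boolP (a \in leaves t1)) => [a1 _|a1 /= a2].
    by apply: perm_trans (IH1 _ a1) _; perm_count.
  by apply: perm_trans (IH2 _ a2) _; perm_count.
- exact: IHt.
Qed.

Lemma leaves_root_at a (t : tree) : a \in slots t ->
  perm_eq (a :: leaves (root_at a t)) (slots t).
Proof.
rewrite /slots mem_cat /root_at; case: ifP => [a1 _|_ /= a2].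
  exact: leaves_reroot.
by apply: perm_trans (leaves_reroot _ a2) _; rewrite perm_catC.
Qed.

Lemma slots_plug a T (t : tree) : uniq (slots t) -> a \in slots t ->
  perm_eq (a :: slots (plug a T t.1, plug a T t.2)) (slots t ++ leaves T).
Proof.
case: t => t1 t2 Ut at'.
by have := leaves_plug T (t := Br t1 t2) Ut at'.
Qed.

Section Functions.
Variables (V : lmodType k) (X : seq L) (f : tree -> V).
Hypothesis fX : tree_rules hH X f.

(** [reroot] follows the path from the root to [a], rotating each bracket on it and replacing each
    label by its antipode; [f] respects exactly these moves. *)
Lemma plug_reroot a T s u : uniq (leaves s) -> a \in leaves s ->
    perm_eq (slots (plug a T s, u)) X ->
  f (plug a T s, u) = f (reroot hH a s u, T).
Proof.
elim: s u => [x|s1 IH1 s2 IH2|g s IHs] u /=.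
- rewrite inE /plug /= => _ /eqP->; rewrite eqxx => uX.
  by rewrite (rule_sym fX).
- rewrite cat_uniq mem_cat => /and3P[U1 /hasPn U12 U2].
  rewrite -[plug a T (Br s1 s2)]/(Br (plug a T s1) (plug a T s2)).
  case: (boolP (a \in leaves s1)) => [a1 _|a1 /= a2].
    rewrite (@plug_notin _ _ s2); last by apply/negP => /U12; rewrite /= a1.
    move=> sX; rewrite (rule_left fX) ?IH1 //.
    by permX sX.
  rewrite (@plug_notin _ _ s1) // => sX.
  have cE : f (Br s1 (plug a T s2), u) = f (plug a T s2, Br u s1).
    rewrite (rule_sym fX) // (rule_rotr fX); last by permX sX.
    by rewrite (rule_sym fX) //; permX sX.
  by rewrite cE IH2 //; permX sX.
- move=> Us a_s sX; rewrite -[plug a T (Op g s)]/(Op g (plug a T s)) (rule_inv fX) //.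
  exact: IHs.
Qed.

Lemma plug_root_at a T (s : tree) : uniq (slots s) -> a \in slots s ->
    perm_eq (slots (plug a T s.1, plug a T s.2)) X ->
  f (plug a T s.1, plug a T s.2) = f (root_at a s, T).
Proof.
case: s => s1 s2 /=; rewrite /slots /= cat_uniq mem_cat /root_at /=.
case/and3P=> U1 /hasPn U12 U2.
case: (boolP (a \in leaves s1)) => [a1 _|a1 /= a2].
  rewrite (@plug_notin _ _ s2); last by apply/negP => /U12; rewrite /= a1.
  exact: plug_reroot.
rewrite (@plug_notin _ _ s1) // => sX.
rewrite (rule_sym fX) //; apply: plug_reroot => //.
by permX sX.
Qed.

(** This removes the asymmetry of [glue] between its two trees, so an edge may be contracted from
    either end. *)
Lemma glue_root_at a b (s : tree) (t : tree) : uniq (slots s) -> a \in slots s ->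
    perm_eq (slots (glue hH a b s t)) X ->
  f (glue hH a b s t) = f (root_at a s, root_at b t).
Proof. exact: plug_root_at. Qed.

End Functions.

(** Plugging commutes with brackets and labels, so each relation is carried to an instance of the
    same relation. It allows the normal form of a vertex to be used inside a composition. *)
Lemma rule_plug (V : lmodType k) (X X' : seq L) (f : tree -> V) a T :
    tree_rules hH X' f ->
    (forall t : tree, perm_eq (slots t) X ->
       perm_eq (slots (plug a T t.1, plug a T t.2)) X') ->
  tree_rules hH X (fun t : tree => f (plug a T t.1, plug a T t.2)).
Proof.
move=> fX' XX'; pose p := plug a T; split=> /=.
- by move=> s t /XX'; apply: (rule_sym fX' (s := p s)).
- by move=> s t u /XX'; apply: (rule_rot fX' (s := p s) (t := p t)).
- by move=> h s t /XX'; apply: (rule_inv fX' h (s := p s)).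
- by move=> s t u /XX'; apply: (rule_as fX' (s := p s) (t := p t)).
- by move=> s t u v /XX'; apply: (rule_ihx fX' (s := p s) (t := p t) (u := p u)).
- by move=> s t /XX'; apply: (rule_lin fX' (s := p s)).
- by move=> s t /XX'; apply: (rule_unit fX' (s := p s)).
- by move=> g h s t /XX'; apply: (rule_mul fX' g h (s := p s)).
- by move=> h s t u /XX'; apply: (rule_br fX' h (s := p s) (t := p t)).
Qed.

Lemma rule_add (V : lmodType k) (X : seq L) (f g : tree -> V) :
  tree_rules hH X f -> tree_rules hH X g -> tree_rules hH X (fun t : tree => f t + g t).
Proof.
move=> fX gX; split.
- by move=> s t stX; rewrite (rule_sym fX) // (rule_sym gX).
- by move=> s t u stX; rewrite (rule_rot fX) // (rule_rot gX).
- by move=> h s t stX; rewrite (rule_inv fX) // (rule_inv gX).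
- by move=> s t u stX; rewrite (rule_as fX) // (rule_as gX) // opprD.
- move=> s t u v stX; rewrite !addrA -[RHS](addr0 0).
  rewrite -[in X in _ = X + _](rule_ihx fX stX) -[in X in _ = _ + X](rule_ihx gX stX).
  by rewrite [RHS]addrACA [X in _ = X + _]addrACA !addrA.
- by move=> s t stX; apply: linear_add; [apply: rule_lin fX _ _ _ | apply: rule_lin gX _ _ _].
- by move=> s t stX; rewrite (rule_unit fX) // (rule_unit gX).
- by move=> a h s t stX; rewrite (rule_mul fX) // (rule_mul gX).
- move=> h s t u stX; rewrite (rule_br fX) // (rule_br gX) //.
  by rewrite /copsum -big_split.
Qed.

End Gluing.

(** The three rerootings respect one cyclic order of the slots; this is the symmetry behind the
    three equal signs in the theta relation. *)
Lemma tripodP (k : fieldType) (H : algType k) (hH : hopf H) (v : tree H hedge) :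
    tripod v -> uniq (slots v) -> exists x y z,
  [/\ slots v = [:: x; y; z], root_at hH x v = Br (Lf y) (Lf z),
      root_at hH y v = Br (Lf z) (Lf x) & root_at hH z v = Br (Lf x) (Lf y)].
Proof.
case: v => s t; rewrite /tripod /tlie /slots /= => /andP[/andP[ls lt]].
rewrite size_cat => /eqP E.
have gt0 (u : tm H hedge) : (0 < size (leaves u))%N by exact: leaves_gt0.
have l1 (u : tm H hedge) : lie u -> size (leaves u) = 1%N -> exists x, u = Lf x.
  case: u => [x|u1 u2|//] /=; first by exists x.
  by move=> _; rewrite size_cat; have := gt0 u1; have := gt0 u2; lia.
have l2 (u : tm H hedge) : lie u -> size (leaves u) = 2%N ->
    exists x y, u = Br (Lf x) (Lf y).
  case: u => [x|u1 u2|//] //= /andP[lu1 lu2]; rewrite size_cat => E2.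
  have u10 := gt0 u1; have u20 := gt0 u2.
  have [e1 e2] : size (leaves u1) = 1%N /\ size (leaves u2) = 1%N by lia.
  have [x ->] := l1 u1 lu1 e1; have [y ->] := l1 u2 lu2 e2.
  by exists x, y.
have s0 := gt0 s; have t0 := gt0 t.
have [s1|s1] : size (leaves s) = 1%N \/ size (leaves s) = 2%N by lia.
- have [x ->] := l1 _ ls s1; have t2 : size (leaves t) = 2%N by lia.
  have [y [z ->]] := l2 _ lt t2; move=> /= U; exists x, y, z.
  move: U; rewrite !inE !negb_or -!andbA => /and4P[/negPf xy /negPf xz /negPf yz _].
  have sym (p q : hedge) : (p == q) = false -> (q == p) = false by rewrite eq_sym.
  by rewrite /root_at /= !inE !eqxx !(sym _ _ xy) !(sym _ _ xz) !(sym _ _ yz) /=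
    ?inE ?eqxx ?(sym _ _ yz).
have t1 : size (leaves t) = 1%N by lia.
have [z ->] := l1 _ lt t1; have [x [y ->]] := l2 _ ls s1.
move=> /= U; exists x, y, z.
move: U; rewrite !inE !negb_or -!andbA => /and4P[/negPf xy /negPf xz /negPf yz _].
have sym (p q : hedge) : (p == q) = false -> (q == p) = false by rewrite eq_sym.
by rewrite /root_at /= !inE !eqxx !(sym _ _ xy) !(sym _ _ xz) !(sym _ _ yz) /=
    ?inE ?eqxx ?(sym _ _ xy) ?orbT.
Qed.

(** * From Omega_2 to the quotient of H (x) H *)

Section OneVertexGraphs.
Variables (k : fieldType) (H : algType k).
Local Notation tree := (tree H hedge).
Implicit Types (t : tree) (x y : hedge).

Definition outs (s : seq hedge) := [seq a <- s | ~~ a.2].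

Lemma outs_perm s : uniq s -> all (fun a => flip a \in s) s ->
  perm_eq s (outs s ++ [seq flip a | a <- outs s]).
Proof.
move=> Us /allP fs.
have pf : perm_eq [seq a <- s | a.2] [seq flip a | a <- outs s].
  apply: uniq_perm; rewrite ?filter_uniq //.
    by rewrite (map_inj_uniq flip_inj) filter_uniq.
  move=> a; rewrite mem_filter; apply/andP/mapP => [[a2 /fs fas]|[b]].
    exists (flip a); last by rewrite flipK.
    by rewrite mem_filter fas /= a2.
  by rewrite mem_filter => /andP[b2 /fs bs] ->; rewrite /= b2.
rewrite -(perm_filterC (fun a : hedge => ~~ a.2)) perm_cat2l /=.
by rewrite (eq_filter (a2 := fun a : hedge => a.2)) // => a /=; rewrite negbK.
Qed.

Lemma hedges1 t : hedges [:: t] = slots t.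
Proof. by rewrite /hedges /= cats0. Qed.

Lemma edges1 t : edges [:: t] = [seq a.1 | a <- outs (slots t)].
Proof. by rewrite /edges hedges1. Qed.

Definition two_edges (s : seq hedge) : bool :=
  [&& uniq s, all (fun a => flip a \in s) s & size s == 4%N].

(** One vertex is connected, and rank 2 means edges + 1 = 2 + 1, so two edges and four
    half-edges. *)
Lemma is_graph1 t : is_graph 2 1 [:: t] = two_edges (slots t).
Proof.
have -> : is_graph 2 1 [:: t] = [&& uniq (slots t),
    all (fun a => flip a \in slots t) (slots t) & size (outs (slots t)) == 2%N].
  rewrite /is_graph hedges1 edges1 size_map /= andbA.
  rewrite [[forall u, _]](_ : _ = true) ?andTb //.
    by rewrite -andbA; congr [&& _, _ & _]; lia.
  apply/forallP => u; apply/forallP => v.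
  suff -> : u = v by apply: connect0.
  by apply: val_inj; case: u v => [[|m] //= um] [[|m'] //= vm].
rewrite /two_edges; move: (slots t) => s.
have [Us|//] := boolP (uniq s); have [fs|//] := boolP (all _ _).
by have /perm_size := outs_perm Us fs; rewrite size_cat size_map => -> /=;
  case: (size (outs s)) => [|[|[|n]]] //=; rewrite !addnS.
Qed.

Lemma is_graph_size n j (g : seq tree) : is_graph n j g -> size g = j.
Proof. by case/and5P=> /eqP. Qed.

Lemma two_edgesP s : two_edges s -> exists x y,
  [/\ x.1 != y.1, ~~ x.2, ~~ y.2, outs s = [:: x; y] & perm_eq s (ends x y)].
Proof.
case/and3P=> Us fs /eqP s4; have os := outs_perm Us fs.
have := perm_size os; rewrite s4 size_cat size_map => o2.
have : all (fun a : hedge => ~~ a.2) (outs s) by rewrite filter_all.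
have : uniq (outs s) by rewrite filter_uniq.
have {o2} : size (outs s) = 2%N by move: o2; case: (size (outs s)) => [|[|[|n]]] //=; rewrite !addnS.
case E : (outs s) os => [|x [|y [|z l]]] //= os _.
rewrite inE andbT => xy /and3P[x2 y2 _]; exists x, y; split=> //.
  apply: contraNneq xy; case: (x) (y) x2 y2 => [e b] [f c] /=.
  by move=> /negPf-> /negPf-> ->.
by apply: perm_trans os _; apply/permP => p /=; lia.
Qed.

Lemma two_edges_ends x y s : x.1 != y.1 -> perm_eq s (ends x y) -> two_edges s.
Proof.
move=> xy sX; rewrite /two_edges (perm_uniq sX) ends_uniq // (perm_size sX) eqxx andbT.
apply/allP => a; rewrite !(perm_mem sX) !inE.
by case/or4P=> /eqP->; rewrite ?flipK eqxx ?orbT.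
Qed.

Lemma two_edges_perm s s' : perm_eq s s' -> two_edges s = two_edges s'.
Proof.
move=> ss'; rewrite /two_edges (perm_uniq ss') (perm_size ss') (perm_all _ ss').
by congr [&& _, _ & _]; apply: eq_all => a; apply: perm_mem.
Qed.

Lemma slots_relab (L L' : Type) (s : L -> L') (t : Defs.tree H L) :
  slots (relab s t) = map s (slots t).
Proof.
have E (u : tm H L) : leaves (bind (fun z => Lf (s z)) u) = map s (leaves u) :> seq L'.
  by elim: u => [z|u1 IH1 u2 IH2|h u IHu] //=; rewrite IH1 IH2 map_cat.
by rewrite /slots /= !E map_cat.
Qed.

Lemma two_edges_map (s : hedge -> hedge) l :
    injective s -> (forall a, s (flip a) = flip (s a)) ->
  two_edges (map s l) = two_edges l.
Proof.
move=> si sf; rewrite /two_edges map_inj_uniq // size_map all_map.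
by congr [&& _, _ & _]; apply: eq_all => a; rewrite /= -sf mem_map.
Qed.

End OneVertexGraphs.

Section GraphFunctional.
Variables (k : fieldType) (H : algType k) (hH : hopf H).
Hypothesis coc : cocommutative hH.
Local Notation S := (antip hH).
Local Notation D := (@copsum k H hH _).
Local Notation tree := (tree H hedge).
Local Notation tm := (tm H hedge).
Variables (V : lmodType k) (M : tensor H H -> V).
Hypotheses (Ml : linear M) (Mi : conj_inv hH M).
Hypothesis Mtau : forall a b, M (tens a b) = M (tens b a).
Hypothesis MSS : forall a b, M (tens a b) = M (tens (S a) (S b)).
Local Notation phi := (phi hH M).

(** [outs] picks the tail of each edge; by [phi_swap] the order in which the tails are listed does
    not matter. *)
Definition phiG (t : tree) : V :=
  if outs (slots t) is [:: x; y] then phi x y t else 0.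

Definition sgn (x y : hedge) : k := (-1) ^+ (x.2 + y.2)%N.

(** Choosing the head of an edge instead of its tail negates [phi]; [sgn] counts the heads
    chosen. *)
Lemma phiGE x y (t : tree) : x.1 != y.1 -> perm_eq (slots t) (ends x y) ->
  phiG t = sgn x y *: phi x y t.
Proof.
move=> xy tX; have [x' [y' [xy' x2 y2 oE tX']]] := two_edgesP (two_edges_ends xy tX).
rewrite /phiG oE.
have t4 : size (slots t) = 4%N by rewrite (perm_size tX).
have E (z w : hedge) : z.1 != w.1 -> phi (z.1, false) (w.1, false) t = sgn z w *: phi z w t.
  case: z w => [e b] [f c] /= ef; case: b; case: c; rewrite /sgn /= ?expr2 ?mulrNN ?mulr1 ?scale1r //.
  - by rewrite -[(e, true)]/(flip (e, false)) -[(f, true)]/(flip (f, false))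
      phi_flipr phi_flipl // opprK.
  - by rewrite expr1 -[(e, true)]/(flip (e, false)) phi_flipl // scaleN1r opprK.
  - by rewrite expr1 -[(f, true)]/(flip (f, false)) phi_flipr // scaleN1r opprK.
rewrite -E //.
have F (z : hedge) : ~~ z.2 -> z = (z.1, false) by case: z => ? [].
have xX : x' \in ends x y by rewrite -(perm_mem tX) (perm_mem tX') mem_head.
have yX : y' \in ends x y.
  by rewrite -(perm_mem tX) (perm_mem tX') !inE eqxx !orbT.
have G (z : hedge) : z \in ends x y -> z.1 = x.1 \/ z.1 = y.1.
  by rewrite !inE => /or4P[] /eqP->; auto.
rewrite (F _ x2) (F _ y2) /=.
move: xy'; case: (G _ xX) (G _ yX) => -> [] ->; rewrite ?eqxx // => xy'.
by rewrite phi_swap.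
Qed.

Lemma phiG_relab (s : hedge -> hedge) x y (t : tree) :
    injective s -> (forall a, s (flip a) = flip (s a)) ->
    x.1 != y.1 -> perm_eq (slots t) (ends x y) ->
  phiG (relab s t) = sgn (s x) (s y) *: phi x y t.
Proof.
move=> si sf xy tX; rewrite -(@phi_relab _ _ hH _ M s x y t si sf).
have sX : perm_eq (slots (relab s t)) (ends (s x) (s y)).
  by rewrite slots_relab /ends -!sf (perm_map s tX).
apply: phiGE => //; apply/eqP => E.
have := ends_uniq xy; rewrite -(map_inj_uniq si) /ends /= !sf.
case: (s x) (s y) E => [e b] [f c] /= ->; rewrite /flip /= !inE.
by case: b; case: c; rewrite ?eqxx ?orbT.
Qed.

Definition Gfun (g : seq tree) : V := if g is [:: t] then phiG t else 0.

Definition Fgr : freemod k (graph H 2 1) -> V :=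
  fext (fun u : graph H 2 1 => Gfun (val u)).

Lemma Fgr_linear : linear Fgr. Proof. exact: fext_linear. Qed.

Lemma Fgr_gr g : Fgr (gr 2 1 g) = if is_graph 2 1 g then Gfun g else 0.
Proof.
rewrite /gr; case: insubP => [u gg <-|/negPf gg].
  by rewrite (valP u) /Fgr fextU.
by rewrite gg (lin0 Fgr_linear).
Qed.

Lemma Fgr_gr1 (t : tree) :
  Fgr (gr 2 1 [:: t]) = if two_edges (slots t) then phiG t else 0.
Proof. by rewrite Fgr_gr is_graph1. Qed.

Lemma Fgr_gr0 (g : seq tree) : size g != 1%N -> Fgr (gr 2 1 g) = 0.
Proof.
move=> g1; rewrite Fgr_gr; case: ifP => // /is_graph_size E.
by rewrite E in g1.
Qed.

(** Exchanging vertices concerns lists with at least two vertices, which are sent to 0. Reversing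
    one edge changes [sgn] and renaming preserves it, while [phi] is natural under both. Relations
    between decorations are those of HLie, killed by [phi_hlie]. *)
Lemma Fgr_rel r : graph_rel hH r -> Fgr r = 0.
Proof.
have Fl := Fgr_linear; case=> {r}.
- move=> g1 u v g2; rewrite (linD Fl) !Fgr_gr0 ?addr0 //;
    by rewrite size_cat /=; lia.
- move=> g e eg; rewrite (linD Fl).
  case: g eg => [|t [|u g]] eg; [by rewrite !Fgr_gr0 ?addr0| |
    by rewrite !Fgr_gr0 ?addr0].
  set s := fun a : hedge => _.
  have si : injective s.
    apply: (can_inj (g := s)) => a; rewrite /s.
    by case: (eqVneq a.1 e) => [ae|/negPf ae]; rewrite /= ?ae ?eqxx ?flipK.
  have sf a : s (flip a) = flip (s a).
    by rewrite /s /=; case: (a.1 == e).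
  rewrite /= !Fgr_gr1 slots_relab two_edges_map //.
  case: ifP => [f4|]; last by rewrite addr0.
  have [x [y [xy x2 y2 oE tX]]] := two_edgesP f4.
  rewrite (phiG_relab si sf xy tX) (phiGE xy tX).
  move: eg; rewrite edges1 oE /= !inE /sgn /s.
  have s1 (a : hedge) : ~~ a.2 -> (flip a).2 = true by case: a => ? [].
  move=> /orP[] /eqP->; rewrite eqxx.
    rewrite [y.1 == _]eq_sym (negPf xy) (s1 _ x2) (negPf x2) (negPf y2) /=.
    by rewrite expr0 expr1 scale1r scaleN1r subrr.
  rewrite (negPf xy) (s1 _ y2) (negPf x2) (negPf y2) /=.
  by rewrite expr0 expr1 scale1r scaleN1r subrr.
- move=> g f fi; rewrite (linB Fl).
  case: g => [|t [|u g]]; [by rewrite !Fgr_gr0 ?subr0| |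
    by rewrite !Fgr_gr0 ?subr0].
  set s := fun a : hedge => _.
  have si : injective s by move=> [a b] [c d] [] /fi -> ->.
  have sf a : s (flip a) = flip (s a) by [].
  rewrite /= !Fgr_gr1 slots_relab two_edges_map //.
  case: ifP => [f4|]; last by rewrite subr0.
  have [x [y [xy x2 y2 oE tX]]] := two_edgesP f4.
  rewrite (phiG_relab si sf xy tX) (phiGE xy tX).
  by rewrite /sgn /s /= subrr.
move=> g1 X s g2 sX s0; rewrite (lin_sum Fl).
under eq_bigr => c _ do rewrite (linZ Fl).
have [g10|g10] := eqVneq (size g1 + size g2)%N 0%N; last first.
  apply: big1 => c _; rewrite Fgr_gr0 ?scaler0 // size_cat /=; lia.
have [-> ->] : g1 = [::] /\ g2 = [::] by case: (g1) (g2) g10 => [|? ?] [|? ?].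
rewrite /=; under eq_bigr => c _ do rewrite Fgr_gr1.
have [f4|f4] := boolP (two_edges X); last first.
  apply: big1_seq => c /andP[_ /sX cX].
  by rewrite (two_edges_perm cX) (negPf f4) scaler0.
have [x [y [xy x2 y2 oE pX]]] := two_edgesP f4.
have pX' : perm_eq (ends x y) X by rewrite perm_sym.
have E := hlie_fun_sum (phi_hlie coc Ml Mi xy pX') sX s0.
transitivity (sgn x y *: \sum_(c <- s) c.1 *: phi x y c.2).
  rewrite scaler_sumr; apply: eq_big_seq => c /sX cX.
  rewrite (two_edges_perm cX) f4 (phiGE xy); last exact: perm_trans cX pX.
  by rewrite !scalerA mulrC.
by rewrite E scaler0.
Qed.

Definition Fgraphs : graphs hH 2 1 -> V := quot_lift Fgr.

Lemma Fgraphs_linear : linear Fgraphs.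
Proof. exact: quot_lift_linear Fgr_linear Fgr_rel. Qed.

Lemma Fgraphs_slide r : slide_rel (n := 2) (j := 1) r -> Fgraphs r = 0.
Proof.
case=> g h a; rewrite /Fgraphs (quot_lift_pr Fgr_linear Fgr_rel).
rewrite (linB Fgr_linear).
case: g => [|t [|u g]]; [by rewrite !Fgr_gr0 ?subr0| |
    by rewrite !Fgr_gr0 ?subr0].
rewrite /put /= -!/(treeput _ _ t) !Fgr_gr1.
have sE b c : slots (treeput b c t) = slots t.
  by rewrite /slots /treeput /= -!/(tput c b _) !leaves_tput.
rewrite !sE; case: ifP => [f4|]; last by rewrite subr0.
have [x [y [xy x2 y2 oE tX]]] := two_edgesP f4.
rewrite !(phiGE xy) ?sE // (phi_put coc) ?subrr //.
Qed.

Definition Fbar : graphs_bar hH 2 1 -> V := quot_lift Fgraphs.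

Lemma Fbar_linear : linear Fbar.
Proof. exact: quot_lift_linear Fgraphs_linear Fgraphs_slide. Qed.

Lemma Fbar_grb (t : tree) :
  Fbar (grb hH 2 1 [:: t]) = if two_edges (slots t) then phiG t else 0.
Proof.
rewrite /Fbar /grb (quot_lift_pr Fgraphs_linear Fgraphs_slide).
by rewrite /Fgraphs (quot_lift_pr Fgr_linear Fgr_rel) Fgr_gr1.
Qed.

Lemma Fbar_ends x y (t : tree) : x.1 != y.1 -> perm_eq (slots t) (ends x y) ->
  Fbar (grb hH 2 1 [:: t]) = sgn x y *: phi x y t.
Proof.
by move=> xy tX; rewrite Fbar_grb (two_edges_ends xy tX) (phiGE xy tX).
Qed.

End GraphFunctional.

Arguments glue : simpl never.

Lemma edges_perm6 (k : fieldType) (H : algType k) (g : seq (tree H hedge)) x y z :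
  perm_eq (hedges g) [:: x; flip x; y; flip y; z; flip z] ->
  perm_eq (edges g) [:: x.1; y.1; z.1].
Proof.
move=> gX; rewrite /edges.
have := perm_map fst (perm_filter (fun a : hedge => ~~ a.2) gX).
move/perm_trans; apply.
by case: x y z {gX} => [x []] [y []] [z []].
Qed.

Lemma uniq_fst_neq x y : uniq (ends x y) -> x.1 != y.1.
Proof.
move=> U; apply/eqP => E; move: U.
case: x y E => [e b] [f c] /= ->; rewrite /ends /flip /= !inE.
by case: b; case: c; rewrite ?eqxx ?orbT.
Qed.

(** * The functional vanishes on the boundaries of dumbbells and theta graphs *)

Section Boundary.
Variables (k : fieldType) (H : algType k) (hH : hopf H).
Hypothesis coc : cocommutative hH.
Local Notation S := (antip hH).
Local Notation D := (@copsum k H hH _).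
Local Notation tree := (tree H hedge).
Local Notation tm := (tm H hedge).
Variables (V : lmodType k) (M : tensor H H -> V).
Hypotheses (Ml : linear M) (Mi : conj_inv hH M).
Hypothesis Mtau : forall a b, M (tens a b) = M (tens b a).
Hypothesis MSS : forall a b, M (tens a b) = M (tens (S a) (S b)).
Hypothesis M1 : forall b, M (tens 1 b) = 0.
Hypothesis Mgam : forall a b, M (tens a b)
  + D a (fun a1 a2 => M (tens (S b * a1) a2))
  + D b (fun b1 b2 => M (tens b1 (S a * b2))) = 0.
Local Notation phi := (phi hH M).
Local Notation Fbar := (@Fbar k H hH V M).

Let phi_rules x y X : x.1 != y.1 -> perm_eq (ends x y) X -> tree_rules hH X (phi x y).
Proof. by move=> xy pX; apply/hlie_fun_rules/phi_hlie. Qed.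

Definition bd_term (g : seq tree) (e : nat) : V :=
  let i := vtx g (e, false) in
  let i' := vtx g (e, true) in
  if i != i' then (-1) ^+ (i + i' + (i < i'))%N *: Fbar (grb hH 2 1 (contract hH e g))
  else 0.

Lemma Fbar_bd (g : seq tree) : Fbar (bd hH 2 1 g) = \sum_(e <- edges g) bd_term g e.
Proof.
have Fl := Fbar_linear coc Ml Mi Mtau MSS.
rewrite /bd (lin_sum Fl) big_mkcond; apply: eq_bigr => e _.
by rewrite /bd_term; case: ifP => // _; rewrite (linZ Fl).
Qed.

Lemma vtx2 (v w : tree) a : vtx [:: v; w] a =
  if a \in slots v then 0%N else if a \in slots w then 1%N else 2%N.
Proof. by rewrite /vtx /=; case: ifP => //; case: ifP. Qed.

Lemma bd_term_loop (g : seq tree) a :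
  vtx g a = vtx g (flip a) -> bd_term g a.1 = 0.
Proof. by case: a => e []; rewrite /bd_term /flip /= => ->; rewrite eqxx. Qed.

Lemma slots_glue a b (v w : tree) : uniq (slots v) -> a \in slots v ->
  b \in slots w -> perm_eq (a :: b :: slots (glue hH a b v w)) (slots v ++ slots w).
Proof.
move=> Uv av bw; rewrite glueE -[tbind _ _]/(plug a (root_at hH b w) v.1, plug a (root_at hH b w) v.2).
have := slots_plug (root_at hH b w) Uv av; move: (slots (_, _)) => l p1.
have p2 := leaves_root_at hH bw.
apply: perm_trans (_ : perm_eq _ (b :: (slots v ++ leaves (root_at hH b w)))) _.
  rewrite -(perm_cons b) in p1; apply: perm_trans p1.
  by perm_count.
apply: perm_trans (_ : perm_eq _ (slots v ++ (b :: leaves (root_at hH b w)))) _.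
  by perm_count.
by rewrite perm_cat2l.
Qed.

(** The sign collects the direction of the contracted edge and those of the two remaining ones.
    Exchanging the vertices changes the sign of the contraction while the pairing of the rerooted
    trees is symmetric. *)
Lemma bd_term_root (v w : tree) a x y : x.1 != y.1 -> uniq (slots v ++ slots w) ->
    a \in slots v -> flip a \in slots w ->
    perm_eq (slots v ++ slots w) (a :: flip a :: ends x y) ->
  let r := ((-1) ^+ a.2 * sgn k x y) *: phi x y (root_at hH a v, root_at hH (flip a) w) in
  bd_term [:: v; w] a.1 = r /\ bd_term [:: w; v] a.1 = - r.
Proof.
move=> xy U av aw vwX r.
move: (U); rewrite cat_uniq => /and3P[Uv /hasPn Uvw Uw].
have aNw : (a \in slots w) = false by apply/negP => /Uvw; rewrite /= av.
have fNv : (flip a \in slots v) = false by apply/negP => av'; have := Uvw _ aw; rewrite /= av'.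
have G (b c : hedge) (s t : tree) : uniq (slots s) -> b \in slots s -> c \in slots t ->
    perm_eq (slots s ++ slots t) (b :: c :: ends x y) ->
    Fbar (grb hH 2 1 [:: glue hH b c s t]) = sgn k x y *: phi x y (root_at hH b s, root_at hH c t)
    /\ perm_eq (slots (glue hH b c s t)) (ends x y).
  move=> Us bs ct stX; have gX : perm_eq (slots (glue hH b c s t)) (ends x y).
    rewrite -(perm_cons c) -(perm_cons b).
    by apply: perm_trans stX; apply: slots_glue.
  rewrite (Fbar_ends coc Ml Mi Mtau MSS xy gX); split=> //.
  by rewrite (glue_root_at (phi_rules xy (perm_refl _))).
have [G1 _] := G _ _ _ _ Uv av aw vwX.
have wvX : perm_eq (slots w ++ slots v) (flip a :: a :: ends x y).
  rewrite (perm_catC (slots w) (slots v)); apply: perm_trans vwX _.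
  by perm_count.
have [G2 g2X] := G _ _ _ _ Uw aw av wvX.
have rX : perm_eq (slots (root_at hH (flip a) w, root_at hH a v)) (ends x y).
  have pw := leaves_root_at hH aw; have pv := leaves_root_at hH av.
  rewrite -(perm_cons a) -(perm_cons (flip a)).
  apply: perm_trans wvX; rewrite /slots /=.
  apply: perm_trans (perm_cat pw pv).
  by perm_count.
rewrite (rule_sym (phi_rules xy (perm_refl _))) // in G2.
have Vva : vtx [:: v; w] a = 0%N by rewrite vtx2 av.
have Vvf : vtx [:: v; w] (flip a) = 1%N by rewrite vtx2 fNv aw.
have Vwa : vtx [:: w; v] a = 1%N by rewrite vtx2 aNw av.
have Vwf : vtx [:: w; v] (flip a) = 0%N by rewrite vtx2 aw.
(* The boundary always contracts from tail to head, while [a] may be either end of the edge. *)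
have E0 : (a.1, false) = if a.2 then flip a else a by case: (a) => e [].
have E1 : (a.1, true) = if a.2 then a else flip a by case: (a) => e [].
clear - G1 G2 Vva Vvf Vwa Vwf E0 E1.
rewrite /bd_term /contract E0 E1 {E0 E1} /r; case: (a.2); cbv zeta beta iota.
  rewrite Vva Vvf Vwa Vwf /= G2.
  by rewrite ?expr0 ?expr1 ?sqrrN ?expr1n ?scale1r ?mulN1r ?mul1r ?scaleN1r
    ?scaleNr ?opprK.
rewrite Vva Vvf Vwa Vwf /= G1.
by rewrite ?expr0 ?expr1 ?sqrrN ?expr1n ?scale1r ?mulN1r ?mul1r ?scaleN1r
  ?scaleNr ?opprK.
Qed.

Lemma big_edges3 (g : seq tree) x y z :
  perm_eq (hedges g) [:: x; flip x; y; flip y; z; flip z] ->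
  \sum_(e <- edges g) bd_term g e = bd_term g x.1 + bd_term g y.1 + bd_term g z.1.
Proof.
move=> gX; rewrite (perm_big _ (edges_perm6 gX)) /= !big_cons big_nil addr0.
by rewrite addrA.
Qed.

Lemma hedges2 (v w : tree) : hedges [:: v; w] = slots v ++ slots w.
Proof. by rewrite /hedges /= cats0. Qed.

(** Loops are not contracted, so only the bridge [c] contributes; its term contains the label-free
    loop of the tripod [v] and vanishes by [phi_loop]. *)
Lemma dumbbell (v w : tree) c l m :
    uniq [:: c; flip c; l; flip l; m; flip m] ->
    perm_eq (slots v) [:: c; l; flip l] -> root_at hH c v = Br (Lf l) (Lf (flip l)) ->
    perm_eq (slots w) [:: flip c; m; flip m] ->
  \sum_(e <- edges [:: v; w]) bd_term [:: v; w] e = 0 /\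
  \sum_(e <- edges [:: w; v]) bd_term [:: w; v] e = 0.
Proof.
move=> U vX rv wX.
have p6 : perm_eq (slots v ++ slots w) [:: c; flip c; l; flip l; m; flip m].
  by apply: perm_trans (perm_cat vX wX) _; perm_count.
have p6' : perm_eq (slots w ++ slots v) [:: c; flip c; l; flip l; m; flip m].
  by rewrite (perm_catC (slots w) (slots v)).
have Ulm : uniq (ends l m) by move: U => /= /and3P[_ _].
have lm := uniq_fst_neq Ulm.
have so3_val : c \in slots v by rewrite (perm_mem vX) mem_head.
have cw : flip c \in slots w by rewrite (perm_mem wX) mem_head.
have Uvw : uniq (slots v ++ slots w) by rewrite (perm_uniq p6).
have [b1 b2] := bd_term_root lm Uvw so3_val cw p6.
have r0 : phi l m (root_at hH c v, root_at hH (flip c) w) = 0.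
  rewrite rv phi_loop //; rewrite -(perm_cons (flip c)).
  exact: perm_trans (leaves_root_at hH cw) wX.
have lv a : a \in [:: l; flip l] -> a \in slots v.
  by rewrite (perm_mem vX) !inE => ->; rewrite orbT.
have mw a : a \in [:: m; flip m] -> a \in slots w.
  by rewrite (perm_mem wX) !inE => ->; rewrite orbT.
have mem2 (a b : hedge) : (a \in [:: a; b]) * (b \in [:: a; b]).
  by rewrite !inE !eqxx orbT.
move: (Uvw); rewrite cat_uniq => /and3P[_ /hasPn N _].
have mv a : a \in [:: m; flip m] -> (a \in slots v) = false.
  by move=> /mw /N /negPf.
have lw a : a \in [:: l; flip l] -> (a \in slots w) = false.
  by move=> /lv av; apply/negP => /N; rewrite /= av.
rewrite (@big_edges3 _ c l m) ?hedges2 // (@big_edges3 _ c l m) ?hedges2 //.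
rewrite b1 b2 r0 scaler0 oppr0 !add0r.
have z1 : bd_term [:: v; w] l.1 = 0 by apply: bd_term_loop; rewrite !vtx2 !lv ?mem2.
have z2 : bd_term [:: v; w] m.1 = 0.
  by apply: bd_term_loop; rewrite !vtx2 !mv ?mem2 // !mw ?mem2.
have z3 : bd_term [:: w; v] l.1 = 0.
  by apply: bd_term_loop; rewrite !vtx2 !lw ?mem2 // !lv ?mem2.
have z4 : bd_term [:: w; v] m.1 = 0 by apply: bd_term_loop; rewrite !vtx2 !mw ?mem2.
by rewrite z1 z2 z3 z4 addr0.
Qed.

(** The three contractions of a theta graph whose second vertex is the tripod with labels 1, q, r.
    Here no label lies above a bracket; in the next two lemmas a label lands on one and is split by
    the coproduct. *)
Lemma theta_T1 y z q r : y.1 != z.1 ->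
  phi y z (Br (Lf y) (Lf z), Br (Op q (Lf (flip y))) (Op r (Lf (flip z)))) =
  M (tens (S q) (S r)).
Proof.
move=> yz; have fw := phi_rules yz (perm_refl _).
rewrite -(rule_unitl fw); last by perm_count.
rewrite -(rule_unitr fw); last by perm_count.
by rewrite phi_std // !mul1r.
Qed.

Lemma theta_T2 x z q r : z.1 != x.1 ->
  phi z x (Lf (flip x), Br (Op q (Br (Lf z) (Lf x))) (Op r (Lf (flip z)))) =
  D q (fun a b => M (tens (a * S r) b)).
Proof.
move=> zx; have fw := phi_rules zx (perm_refl _).
rewrite (rule_sym fw); last by perm_count.
rewrite (rule_left fw); last by perm_count.
rewrite (rule_br fw); last by perm_count.
apply: eq_D => a b; rewrite -(rule_unitrr fw); last by perm_count.
by rewrite phi_std // S_1 mulr1.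
Qed.

Lemma theta_T3 x y q r : x.1 != y.1 ->
  phi x y (Lf (flip x), Br (Op q (Lf (flip y))) (Op r (Br (Lf x) (Lf y)))) =
  D r (fun a b => M (tens a (b * S q))).
Proof.
move=> xy; have fw := phi_rules xy (perm_refl _).
rewrite (rule_rotr fw); last by perm_count.
rewrite (rule_sym fw); last by perm_count.
rewrite (rule_br fw); last by perm_count.
apply: eq_D => a b; rewrite -(rule_unitrl fw); last by perm_count.
by rewrite phi_std // S_1 mulr1.
Qed.

(** As a function of [w] the sum obeys all relations of HLie, so [nf_span3] reduces it to a tripod
    with labels 1, q, r; for this tripod it is the three-term relation for q and r. *)
Lemma theta_sum (w : tree) x y z :
    uniq [:: x; flip x; y; flip y; z; flip z] ->
    perm_eq (slots w) [:: flip x; flip y; flip z] ->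
  phi y z (Br (Lf y) (Lf z), root_at hH (flip x) w) +
  phi z x (Br (Lf z) (Lf x), root_at hH (flip y) w) +
  phi x y (Br (Lf x) (Lf y), root_at hH (flip z) w) = 0.
Proof.
move=> U wX; pose X := [:: flip x; flip y; flip z].
have Uyz : uniq (ends y z) by move: U => /= /and3P[_ _].
have Uzx : uniq (ends z x).
  apply: subseq_uniq (_ : subseq _ [:: z; flip z; x; flip x; y; flip y]) _.
    by rewrite -[[:: z; _; _; _; _; _]]/(ends z x ++ [:: y; flip y]) prefix_subseq.
  rewrite -(perm_uniq (s1 := [:: x; flip x; y; flip y; z; flip z])) //.
  by perm_count.
have Uxy : uniq (ends x y).
  apply: subseq_uniq U.
  by rewrite -[[:: x; _; _; _; _; _]]/(ends x y ++ [:: z; flip z]) prefix_subseq.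
have yz := uniq_fst_neq Uyz; have zx := uniq_fst_neq Uzx; have xy := uniq_fst_neq Uxy.
have UX : uniq X.
  apply: subseq_uniq U; apply/subseqP.
  by exists [:: false; true; false; true; false; true].
have plugX a b c : perm_eq [:: flip a; flip b; flip c] X -> forall t : tree,
    perm_eq (slots t) X ->
    perm_eq (slots (plug (flip a) (Br (Lf b) (Lf c)) t.1,
                    plug (flip a) (Br (Lf b) (Lf c)) t.2)) (ends b c).
  move=> aX t tX; have at' : flip a \in slots t.
    by rewrite (perm_mem tX) -(perm_mem aX) mem_head.
  have Ut : uniq (slots t) by rewrite (perm_uniq tX).
  have p1 := slots_plug (Br (Lf b) (Lf c)) Ut at'.
  rewrite -(perm_cons (flip a)); apply: perm_trans p1 _.
  rewrite perm_sym in aX; have tX' := perm_trans tX aX.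
  apply: perm_trans (perm_cat tX' (perm_refl _)) _.
  by perm_count.
have X1 : perm_eq [:: flip x; flip y; flip z] X by [].
have X2 : perm_eq [:: flip y; flip z; flip x] X by perm_count.
have X3 : perm_eq [:: flip z; flip x; flip y] X by perm_count.
have P a b c : b.1 != c.1 -> perm_eq [:: flip a; flip b; flip c] X ->
    phi b c (Br (Lf b) (Lf c), root_at hH (flip a) w) =
    phi b c (plug (flip a) (Br (Lf b) (Lf c)) w.1, plug (flip a) (Br (Lf b) (Lf c)) w.2).
  move=> bc aX; have fw := phi_rules bc (perm_refl (ends b c)).
  have aw : flip a \in slots w by rewrite (perm_mem wX) -(perm_mem aX) mem_head.
  have Uw : uniq (slots w) by rewrite (perm_uniq wX).
  have pw := plugX a b c aX w wX.
  rewrite (plug_root_at fw) // (rule_sym fw) //.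
  have pr := leaves_root_at hH aw; rewrite -(perm_cons (flip a)) /slots [leaves _]/=.
  apply: perm_trans (_ : perm_eq _ ((flip a :: leaves (root_at hH (flip a) w)) ++ [:: b; c])) _.
    by perm_count.
  apply: perm_trans (perm_cat (perm_trans pr wX) (perm_refl _)) _.
  apply: perm_trans (perm_cat _ (perm_refl _)) _; first by rewrite perm_sym in aX; apply: aX.
  by perm_count.
rewrite (P x y z) // (P y z x) // (P z x y) //.
pose f (t : tree) :=
  phi y z (plug (flip x) (Br (Lf y) (Lf z)) t.1, plug (flip x) (Br (Lf y) (Lf z)) t.2) +
  phi z x (plug (flip y) (Br (Lf z) (Lf x)) t.1, plug (flip y) (Br (Lf z) (Lf x)) t.2) +
  phi x y (plug (flip z) (Br (Lf x) (Lf y)) t.1, plug (flip z) (Br (Lf x) (Lf y)) t.2).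
have fX : tree_rules hH X f.
  apply: rule_add; first apply: rule_add.
  - by apply: rule_plug (plugX x y z X1); apply: phi_rules.
  - by apply: rule_plug (plugX y z x X2); apply: phi_rules.
  - by apply: rule_plug (plugX z x y X3); apply: phi_rules.
rewrite -[LHS]/(f w).
apply: (nf_span3 fX (U := fun v => v = 0) _ _ UX X1) => //.
  by move=> a u v -> ->; rewrite scaler0 addr0.
move=> q r; rewrite /f /plug /= !eqxx.
have [n1 n2 n3] : [/\ (flip y == flip x) = false, (flip z == flip x) = false &
  (flip z == flip y) = false].
  move: UX; rewrite /X /= !inE negb_or => /andP[/andP[/negPf a1 /negPf a2]].
  by rewrite andbT => /negPf a3; rewrite eq_sym a1 eq_sym a2 eq_sym a3.
have [m1 m2 m3] : [/\ (flip x == flip y) = false, (flip x == flip z) = false &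
  (flip y == flip z) = false].
  by rewrite eq_sym n1 eq_sym n2 eq_sym n3.
rewrite n1 n2 n3 m1 m2 m3.
(* S (x) S removes the antipodes of the first term. The other two have S(r) or S(q) on the wrong
   side of the coproduct component, which [conj_inv_swap] corrects. *)
rewrite theta_T1 // theta_T2 // theta_T3 // -MSS -[RHS](Mgam q r).
congr (_ + _ + _); last by rewrite conj_inv_swap.
transitivity (D q (fun a b => M (tens a (b * S r)))).
  by rewrite (D_comm coc); [apply: eq_D => a b; rewrite Mtau | lin].
rewrite -conj_inv_swap // (D_comm coc); last by lin.
by apply: eq_D => a b; rewrite Mtau.
Qed.

Lemma theta (v w : tree) x y z :
    uniq [:: x; flip x; y; flip y; z; flip z] ->
    slots v = [:: x; y; z] -> root_at hH x v = Br (Lf y) (Lf z) ->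
    root_at hH y v = Br (Lf z) (Lf x) -> root_at hH z v = Br (Lf x) (Lf y) ->
    perm_eq (slots w) [:: flip x; flip y; flip z] ->
  \sum_(e <- edges [:: v; w]) bd_term [:: v; w] e = 0 /\
  \sum_(e <- edges [:: w; v]) bd_term [:: w; v] e = 0.
Proof.
move=> U vX rx ry rz wX.
have p6 : perm_eq (slots v ++ slots w) [:: x; flip x; y; flip y; z; flip z].
  rewrite vX; apply: perm_trans (perm_cat (perm_refl _) wX) _; perm_count.
have p6' : perm_eq (slots w ++ slots v) [:: x; flip x; y; flip y; z; flip z].
  by rewrite (perm_catC (slots w) (slots v)).
have Uvw : uniq (slots v ++ slots w) by rewrite (perm_uniq p6).
have mem a : a \in [:: x; y; z] -> a \in slots v by rewrite vX.
have memw a : a \in [:: flip x; flip y; flip z] -> a \in slots w.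
  by rewrite (perm_mem wX).
have Uyz : uniq (ends y z) by move: U => /= /and3P[_ _].
have Uxy : uniq (ends x y).
  apply: subseq_uniq U.
  by rewrite -[[:: x; _; _; _; _; _]]/(ends x y ++ [:: z; flip z]) prefix_subseq.
have Uzx : uniq (ends z x).
  apply: subseq_uniq (_ : subseq _ [:: z; flip z; x; flip x; y; flip y]) _.
    by rewrite -[[:: z; _; _; _; _; _]]/(ends z x ++ [:: y; flip y]) prefix_subseq.
  by rewrite -(perm_uniq (s1 := [:: x; flip x; y; flip y; z; flip z])) //; perm_count.
have yz := uniq_fst_neq Uyz; have zx := uniq_fst_neq Uzx; have xy := uniq_fst_neq Uxy.
have [] := bd_term_root yz Uvw (mem x _) (memw _ _) p6; rewrite ?inE ?eqxx ?orbT //.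
have py : perm_eq (slots v ++ slots w) (y :: flip y :: ends z x).
  by apply: perm_trans p6 _; perm_count.
have pz : perm_eq (slots v ++ slots w) (z :: flip z :: ends x y).
  by apply: perm_trans p6 _; perm_count.
have [] := bd_term_root zx Uvw (mem y _) (memw _ _) py; rewrite ?inE ?eqxx ?orbT //.
have [] := bd_term_root xy Uvw (mem z _) (memw _ _) pz; rewrite ?inE ?eqxx ?orbT //.
rewrite rx ry rz => bz bz' b_y by' bx bx'.
rewrite (@big_edges3 _ x y z) ?hedges2 // (@big_edges3 _ x y z) ?hedges2 //.
rewrite bx bx' b_y by' bz bz' -!opprD.
suff -> : ((-1) ^+ x.2 * sgn k y z) *: phi y z (Br (Lf y) (Lf z), root_at hH (flip x) w) +
   ((-1) ^+ y.2 * sgn k z x) *: phi z x (Br (Lf z) (Lf x), root_at hH (flip y) w) +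
   ((-1) ^+ z.2 * sgn k x y) *: phi x y (Br (Lf x) (Lf y), root_at hH (flip z) w) = 0.
  by rewrite oppr0.
(* All three terms carry the same sign, determined by the directions of the three edges, so it
   factors out. *)
have sE (a b c : hedge) : (-1) ^+ a.2 * sgn k b c = (-1) ^+ (a.2 + b.2 + c.2).
  by rewrite /sgn -exprD addnA.
rewrite !sE -[(z.2 + x.2 + y.2)%N]addnA [(z.2 + _)%N]addnC.
rewrite -[(y.2 + z.2 + x.2)%N]addnC [(x.2 + (_ + _))%N]addnA.
by rewrite -!scalerDr theta_sum ?scaler0.
Qed.

(** Once the leg [c] is matched, the other two half-edges of [w] can only be matched with each
    other. *)
Lemma dumbbell_graph (v w : tree) c l : uniq (slots v ++ slots w) ->
    (forall a, a \in slots v ++ slots w -> flip a \in slots v ++ slots w) ->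
    size (slots w) = 3%N -> perm_eq (slots v) [:: c; l; flip l] ->
    root_at hH c v = Br (Lf l) (Lf (flip l)) -> flip c \in slots w ->
  \sum_(e <- edges [:: v; w]) bd_term [:: v; w] e = 0 /\
  \sum_(e <- edges [:: w; v]) bd_term [:: w; v] e = 0.
Proof.
move=> U cl w3 vX rv cw; move: (U); rewrite cat_uniq => /and3P[Uv /hasPn N Uw].
have wE := perm_to_rem cw; have := perm_size wE; rewrite w3 /=.
case wr : (rem (flip c) (slots w)) wE => [|m [|m' [|]]] //= wX _.
have mw : m \in slots w by rewrite (perm_mem wX) !inE eqxx orbT.
have Uw' : uniq [:: flip c; m; m'] by rewrite -(perm_uniq wX).
have vE a : (a \in slots v) = (a \in [:: c; l; flip l]) by rewrite (perm_mem vX).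
have fm : flip m = m'.
  have : flip m \in slots v ++ slots w by apply: cl; rewrite mem_cat mw orbT.
  rewrite mem_cat vE (perm_mem wX) !inE flip_neq /= => /orP[|]; last first.
    case/orP=> /eqP // /flip_inj mc; have := N _ mw.
    by rewrite /= vE mc mem_head.
  case/or3P=> /eqP fm.
  - by move: Uw'; rewrite /= inE -fm flipK eqxx.
  - by have := N _ mw; rewrite /= vE !inE -fm flipK eqxx !orbT.
  - by have := N _ mw; rewrite /= vE (flip_inj fm) !inE eqxx orbT.
rewrite -fm in wX; apply: (dumbbell (c := c) (l := l) (m := m)) => //.
have p6 : perm_eq (slots v ++ slots w) [:: c; flip c; l; flip l; m; flip m].
  by apply: perm_trans (perm_cat vX wX) _; perm_count.
by rewrite -(perm_uniq p6).
Qed.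

(** Either two legs of the tripod form a loop, and the graph is a dumbbell, or all three legs lead
    to [w], and it is a theta graph. *)
Lemma tripod_zero (v w : tree) : tripod v -> uniq (slots v ++ slots w) ->
    (forall a, a \in slots v ++ slots w -> flip a \in slots v ++ slots w) ->
    size (slots w) = 3%N ->
  \sum_(e <- edges [:: v; w]) bd_term [:: v; w] e = 0 /\
  \sum_(e <- edges [:: w; v]) bd_term [:: w; v] e = 0.
Proof.
move=> tv U cl w3; move: (U); rewrite cat_uniq => /and3P[Uv /hasPn N Uw].
have [x [y [z [vX rx ry rz]]]] := tripodP hH tv Uv.
have Uxyz : uniq [:: x; y; z] by rewrite -vX.
have [nxy nxz nyz] : [/\ x != y, x != z & y != z].
  by move: Uxyz; rewrite /= !inE negb_or => /and3P[/andP[]].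
have vw a : a \in [:: x; y; z] -> flip a \in [:: x; y; z] \/ flip a \in slots w.
  by rewrite -vX => av; apply/orP; rewrite -mem_cat; apply: cl; rewrite mem_cat av.
have G := dumbbell_graph U cl w3.
have inv a : a \in [:: x; y; z] -> a \notin slots w.
  by rewrite -vX => av; apply/negP => /N; rewrite /= av.
have mx : x \in [:: x; y; z] by rewrite mem_head.
have my : y \in [:: x; y; z] by rewrite !inE eqxx orbT.
have mz : z \in [:: x; y; z] by rewrite !inE eqxx !orbT.
have [fx|fx] := vw x mx.
  move: fx; rewrite !inE flip_neq /= => /orP[] /eqP fx.
    have fz : flip z \in slots w.
      case: (vw z mz) => //; rewrite !inE flip_neq orbF => /orP[] /eqP E.
        by move: nyz; rewrite -fx -E flipK eqxx.
      by move: nxz; rewrite -(flipK x) fx -E flipK eqxx.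
    apply: (G z x) => //; first by rewrite vX fx; perm_count.
    by rewrite rz fx.
  have fy : flip y \in slots w.
    case: (vw y my) => //; rewrite !inE flip_neq => /orP[] /eqP E.
      by move: nyz; rewrite -fx -E flipK eqxx.
    by move: nxy; rewrite -(flipK x) fx -E flipK eqxx.
  have fz : flip z = x by rewrite -fx flipK.
  apply: (G y z) => //; first by rewrite vX fz; perm_count.
  by rewrite ry fz.
have [fy|fy] := vw y my.
  move: fy; rewrite !inE flip_neq /= => /orP[] /eqP fy.
    by have := inv _ my; rewrite -(flipK y) fy fx.
  apply: (G x y) => //; first by rewrite vX fy; perm_count.
  by rewrite rx fy.
have [fz|fz] := vw z mz.
  move: fz; rewrite !inE flip_neq orbF => /orP[] /eqP fz.
    by have := inv _ mz; rewrite -(flipK z) fz fx.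
  by have := inv _ mz; rewrite -(flipK z) fz fy.
have wX : perm_eq (slots w) [:: flip x; flip y; flip z].
  have Uf : uniq [:: flip x; flip y; flip z].
    by rewrite -[[:: _; _; _]]/(map flip [:: x; y; z]) (map_inj_uniq flip_inj).
  have sub : {subset [:: flip x; flip y; flip z] <= slots w}.
    by move=> a; rewrite !inE => /or3P[] /eqP->.
  have [|_ E] := uniq_min_size Uf sub; first by rewrite w3.
  by apply: uniq_perm.
apply: (theta (x := x) (y := y) (z := z)) => //.
have p6 : perm_eq (slots v ++ slots w) [:: x; flip x; y; flip y; z; flip z].
  by rewrite vX; apply: perm_trans (perm_cat (perm_refl _) wX) _; perm_count.
by rewrite -(perm_uniq p6).
Qed.

Lemma Fbar_bdS2 r : bdS2 (n := 2) r -> Fbar r = 0.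
Proof.
case=> g gg tg; rewrite Fbar_bd.
have g2 := is_graph_size gg.
case: g g2 gg tg => [|v [|w []]] //= _ gg tg.
move: gg; rewrite /is_graph /= hedges2 => /and4P[U /allP cl _ /eqP E].
(* Rank 2 with two vertices means three edges, so the vertex opposite the tripod also has three
   slots. *)
have sE : size (slots v ++ slots w) = 6%N.
  have os := outs_perm U (introT allP cl).
  rewrite (perm_size os) size_cat size_map.
  move: E; rewrite /edges hedges2 size_map -/(outs _).
  by case: (size (outs _)) => [|[|[|[|n]]]].
have tv (u : tree) : tripod u -> size (slots u) = 3%N by case/andP=> _ /eqP.
have [t|t] : tripod v \/ tripod w by move: tg => /or3P[]; auto.
  have w3 : size (slots w) = 3%N by move: sE; rewrite size_cat (tv v t) => -[].
  by have [] := tripod_zero t U cl w3.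
have v3 : size (slots v) = 3%N.
  by move: sE; rewrite size_cat (tv w t) addnC => -[].
have pU : perm_eq (slots w ++ slots v) (slots v ++ slots w).
  by rewrite (perm_catC (slots w) (slots v)).
have Uwv : uniq (slots w ++ slots v) by rewrite (perm_uniq pU).
have clw a : a \in slots w ++ slots v -> flip a \in slots w ++ slots v.
  by rewrite !(perm_mem pU); apply: cl.
by have [] := tripod_zero t Uwv clw v3.
Qed.

Definition Fomega : Omega hH 2 -> V := quot_lift Fbar.

Lemma Fomega_linear : linear Fomega.
Proof.
apply: quot_lift_linear Fbar_bdS2.
exact: (Fbar_linear coc Ml Mi Mtau MSS).
Qed.

Lemma Fomega_ends x y (t : tree) : x.1 != y.1 -> perm_eq (slots t) (ends x y) ->
  Fomega (pr (@bdS2 k H hH 2) (grb hH 2 1 [:: t])) = sgn k x y *: phi x y t.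
Proof.
move=> xy tX; rewrite /Fomega (quot_lift_pr _ Fbar_bdS2).
  exact: (Fbar_ends coc Ml Mi Mtau MSS).
exact: (Fbar_linear coc Ml Mi Mtau MSS).
Qed.

End Boundary.

(** * From H (x) H to Omega_2 *)

(** The Jacobi form with its outer bracket rotated to the other side: IHX among the three ways of
    splitting four legs into two pairs. *)
Lemma rule_ihx4 (k : fieldType) (H : algType k) (hH : hopf H) (L : choiceType)
    (V : lmodType k) (X : seq L) (f : tree H L -> V) (s t u v : tm H L) :
    tree_rules hH X f -> perm_eq (slots (Br s t, Br u v)) X ->
  f (Br s t, Br u v) = - f (Br t u, Br s v) - f (Br u s, Br t v).
Proof.
move=> fX sX; have p1 : perm_eq (slots (Br (Br s t) u, v)) X by permX sX.
have := rule_ihx fX p1; rewrite -(rule_rotr fX) //.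
rewrite (rule_left fX (s := Br t u)); last by permX sX.
rewrite (rule_left fX (s := Br u s)); last by permX sX.
by move/eqP; rewrite -addrA addr_eq0 opprD => /eqP.
Qed.

Definition transp (a b n : nat) : nat := if n == a then b else if n == b then a else n.

Lemma transpK a b : involutive (transp a b).
Proof.
move=> n; rewrite /transp; case: (eqVneq n a) => [->|na].
  by rewrite eqxx; case: eqP.
by case: (eqVneq n b) => [->|nb]; rewrite ?eqxx // (negPf na) (negPf nb).
Qed.

(** [GName] asks for an injection of all names. The first transposition brings e to 0; the second
    brings the image of f, which is not 0, to 1 and fixes 0. *)
Lemma rename01 (e f : nat) : e != f ->
  exists g : nat -> nat, [/\ injective g, g e = 0%N & g f = 1%N].
Proof.
move=> ef; pose f' := transp e 0 f; exists (transp f' 1 \o transp e 0).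
have f'0 : (0%N == f') = false.
  rewrite /f' /transp eq_sym [f == e]eq_sym (negPf ef).
  by case: (eqVneq f 0%N) => [f0|/negPf]; rewrite // -f0 (negPf ef).
split; first by apply: inj_comp; apply/inv_inj/transpK.
  by rewrite /= {2}/transp eqxx /transp f'0.
by rewrite /= -/f' /transp eqxx.
Qed.

Section Omega.
Variables (k : fieldType) (H : algType k) (hH : hopf H).
Hypothesis coc : cocommutative hH.
Local Notation S := (antip hH).
Local Notation eps := (cou hH).
Local Notation D := (@copsum k H hH _).
Local Notation tree := (tree H hedge).
Local Notation tm := (tm H hedge).
Local Notation Om := (Omega hH 2).
Implicit Types (x y : hedge) (a b c d h : H).

Definition grO (r : freemod k (graph H 2 1)) : Om :=
  pr (@bdS2 k H hH 2) (pr (@slide_rel k H hH 2 1) (pr (@graph_rel k H hH 2 1) r)).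

Lemma grO_linear : linear grO.
Proof.
exact: linear_comp (linear_fun (pr _))
  (linear_comp (linear_fun (pr _)) (linear_fun (pr _))).
Qed.

Definition cls (t : tree) : Om := grO (gr 2 1 [:: t]).

Lemma grO_rel r : graph_rel hH r -> grO r = 0.
Proof. by move=> rr; rewrite /grO (pr_gen0 rr) !linear0. Qed.

(** Multilinearity of the decoration of the single vertex, [GDec] with nothing before or after
    it. *)
Lemma cls_hlie X : hlie_fun hH X cls.
Proof.
move=> r rX; have [s rE] := freeg_ind_lin r.
have Ol := grO_linear; have el := @ext_linear k H _ Om X cls.
have trK (u : treeOn H X) : tr X (val u) = << u >> :> freemod k (treeOn H X).
  by rewrite /tr valK.
pose q := [seq (z.1, val z.2) | z <- s].
have -> : ext cls r = grO (\sum_(z <- q) z.1 *: gr 2 1 ([::] ++ z.2 :: [::])).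
  rewrite rE (lin_sum el) (lin_sum Ol) big_map; apply: eq_bigr => z _.
  by rewrite (linZ el) (linZ Ol) /ext fextU.
apply/grO_rel/(@GDec k H hH 2 1 [::] X q [::]) => [z /mapP[d _ ->]|]; first exact: (valP d.2).
have pl := linear_fun (pr (@HLie_rel k H hH _ X)).
rewrite -[RHS](pr_gen0 rX) rE (lin_sum pl) big_map; apply: eq_bigr => z _.
by rewrite (linZ pl) /hl trK.
Qed.

Lemma cls_rules X : tree_rules hH X cls.
Proof. exact/hlie_fun_rules/cls_hlie. Qed.

Definition std_tree x y a b c d : tree :=
  (Br (Op a (Lf x)) (Op b (Lf y)), Br (Op c (Lf (flip x))) (Op d (Lf (flip y)))).

Lemma std_tree_slots x y a b c d : perm_eq (slots (std_tree x y a b c d)) (ends x y).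
Proof. by perm_count. Qed.

Lemma cls_flip x y a b c d : x.1 != y.1 ->
  cls (std_tree (flip x) y a b c d) = - cls (std_tree x y a b c d).
Proof.
move=> xy; have Ol := grO_linear.
have ex : x.1 \in edges [:: std_tree x y a b c d].
  by case: (x) (y) => e [] [f []]; rewrite /edges /= !inE eqxx ?orbT.
have := grO_rel (GFlip hH 2 1 ex).
rewrite (linD Ol) => /eqP; rewrite addrC addr_eq0 => /eqP E.
rewrite {2}/cls -E /cls; congr (grO (gr 2 1 [:: _])).
by rewrite /relab /std_tree /tbind /= !eqxx eq_sym (negPf xy).
Qed.

Lemma std_tree_swap x y a b c d : cls (std_tree x y a b c d) = cls (std_tree y x b a d c).
Proof.
have w := cls_rules (ends x y).
rewrite /std_tree (rule_as w); last by perm_count.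
rewrite (rule_asr w); last by perm_count.
by rewrite opprK.
Qed.

Lemma cls_flip2 x y a b c d : x.1 != y.1 ->
  cls (std_tree x (flip y) a b c d) = - cls (std_tree x y a b c d).
Proof.
by move=> xy; rewrite std_tree_swap cls_flip 1?eq_sym // std_tree_swap.
Qed.

Let e0 : hedge := (0%N, false).
Let f0 : hedge := (1%N, false).

(** The edges 0 and 1 both leave the first bracket and enter the second, with labels only at their
    tails. *)
Definition std a b : Om := cls (std_tree e0 f0 a b 1 1).

Lemma cls_slide h (a : hedge) (t : tree) :
  cls (treeput h a t) = cls (treeput (S h) (flip a) t).
Proof.
have Ol := grO_linear; apply/eqP; rewrite -subr_eq0 /cls -(linB Ol); apply/eqP.
by rewrite /grO (pr_gen0 (GSlide hH 2 1 [:: t] h a)) linear0.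
Qed.

(** The labels [c] and [d] slide along their edges to the other ends, where they become antipodes on
    the right. *)
Lemma cls_std0 a b c d : cls (std_tree e0 f0 a b c d) = std (a * S c) (b * S d).
Proof.
have w := cls_rules (ends e0 f0).
pose t (z : tm) : tree := (Br (Op a (Lf e0)) (Op b (Lf f0)), Br z (Op d (Lf (flip f0)))).
have -> : cls (std_tree e0 f0 a b c d) = cls (std_tree e0 f0 (a * S c) b 1 d).
  transitivity (cls (treeput c (flip e0) (t (Lf (flip e0))))); first by [].
  rewrite cls_slide flipK.
  transitivity (cls (Br (Op a (Op (S c) (Lf e0))) (Op b (Lf f0)),
    Br (Lf (flip e0)) (Op d (Lf (flip f0))))); first by [].
  by rewrite -(rule_mull w) // -(rule_unitrl w).
transitivity (cls (treeput d (flip f0)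
  (Br (Op (a * S c) (Lf e0)) (Op b (Lf f0)), Br (Op 1 (Lf (flip e0))) (Lf (flip f0))))).
  by [].
rewrite cls_slide flipK.
transitivity (cls (Br (Op (a * S c) (Lf e0)) (Op b (Op (S d) (Lf f0))),
    Br (Op 1 (Lf (flip e0))) (Lf (flip f0)))); first by [].
by rewrite -(rule_mulr w) // -(rule_unitrr w).
Qed.

Lemma cls_std x y a b c d : x.1 != y.1 ->
  cls (std_tree x y a b c d) = sgn k x y *: std (a * S c) (b * S d).
Proof.
move=> xy; have Ol := grO_linear.
have E0 (e f : nat) : e != f ->
    cls (std_tree (e, false) (f, false) a b c d) = std (a * S c) (b * S d).
  move=> ef; have [g [gi ge gf]] := rename01 ef.
  rewrite -cls_std0; apply/eqP; rewrite -subr_eq0 /cls -(linB Ol); apply/eqP.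
  have := grO_rel (GName hH 2 1 [:: std_tree (e, false) (f, false) a b c d] gi).
  by rewrite /= /std_tree /relab /tbind /= ge gf.
case: x y xy => [e []] [f []] /= ef; rewrite /sgn /= ?expr0 ?expr1 ?sqrrN ?expr1n.
- rewrite -[(e, true)]/(flip (e, false)) -[(f, true)]/(flip (f, false)).
  by rewrite cls_flip // cls_flip2 // opprK E0 // scale1r.
- by rewrite -[(e, true)]/(flip (e, false)) cls_flip // E0 // scaleN1r.
- by rewrite -[(f, true)]/(flip (f, false)) cls_flip2 // E0 // scaleN1r.
- by rewrite E0 // scale1r.
Qed.

Lemma std_bil : bilinear std.
Proof.
have w := cls_rules (ends e0 f0).
by split=> a; [apply: (rule_linl w) | apply: (rule_linr w)].
Qed.

Lemma std_tau a b : std a b = std b a.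
Proof. by rewrite /std std_tree_swap cls_std // /sgn expr0 scale1r S_1 !mulr1. Qed.

(** Turning the middle edge around exchanges tails and heads of both loops: the two orientation
    signs cancel and each label returns to a tail as its antipode. *)
Lemma std_SS a b : std a b = std (S a) (S b).
Proof.
have w := cls_rules (ends e0 f0).
rewrite {1}/std /std_tree (rule_sym w) //.
have -> : (Br (Op 1 (Lf (flip e0))) (Op 1 (Lf (flip f0))), Br (Op a (Lf e0)) (Op b (Lf f0)))
  = std_tree (flip e0) (flip f0) 1 1 a b by [].
by rewrite cls_std // /sgn sqrrN expr1n scale1r !mul1r.
Qed.

Let stdT : tensor H H -> Om := tlift std.

Lemma stdT_linear : linear stdT.
Proof. exact: tlift_linear std_bil.1 std_bil.2. Qed.

Lemma stdT_tens a b : stdT (tens a b) = std a b.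
Proof. exact: tlift_tens std_bil.1 std_bil.2 _ _. Qed.

(** The conjugated labels arise from pushing h_(1) into the bracket of the tails and h_(2) into that
    of the heads. On the middle edge these combine to S(h_(1)) h_(2), a scalar. *)
Lemma stdT_conj : conj_inv hH stdT.
Proof.
move=> h a b; have w := cls_rules (ends e0 f0); have Btl := stdT_linear.
have Bb := std_bil.
transitivity (D h (fun u v => D u (fun u1 u2 => D v (fun v1 v2 =>
    std (u1 * a * S u2) (v1 * b * S v2))))).
  rewrite (D_hom _ _ Btl); apply: eq_D => u v.
  rewrite /adj_action (D_hom _ _ (tens_linl _)) (D_hom _ _ Btl); apply: eq_D => u1 u2.
  rewrite (D_hom _ _ (tens_linr _)) (D_hom _ _ Btl); apply: eq_D => v1 v2.
  exact: stdT_tens.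
rewrite (D_swap coc _ (F := fun u1 u2 v1 v2 => std (u1 * a * S u2) (v1 * b * S v2)));
  [|by move=> *; lin..].
pose U : tm := Br (Op a (Lf e0)) (Op b (Lf f0)).
pose W : tm := Br (Lf (flip e0)) (Lf (flip f0)).
have WUX : perm_eq (slots (W, U)) (ends e0 f0) by [].
transitivity (D h (fun p q => cls (Op (S p * q) W, U))).
  apply: eq_D => p q.
  rewrite (rule_mul w) // (rule_sym w) // -(rule_inv w) // (rule_br w) //.
  apply: eq_D => u1 v1; rewrite (rule_sym w) // (rule_br w) //.
  apply: eq_D => u2 v2; rewrite (rule_sym w) // -(rule_mull w) // -(rule_mulr w) //.
  by rewrite -/(std_tree e0 f0 (u1 * a) (v1 * b) u2 v2) cls_std0.
have l : linear (fun g => cls (Op g W, U)) by apply: (rule_lin w).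
rewrite (D_antipl hH h l) (rule_unit w) // (rule_sym w) // stdT_tens /std /std_tree.
by rewrite (rule_unitrl w) // (rule_unitrr w).
Qed.

Lemma bdO (g : seq tree) : is_graph 2 2 g -> has (@tripod k H) g ->
  \sum_(e <- edges g | vtx g (e, false) != vtx g (e, true))
    (-1) ^+ (vtx g (e, false) + vtx g (e, true) +
             (vtx g (e, false) < vtx g (e, true)))%N *: grO (gr 2 1 (contract hH e g))
  = 0.
Proof.
move=> gg tg; have E := pr_gen0 (BdS2 hH gg tg).
have pl := linear_fun (pr (@bdS2 k H hH 2)).
rewrite /bd (lin_sum pl) in E; rewrite -[RHS]E; apply: eq_bigr => e _ /=.
by rewrite (linZ pl).
Qed.

Lemma connect2 (v w : tree) x : x \in slots v -> flip x \in slots w ->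
  flip x \notin slots v -> x \notin slots w ->
  [forall u, forall u', connect (@adj k H [:: v; w]) u u'].
Proof.
move=> xv xw fv fw.
have hx : x \in hedges [:: v; w] by rewrite hedges2 mem_cat xv.
have hf : flip x \in hedges [:: v; w] by rewrite hedges2 mem_cat xw orbT.
have Vx : vtx [:: v; w] x = 0%N by rewrite vtx2 xv.
have Vf : vtx [:: v; w] (flip x) = 1%N by rewrite vtx2 (negPf fv) xw.
apply/forallP => -[[|[|u]] //= ul]; apply/forallP => -[[|[|u']] //= ul'].
- by rewrite (_ : Ordinal ul = Ordinal ul') ?connect0 //; apply: val_inj.
- by apply: connect1; apply/hasP; exists x => //; rewrite Vx Vf.
- by apply: connect1; apply/hasP; exists (flip x) => //; rewrite flipK Vx Vf.
- by rewrite (_ : Ordinal ul = Ordinal ul') ?connect0 //; apply: val_inj.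
Qed.


Let sign2 : (-1 : k) ^+ (0 + 1 + 1) = 1.
Proof. by rewrite sqrrN expr1n. Qed.

(** A dumbbell with one loop label-free and the other labelled [b]. Contracting the bridge gives a
    tree that pairs both loops with themselves; IHX rewrites it as two standard trees, and each
    contributes the class of 1 (x) b. *)
Lemma std_eta2 b : std 1 b + std 1 b = 0.
Proof.
pose X := ends e0 f0; have w := cls_rules X.
pose v : tree := (Lf (0%N, false), Br (Lf (0%N, true)) (Lf (2%N, false))).
pose v' : tree := (Lf (2%N, true), Br (Op b (Lf (1%N, false))) (Lf (1%N, true))).
have gg : is_graph 2 2 [:: v; v'].
  rewrite /is_graph; apply/and5P; split=> //; apply/andP; split=> //.
  exact: (@connect2 _ _ (2%N, false)).
have := bdO gg isT; rewrite (_ : edges [:: v; v'] = [:: 0; 2; 1]%N) //.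
rewrite !big_cons big_nil /= addr0 sign2 scale1r.
pose E0 : tm := Lf e0; pose E1 : tm := Lf (flip e0).
pose F1 : tm := Lf (flip f0); pose F0 : tm := Lf f0.
have -> : contract hH 2 [:: v; v'] = [:: (E0, Br E1 (Br (Op b F0) F1))] by [].
rewrite -/(cls _) (rule_rotr w) // (rule_ihx4 w) // => /eqP.
have E2 : cls (Br E1 (Op b F0), Br E0 F1) = - std 1 b.
  transitivity (cls (std_tree (flip e0) f0 1 b 1 1)).
    rewrite /std_tree flipK (rule_unitl w) //.
    by rewrite (rule_unitrl w) // (rule_unitrr w).
  by rewrite cls_std // /sgn expr1 scaleN1r S_1 !mulr1.
have E3 : cls (Br (Op b F0) E0, Br E1 F1) = - std 1 b.
  rewrite (rule_as w) //; congr (- _); rewrite /std /std_tree (rule_unitl w) //.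
  by rewrite (rule_unitrl w) // (rule_unitrr w).
by rewrite E2 E3 !opprK => /eqP.
Qed.

(** The theta graph with one tripod label-free and the other labelled 1, a, b. Contracting the
    unlabelled edge gives the first term; contracting an edge with label a or b pushes that label
    through a bracket and gives the sum over its coproduct. *)
Lemma std_gam a b : std a b + D a (fun a1 a2 => std (S b * a1) a2)
                        + D b (fun b1 b2 => std b1 (S a * b2)) = 0.
Proof.
pose x : hedge := (0%N, false); pose y : hedge := (1%N, false).
pose z : hedge := (2%N, false); have Bb := std_bil.
pose v : tree := (Lf x, Br (Lf y) (Lf z)).
pose v' : tree := (Lf (flip x), Br (Op a (Lf (flip y))) (Op b (Lf (flip z)))).
have gg : is_graph 2 2 [:: v; v'].
  rewrite /is_graph; apply/and5P; split=> //; apply/andP; split=> //.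
  exact: (@connect2 _ _ x).
have := bdO gg isT; rewrite (_ : edges [:: v; v'] = [:: 0; 1; 2]%N) //.
rewrite !big_cons big_nil /= addr0 sign2 !scale1r.
have -> : contract hH 0 [:: v; v'] =
  [:: (Br (Op a (Lf (flip y))) (Op b (Lf (flip z))), Br (Lf y) (Lf z))] by [].
have -> : contract hH 1 [:: v; v'] = [:: (Lf x,
  Br (Op (S a) (Br (Op b (Lf (flip z))) (Lf (flip x)))) (Lf z))] by [].
have -> : contract hH 2 [:: v; v'] = [:: (Lf x,
  Br (Lf y) (Op (S b) (Br (Lf (flip x)) (Op a (Lf (flip y))))))] by [].
rewrite -!/(cls _) => <-; rewrite -addrA; congr (_ + (_ + _)).
- have w := cls_rules (ends y z).
  transitivity (cls (std_tree (flip y) (flip z) a b 1 1)).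
    by rewrite cls_std // /sgn sqrrN expr1n scale1r S_1 !mulr1.
  by rewrite /std_tree !flipK (rule_unitrl w) // (rule_unitrr w).
- have w := cls_rules (ends z x).
  rewrite (rule_sym w) // (rule_left w) // (rule_br w) // (D_S coc); last first.
    split=> u; first by apply: (rule_linl w).
    by apply: (rule_linr w).
  apply: eq_D => p q; rewrite -(rule_mull w) //.
  transitivity (cls (std_tree (flip z) (flip x) (S p * b) (S q) 1 1)).
    rewrite cls_std // /sgn sqrrN expr1n scale1r S_1 !mulr1.
    by rewrite [LHS]std_SS !S_mul !(S_invol coc).
  by rewrite /std_tree !flipK (rule_unitrl w) // (rule_unitrr w).
have w := cls_rules (ends x y).
rewrite (rule_rotr w) // (rule_sym w) // (rule_br w) // (D_S coc); last first.
  split=> u; first by apply: (rule_linl w).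
  by apply: (rule_linr w).
apply: eq_D => p q; rewrite -(rule_mulr w) //.
transitivity (cls (std_tree (flip x) (flip y) (S p) (S q * a) 1 1)).
  rewrite cls_std // /sgn sqrrN expr1n scale1r S_1 !mulr1.
  by rewrite [LHS]std_SS !S_mul !(S_invol coc).
by rewrite /std_tree !flipK (rule_unitrl w) // (rule_unitrr w).
Qed.

(** * The standard classes span Omega_2 *)

Section Span.
Variable U : Om -> Prop.
Hypotheses (U0 : U 0) (UZD : forall (l : k) (u v : Om), U u -> U v -> U (l *: u + v)).
Hypothesis UB : forall a b, U (std a b).

Lemma span_std p q a b c d : p.1 != q.1 -> U (cls (std_tree p q a b c d)).
Proof. by move=> pq; rewrite cls_std // -[_ *: _]addr0; apply: UZD. Qed.

(** If [p] is joined to the opposite bracket then so is [q], and the tree is standard up to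
    exchanging [r] and [s], which costs a sign. *)
Lemma span_H a b c d (p q r s : hedge) x y : x.1 != y.1 ->
  perm_eq [:: p; q; r; s] (ends x y) -> (flip p == r) || (flip p == s) ->
  U (cls (Br (Op a (Lf p)) (Op b (Lf q)), Br (Op c (Lf r)) (Op d (Lf s)))).
Proof.
move=> xy pX.
have Upq : uniq [:: p; q; r; s] by rewrite (perm_uniq pX) ends_uniq.
have cl u : u \in [:: p; q; r; s] -> flip u \in [:: p; q; r; s].
  rewrite !(perm_mem pX) !inE => /or4P[] /eqP->; by rewrite ?flipK eqxx ?orbT.
have w := cls_rules (ends x y).
have main r' s' : flip p = r' -> perm_eq [:: p; q; r'; s'] [:: p; q; r; s] ->
    r' = flip p /\ s' = flip q /\ p.1 != q.1.
  move=> pr pX'; have : flip q \in [:: p; q; r'; s'].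
    by rewrite (perm_mem pX'); apply: cl; rewrite !inE eqxx orbT.
  have Uq : uniq [:: p; q; r'; s'] by rewrite (perm_uniq pX').
  rewrite !inE flip_neq /=; move: (uniq4 Uq) => E /or3P[] /eqP fq.
  - by move: (uniq4 Uq); rewrite -pr -fq flipK eqxx => -[[[[[[[[[[[]]]]]]]]]]].
  - by move: (uniq4 Uq); rewrite -pr in fq; rewrite (flip_inj fq) eqxx => -[[[[[[[[[[[]]]]]]]]]]].
  split=> //; split=> //; apply: uniq_fst_neq; rewrite /ends fq pr.
  by rewrite -(perm_uniq (s1 := [:: p; q; r'; s'])) //; perm_count.
case/orP=> /eqP E.
  have [_ [sE pq]] := main _ _ E (perm_refl _).
  by rewrite -E sE; apply: span_std.
have [|_ [rE pq]] := main _ r E; first by perm_count.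
rewrite (rule_asr w); last by rewrite /slots /=.
apply: (U_opp U0 UZD); rewrite -E rE.
exact: span_std.
Qed.

(** When both loops close up within a bracket, IHX yields two trees in which they cross from one
    bracket to the other. *)
Lemma span_22 a b c d (p q r s : hedge) x y : x.1 != y.1 ->
  perm_eq [:: p; q; r; s] (ends x y) ->
  U (cls (Br (Op a (Lf p)) (Op b (Lf q)), Br (Op c (Lf r)) (Op d (Lf s)))).
Proof.
move=> xy pX; have [E|E] := boolP ((flip p == r) || (flip p == s)).
  exact: span_H pX E.
have w := cls_rules (ends x y).
have : flip p \in [:: p; q; r; s].
  have : p \in [:: p; q; r; s] by rewrite mem_head.
  by rewrite !(perm_mem pX) !inE => /or4P[] /eqP->; rewrite ?flipK eqxx ?orbT.
rewrite !inE flip_neq (negPf E) orbF => /eqP qE.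
rewrite (rule_ihx4 w) //; apply: (U_add UZD); apply: (U_opp U0 UZD).
  apply: (span_H _ _ _ _ xy); last by rewrite -qE flipK eqxx.
  by apply: perm_trans pX; perm_count.
rewrite (rule_as w); last by apply: perm_trans pX; perm_count.
apply: (U_opp U0 UZD); apply: (span_H _ _ _ _ xy); last by rewrite -qE eqxx.
by apply: perm_trans pX; perm_count.
Qed.

(** The root edge of a normal tree splits the four leaves as 1 + 3, 2 + 2 or 3 + 1; a rotation
    brings the unbalanced cases to 2 + 2. *)
Lemma span_tree x y (t : tree) : x.1 != y.1 -> perm_eq (slots t) (ends x y) ->
  U (cls t).
Proof.
move=> xy; have w := cls_rules (ends x y); apply: (nf_span w U0 UZD).
have gt0 (u : tm) : (0 < size (leaves u))%N by exact: leaves_gt0.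
have U13 a p (t' : tm) : normal t' -> size (leaves t') = 3%N ->
    perm_eq (slots (Op a (Lf p), t')) (ends x y) -> U (cls (Op a (Lf p), t')).
  case: t' => [q|t1 t2|g []] //= /andP[n1 n2]; rewrite size_cat => E.
  have t10 := gt0 t1; have t20 := gt0 t2.
  have main b q (t3 : tm) : normal t3 -> size (leaves t3) = 2%N ->
      perm_eq (slots (Op a (Lf p), Br (Op b (Lf q)) t3)) (ends x y) ->
      U (cls (Op a (Lf p), Br (Op b (Lf q)) t3)).
    move=> n3 E3 pX; have [c [r [d [s tE]]]] := nf_size2 n3 E3.
    rewrite (rule_rotr w) // tE; rewrite tE in pX.
    by apply: (span_22 _ _ _ _ xy); apply: perm_trans pX; perm_count.
  have [t11|t12] : size (leaves t1) = 1%N \/ size (leaves t1) = 2%N by lia.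
    have t22 : size (leaves t2) = 2%N by lia.
    by have [b [q ->]] := nf_size1 n1 t11; apply: main.
  have t21 : size (leaves t2) = 1%N by lia.
  have [b [q ->]] := nf_size1 n2 t21 => pX.
  rewrite (rule_asr w) //; apply: (U_opp U0 UZD); apply: main => //.
  by permX pX.
move=> s t' ns nt stX.
have E : (size (leaves s) + size (leaves t'))%N = 4%N.
  by rewrite -size_cat; apply: (perm_size stX).
have s0 : (0 < size (leaves s))%N by exact: leaves_gt0.
have t0 : (0 < size (leaves t'))%N by exact: leaves_gt0.
have [s1|[s2|s3]] : size (leaves s) = 1%N \/ size (leaves s) = 2%N \/
    size (leaves s) = 3%N by lia.
- have t3 : size (leaves t') = 3%N by lia.
  by have [a [p sE]] := nf_size1 ns s1; rewrite sE in stX *; apply: U13.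
- have t2 : size (leaves t') = 2%N by lia.
  have [a [p [b [q sE]]]] := nf_size2 ns s2.
  have [c [r [d [u tE]]]] := nf_size2 nt t2.
  by rewrite sE tE in stX *; apply: (span_22 _ _ _ _ xy).
have t1 : size (leaves t') = 1%N by lia.
have [a [p tE]] := nf_size1 nt t1; rewrite tE in stX *.
by rewrite (rule_sym w) //; apply: U13 => //; permX stX.
Qed.

Lemma span_Omega (v : Om) : U v.
Proof.
have [v1 ->] := pr_surj v; have [v2 ->] := pr_surj v1; have [r ->] := pr_surj v2.
have [s ->] := freeg_ind_lin r; rewrite -/(grO _) (lin_sum grO_linear).
elim: s => [|z s IHs]; first by rewrite big_nil.
rewrite big_cons (linZ grO_linear); apply: UZD => //.
have -> : << z.2 >> = gr 2 1 (val z.2) :> freemod k (graph H 2 1) by rewrite /gr valK.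
have gz := valP z.2; have := is_graph_size gz.
case: (val z.2) gz => [|t [|t' g]] //= gz _.
move: gz; rewrite is_graph1 => /two_edgesP[x [y [xy _ _ _ tX]]].
exact: span_tree xy tX.
Qed.

End Span.
End Omega.

(** * The two maps are inverse to each other *)

Section Isomorphism.
Variables (k : fieldType) (H : algType k) (hH : hopf H).
Hypotheses (char0 : [pchar k] =i pred0) (coc : cocommutative hH).
Local Notation S := (antip hH).
Local Notation D := (@copsum k H hH _).
Local Notation Q := (quot (@elt_rel k H hH)).

Definition elt_cls (z : tensor H H) : Q := pr (@elt_rel k H hH) (pr (@conj_rel k H hH 1) z).

Lemma elt_cls_linear : linear elt_cls.
Proof. exact: linear_comp (linear_fun (pr _)) (linear_fun (pr _)). Qed.

Lemma elt_cls_conj : conj_inv hH elt_cls.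
Proof. by move=> h a b; rewrite /elt_cls conj_cls (linZ (linear_fun (pr _))). Qed.

Lemma elt_cls_tau a b : elt_cls (tens a b) = elt_cls (tens b a).
Proof. by apply/pr_eqP/in_span_gen/EltTau. Qed.

Lemma elt_cls_SS a b : elt_cls (tens a b) = elt_cls (tens (S a) (S b)).
Proof. by apply/pr_eqP/in_span_gen/EltSS. Qed.

Lemma elt_cls_1 b : elt_cls (tens 1 b) = 0.
Proof. by apply/pr_gen0/EltEta. Qed.

Lemma elt_cls_gam a b : elt_cls (tens a b)
  + D a (fun a1 a2 => elt_cls (tens (S b * a1) a2))
  + D b (fun b1 b2 => elt_cls (tens b1 (S a * b2))) = 0.
Proof.
have pl := linear_fun (pr (@elt_rel k H hH)).
have := pr_gen0 (EltGam hH a b); rewrite elt_gamE !(linD pl).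
by rewrite !(D_hom _ _ pl).
Qed.

(** Characteristic 0 divides [std_eta2] by 2. *)
Lemma std_eta b : std hH 1 b = 0.
Proof.
have := std_eta2 hH b; rewrite -mulr2n -scaler_nat => /eqP.
rewrite scaler_eq0 => /orP[|/eqP//].
by have := char0 2; rewrite !inE /= => ->.
Qed.

Definition Bbar : Hbar hH 1 -> Omega hH 2 := quot_lift (tlift (std hH)).

Lemma Bbar_pr z : Bbar (pr (@conj_rel k H hH 1) z) = tlift (std hH) z.
Proof.
have Bl := stdT_linear hH.
exact: (quot_lift_pr Bl (conj_inv_ker Bl (stdT_conj coc))).
Qed.

Lemma Bbar_linear : linear Bbar.
Proof.
have Bl := stdT_linear hH.
exact: (quot_lift_linear Bl (conj_inv_ker Bl (stdT_conj coc))).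
Qed.

Lemma Bbar_elt z : elt_rel z -> Bbar z = 0.
Proof.
have Bb := std_bil hH; have Bl := stdT_linear hH; have stdT := stdT_tens hH.
case=> {z} [a b|a b|a|a b].
- by rewrite (linB Bbar_linear) !Bbar_pr !stdT (std_tau hH) subrr.
- by rewrite (linB Bbar_linear) !Bbar_pr !stdT (std_SS hH) subrr.
- by rewrite Bbar_pr stdT std_eta.
rewrite Bbar_pr !(linD Bl) !D_tlift; [|by lin..].
rewrite !(D_hom _ _ Bl) stdT -[RHS](std_gam coc a b).
by congr (_ + _ + _); apply: eq_D => x y; rewrite stdT.
Qed.

Definition Bquot : Q -> Omega hH 2 := quot_lift Bbar.

Lemma Bquot_eltM z : Bquot (elt_cls z) = tlift (std hH) z.
Proof. by rewrite /Bquot (quot_lift_pr Bbar_linear Bbar_elt) Bbar_pr. Qed.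

Lemma Bquot_linear : linear Bquot.
Proof. exact: (quot_lift_linear Bbar_linear Bbar_elt). Qed.

(** [Fomega] after [Bquot] is the identity, by [phi_std] on elementary tensors. [Bquot] is onto
    because standard classes span, so it is a two-sided inverse. *)
Lemma Omega_elt_iso : lin_iso (Omega hH 2) Q.
Proof.
have Fl : linear (@Fomega k H hH _ elt_cls).
  exact: (Fomega_linear coc elt_cls_linear elt_cls_conj elt_cls_tau elt_cls_SS elt_cls_1 elt_cls_gam).
have BF q : Fomega elt_cls (Bquot q) = q.
  have [z ->] := pr_surj q; have [u ->] := pr_surj z; rewrite -/(elt_cls u) Bquot_eltM.
  have Bl := stdT_linear hH.
  apply: (tensor_ext (linear_comp Fl Bl) elt_cls_linear) => a b.
  rewrite stdT_tens //.
  rewrite (Fomega_ends coc elt_cls_linear elt_cls_conj elt_cls_tau elt_cls_SS elt_cls_1 elt_cls_gam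
    (x := (0%N, false)) (y := (1%N, false)) isT (std_tree_slots _ _ _ _ _ _)).
  by rewrite /sgn expr0 scale1r phi_std ?S_1 ?mulr1 //; apply: elt_cls_linear.
exists (mklin Fl); exists Bquot => [v|q]; last exact: BF.
have [q <-] : exists q, Bquot q = v; last by rewrite /= BF.
apply: (span_Omega (U := fun v => exists q, Bquot q = v)).
- by exists 0; apply: lin0 Bquot_linear.
- by move=> l _ _ [q <-] [q' <-]; exists (l *: q + q'); apply: Bquot_linear.
by move=> a b; exists (elt_cls (tens a b)); rewrite Bquot_eltM stdT_tens.
Qed.

End Isomorphism.

Lemma lin_iso_trans (k : fieldType) (U V W : lmodType k) :
  lin_iso U V -> lin_iso V W -> lin_iso U W.
Proof.
move=> [f fb] [g gb].
by exists (mklin (linear_comp (linear_fun g) (linear_fun f))); apply: bij_comp.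
Qed.

Theorem theorem4p10 (k : fieldType) (H : algType k) (hH : hopf H) :
  [pchar k] =i pred0 -> cocommutative hH ->
  [/\ lin_iso (Omega hH 2) (quot (@op_rel k H hH)),
      lin_iso (Omega hH 2) (quot (@elt_rel k H hH)) &
      forall z : Hbar hH 1, in_span (@op_rel k H hH) z <-> in_span (@elt_rel k H hH) z].
Proof.
move=> char0 coc; have iso := Omega_elt_iso char0 coc; have E := op_elt_eq coc.
split; [|exact: iso|exact: E].
exact: (lin_iso_trans iso (quot_span_iso (fun z => iff_sym (E z)))).
Qed.
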